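(* Let $\mathcal{F}(x)=x^8+ax^4+b\in\mathbb{Z}[x]$ and $\mathcal{G}(x)=x^8+ax^6+bx^4+ax^2+1\in\mathbb{Z}[x]$ with $a\neq 0$ (for $\mathcal{G}$). (1) For each $X\in\{9,15,17,26\}$ there exists an infinite family of monogenic polynomials $\mathcal{F}(x)$ with Galois group 8T$X$. For each $X\in\{2,3,4,6,8,11,16,22\}$ there exist at most finitely many monogenic polynomials $\mathcal{F}(x)$ with Galois group 8T$X$. (2) For each $X\in\{9,18\}$ there exists an infinite family of monogenic polynomials $\mathcal{G}(x)$ with Galois group 8T$X$. For each $X\in\{2,3,4,10\}$ there exist at most finitely many monogenic polynomials $\mathcal{G}(x)$ with Galois group 8T$X$. Here a ''family'' means a set of polynomials no two of which generate isomorphic octic fields.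
   Context: A monic polynomial $f(x)\in\mathbb{Z}[x]$ of degree $N$ is called monogenic if $f$ is irreducible over $\mathbb{Q}$ and $\{1,\theta,\dots,\theta^{N-1}\}$ is a $\mathbb{Z}$-basis of the ring of integers of $\mathbb{Q}(\theta)$, where $f(\theta)=0$; equivalently $\Delta(f)=\Delta(\mathbb{Q}(\theta))$. Galois groups are over $\mathbb{Q}$. 8T$X$ denotes the $X$-th transitive subgroup of $S_8$ in the standard (Butler–McKay/Magma) numbering; in particular 8T2 $\cong C_2\times C_4$, 8T3 $\cong C_2^3$, 8T4 $\cong D_4$, 8T6 $\cong D_8$ (order 16), 8T8 $\cong Q_8\rtimes C_2$, 8T9 $\cong C_2\times D_4$, 8T10 $\cong C_2^2\rtimes C_4$, 8T11 $\cong C_4\circ D_4$, 8T15 $\cong C_8\rtimes C_2^2$, 8T16 $\cong C_4.D_4$, 8T17 $\cong C_4\wr C_2$, 8T18 $\cong C_2^2\wr C_2$, 8T22 $\cong D_4\circ D_4$, 8T26 $\cong \mathrm{Hol}(D_4)$. *)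

(* Defs.v *)
From HB Require Import structures.
From mathcomp Require Import all_boot all_order all_algebra all_fingroup all_field.
Set Implicit Arguments.
Unset Strict Implicit.
Unset Printing Implicit Defensive.
Import Order.TTheory GRing.Theory Num.Theory.
Local Open Scope ring_scope.

Definition polyF (a b : int) : {poly int} := 'X^8 + a%:P * 'X^4 + b%:P.
Definition polyG (a b : int) : {poly int} :=
  'X^8 + a%:P * 'X^6 + b%:P * 'X^4 + a%:P * 'X^2 + 1.

Definition polyZC (f : {poly int}) : {poly algC} := map_poly (fun z : int => z%:~R) f.
Definition polyQC (p : {poly rat}) : {poly algC} := map_poly (fun q : rat => ratr q) p.

Definition Qadj (theta : algC) (x : algC) : Prop :=
  exists p : {poly rat}, x = (polyQC p).[theta].

(* f monic in Z[x] is monogenic: f irreducible over Q and {1, theta, ...,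
   theta^(N-1)} (N = deg f) is a Z-basis of the ring of integers of Q(theta),
   i.e. every algebraic integer of Q(theta) is a Z-combination of
   1, theta, ..., theta^(N-1) (linear independence follows from irreducibility,
   and Z[theta] is always contained in the ring of integers). *)
Definition monogenic (f : {poly int}) : Prop :=
  [/\ f \is monic,
      irreducible_poly (map_poly (fun z : int => z%:~R) f : {poly rat})
    & forall theta : algC, root (polyZC f) theta ->
        forall alpha : algC, Qadj theta alpha -> alpha \in Aint ->
          exists q : {poly int}, (size q <= (size f).-1)%N /\
                                 alpha = (polyZC q).[theta] ].

Definition fields_iso (theta1 theta2 : algC) : Prop :=
  exists phi : algC -> algC,
    [/\ forall x, Qadj theta1 x -> Qadj theta2 (phi x),
        forall y, Qadj theta2 y -> exists2 x, Qadj theta1 x & phi x = y,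
        forall x y, Qadj theta1 x -> Qadj theta1 y -> phi x = phi y -> x = y,
        phi 1 = 1 /\
        forall x y, Qadj theta1 x -> Qadj theta1 y -> phi (x + y) = phi x + phi y
      & forall x y, Qadj theta1 x -> Qadj theta1 y -> phi (x * y) = phi x * phi y].

(* Permutations of {1..8}: cyc [:: a1; ...; ak] is the cycle (a1 ... ak),
   points written 1-based (point i is the ordinal i-1 of 'I_8).
   With MathComp's convention (s * t) x = t (s x),
   (a1 a2 ... ak) = (a1 a2)(a1 a3)...(a1 ak). *)
Local Close Scope ring_scope.
Definition pt (i : nat) : 'I_8 := inord i.-1.
Definition cyc (l : seq nat) : 'S_8 :=
  if l is a :: r then (\prod_(b <- r) tperm (pt a) (pt b))%g else 1%g.

(* Representatives of the transitive groups 8T_X of S_8 used in the theorem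
   (Butler--McKay / GAP / Magma numbering).  Each is a 2-group; the classes
   were identified by their isomorphism types. *)
Definition pr (l : seq (seq nat)) : 'S_8 := (\prod_(c <- l) cyc c)%g.
Definition gen_grp (l : seq 'S_8) : {set 'S_8} := <<[set x in l]>>%g.

Definition T8 (X : nat) : {set 'S_8} :=
  match X with
  | 2 => gen_grp [:: pr [:: [:: 1;2]; [:: 3;4]; [:: 5;6]; [:: 7;8]];
                     pr [:: [:: 1;5;4;8]; [:: 2;6;3;7]]]
  | 3 => gen_grp [:: pr [:: [:: 1;2]; [:: 3;4]; [:: 5;6]; [:: 7;8]];
                     pr [:: [:: 1;3]; [:: 2;4]; [:: 5;8]; [:: 6;7]];
                     pr [:: [:: 1;5]; [:: 2;6]; [:: 3;8]; [:: 4;7]]]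
  | 4 => gen_grp [:: pr [:: [:: 1;2]; [:: 3;4]; [:: 5;7]; [:: 6;8]];
                     pr [:: [:: 1;5;4;8]; [:: 2;6;3;7]]]
  | 6 => gen_grp [:: pr [:: [:: 3;4]; [:: 5;8]; [:: 6;7]];
                     pr [:: [:: 1;5]; [:: 2;6]; [:: 3;7]; [:: 4;8]]]
  | 8 => gen_grp [:: pr [:: [:: 3;4]; [:: 5;7]; [:: 6;8]];
                     pr [:: [:: 1;5;2;6]; [:: 3;7;4;8]]]
  | 9 => gen_grp [:: pr [:: [:: 5;8]; [:: 6;7]];
                     pr [:: [:: 1;2]; [:: 3;4]; [:: 5;6]; [:: 7;8]];
                     pr [:: [:: 1;5]; [:: 2;6]; [:: 3;7]; [:: 4;8]]]
  | 10 => gen_grp [:: pr [:: [:: 5;7]; [:: 6;8]];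
                     pr [:: [:: 1;5;2;6]; [:: 3;7;4;8]]]
  | 11 => gen_grp [:: pr [:: [:: 3;4]; [:: 5;6]];
                     pr [:: [:: 1;3]; [:: 2;4]; [:: 5;8]; [:: 6;7]];
                     pr [:: [:: 1;5]; [:: 2;6]; [:: 3;7]; [:: 4;8]]]
  | 15 => gen_grp [:: pr [:: [:: 5;6]; [:: 7;8]];
                     pr [:: [:: 3;4]; [:: 5;7]; [:: 6;8]];
                     pr [:: [:: 1;5]; [:: 2;6]; [:: 3;7]; [:: 4;8]]]
  | 16 => gen_grp [:: pr [:: [:: 3;4]; [:: 7;8]];
                     pr [:: [:: 1;5;3;7;2;6;4;8]]]
  | 17 => gen_grp [:: pr [:: [:: 5;7;6;8]];
                     pr [:: [:: 1;5]; [:: 2;6]; [:: 3;8]; [:: 4;7]]]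
  | 18 => gen_grp [:: pr [:: [:: 5;6]; [:: 7;8]];
                     pr [:: [:: 5;7]; [:: 6;8]];
                     pr [:: [:: 1;5]; [:: 2;6]; [:: 3;7]; [:: 4;8]]]
  | 22 => gen_grp [:: pr [:: [:: 5;6]; [:: 7;8]];
                     pr [:: [:: 3;4]; [:: 7;8]];
                     pr [:: [:: 1;3]; [:: 2;4]; [:: 5;7]; [:: 6;8]];
                     pr [:: [:: 1;5]; [:: 2;6]; [:: 3;7]; [:: 4;8]]]
  | 26 => gen_grp [:: pr [:: [:: 5;7;6;8]];
                     pr [:: [:: 3;4]; [:: 7;8]];
                     pr [:: [:: 1;5]; [:: 2;6]; [:: 3;7]; [:: 4;8]]]
  | _ => set0
  end.

Local Open Scope ring_scope.

(* The Galois group over Q of an octic f in Z[x] is (conjugate in S_8 to) the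
   permutation group H: for some labelling e : {1..8} -> roots of f (injective,
   hence onto the 8 roots when f is a separable octic), the permutations of
   the roots induced by the automorphisms of the algebraic closure algC of Q
   (equivalently, by Gal(splitting field / Q)) are exactly the elements of H. *)
Definition galois_group_is (f : {poly int}) (H : {set 'S_8}) : Prop :=
  exists e : 'I_8 -> algC,
    [/\ injective e,
        forall i, root (polyZC f) (e i)
      & forall s : 'S_8,
          (exists u : {rmorphism algC -> algC}, forall i, u (e i) = e (s i))
          <-> s \in H].

Definition infinite_family (adm : int -> int -> Prop)
    (P : int -> int -> {poly int}) (H : {set 'S_8}) : Prop :=
  exists ab : nat -> int * int,
    (forall n, [/\ adm (ab n).1 (ab n).2,
                   monogenic (P (ab n).1 (ab n).2)
                 & galois_group_is (P (ab n).1 (ab n).2) H]) /\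
    (forall n m, n <> m ->
       forall t1 t2 : algC,
         root (polyZC (P (ab n).1 (ab n).2)) t1 ->
         root (polyZC (P (ab m).1 (ab m).2)) t2 ->
         ~ fields_iso t1 t2).

Definition finitely_many (adm : int -> int -> Prop)
    (P : int -> int -> {poly int}) (H : {set 'S_8}) : Prop :=
  exists s : seq (int * int),
    forall a b, adm a b -> monogenic (P a b) -> galois_group_is (P a b) H ->
      (a, b) \in s.

Definition admF (a b : int) : Prop := True.
Definition admG (a b : int) : Prop := a <> 0.

(* Main.v *)
(** The roots of [polyF a b] are the ['i ^+ k * r] and ['i ^+ k * s] with [r^4 + s^4 = - a] and
    [r^4 * s^4 = b]; those of [polyG a b] are [x, - x, 1 / x, - 1 / x] and the same with [y].  So an
    automorphism permutes the roots in one of 64 ways, and it acts by signs on 'i,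
    [r^4 - s^4 = sqrt (a^2 - 4 b)] and [r^2 s^2 = sqrt b] (for [polyG]: on the square roots of
    [D = a^2 - 4 b + 8], [P = b + 2 - 2 a] and [Q = b + 2 + 2 a]).

    These signs determine a permutation modulo the Frattini subgroup.  Hence the Galois group is as
    large as possible once all the sign vectors occur, that is, once no product of the radicands is a
    square.  Families with this property and squarefree discriminant factors (provided by an
    elementary sieve) are monogenic by Dedekind's criterion, and their members are told apart by
    a prime at which one polynomial is separable and the other is not.

    Conversely, running through all the labellings of the roots shows that each of the small groups
    makes one of the signs trivial, so that one of the radicands is a square.  But if
    [polyF a b] is monogenic, [b] is squarefree and [a^2 - 4 b] has no square factor above 4: otherwise
    an element such as [(theta^6 + a theta^2) / p], whose square is integral, lies outside
    [Z[theta]].  The same holds for [P], [Q] and [D], and only finitely many [(a, b)] are left. *)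
From HB Require Import structures.
Require Import Defs.
From mathcomp Require Import all_boot all_order all_algebra all_fingroup all_field.
From mathcomp Require Import ring zify.
Set Implicit Arguments.
Unset Strict Implicit.
Unset Printing Implicit Defensive.
Import Order.TTheory GRing.Theory Num.Theory.
Local Open Scope ring_scope.

(** The three generic signs are dependent exactly where much of the statement lives: [b = 1] (a
    rational square root), [b = -1] (its square root is 'i up to sign), [a = 0] (then [d = - 4 b]),
    and [P = 1] or [Q = 1] for [polyG]. There the roots can be chosen with an extra relation,
    [r * s = 1], [r * s = z] or [s = z * r] with [z ^+ 2 = 'i], or a product such as
    [(x + 1/x) (y + 1/y)] equal to 1. Fewer permutations remain admissible, but new square roots
    appear, of [2 - a] and [- 2 - a], of 2, of [6 - a] and [2 - a]. Each such case therefore has its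
    own list of permutations and its own signs. Finiteness needs two rounds for this reason: the
    generic signs may only yield a condition like [b = 1], and the refined signs then bound [a]. All
    statements about groups are moved to lists of numbers, where they are decided by evaluation. The
    one Diophantine condition that does not collapse at once is that [D * P * Q] is a square; it is
    resolved in [bounded_product]. The moduli in the parameters of the families keep the
    discriminant factors odd up to a power of 2 and pairwise coprime, and secure the behaviour at
    2. *)

Lemma quadratic_automorphism (z : algC) :
  z ^+ 2 \in Crat -> z \notin Crat -> exists u : {rmorphism algC -> algC}, u z = - z.
Proof.
move=> /CratP [q Dq] nz.
have [Qn [QnC [[|zn []] // [Dz]]] genQn] := num_field_exists [:: z].
have zn2 : zn ^+ 2 = q%:A.
  by apply: (fmorph_inj QnC); rewrite rmorphXn /= Dz Dq alg_num_field fmorph_rat.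
have nzn : zn \notin 1%VS.
  apply: contra nz => /vlineP [k Dk]; apply/CratP; exists k.
  by rewrite -Dz Dk alg_num_field fmorph_rat.
have dv : minPoly 1 zn %| 'X^2 - (q%:A)%:P.
  apply: minPoly_dvdp; first by rewrite rpredB ?rpredX ?polyOverX // polyOverC rpredZ ?mem1v.
  by rewrite /root !hornerE zn2 subrr.
have szm : size (minPoly 1 zn) = 3%N.
  apply/eqP; rewrite eqn_leq; apply/andP; split.
    have := dvdp_leq _ dv; rewrite size_XnsubC // => -> //.
    by rewrite -size_poly_eq0 size_XnsubC.
  rewrite size_minPoly ltnS ltn_neqAle eq_sym adjoin_deg_eq1 nzn /=.
  by rewrite /adjoin_degree.
have Dm : minPoly 1 zn = 'X^2 - (q%:A)%:P.
  apply/eqP; rewrite -eqp_monic ?monic_minPoly ?monicXnsubC // -dvdp_size_eqp //.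
  by rewrite szm size_XnsubC.
(* Since [zn] has minimal polynomial [X^2 - q], of which [- zn] is the other root, [zn |-> - zn]
   extends to the quadratic field; from there it is extended to all of [algC]. *)
pose phi := kHomExtend 1 \1 zn (- zn).
have homQn1: kHom 1 1 (\1%VF : 'End(Qn)) by rewrite kHom1.
have rt : root (map_poly \1%VF (minPoly 1 zn)) (- zn).
  rewrite map_poly_id => [|x _]; last by rewrite id_lfunE.
  by rewrite Dm /root !hornerE sqrrN zn2 subrr.
have phim : monoid_morphism phi.
  by apply/kHom_monoid_morphism; rewrite -genQn span_seq1 /= kHomExtendP.
pose phimM := GRing.isMonoidMorphism.Build _ _ phi phim.
pose phiRM : {rmorphism _ -> _} := HB.pack (fun_of_lfun phi) phimM.
have [nu Dnu] := extend_algC_subfield_aut QnC phiRM.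
exists nu; by rewrite -Dz -Dnu /= /phi (kHomExtend_val homQn1 rt) rmorphN.
Qed.

Lemma Crat_sqr_int (z : algC) (N : int) :
  z ^+ 2 = N%:~R -> z \in Crat -> exists k : int, N = k ^+ 2.
Proof.
move=> zN zQ.
have /intrP [k Dk] : z \in Num.int.
  apply: Cint_rat_Aint => //; apply: (@root_monic_Aint ('X^2 - (N%:~R)%:P)).
  - by rewrite /root !hornerE zN subrr.
  - by rewrite monicXnsubC.
  apply/polyOverP=> i; rewrite coefB coefC coefXn -mulrb.
  by rewrite rpredB ?rpred_nat // rpredMn // rpred_int.
exists k; apply/eqP; rewrite -(eqr_int algC) -zN Dk.
by rewrite rmorphXn.
Qed.

Lemma nonsquare_automorphism (z : algC) (N : int) :
  z ^+ 2 = N%:~R -> (forall k : int, N <> k ^+ 2) ->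
  exists u : {rmorphism algC -> algC}, u z = - z.
Proof.
move=> zN Nns; apply: quadratic_automorphism.
  by rewrite zN rpred_int.
by apply/negP=> /(Crat_sqr_int zN) [k /Nns].
Qed.

(** * Permutations of eight points as lists *)

Definition ptab (s : 'S_8) : seq nat := [seq val (s i) | i <- enum 'I_8].
Definition wfp (p : seq nat) : bool := (size p == 8%N) && all (fun k => (k < 8)%N) p.
Definition lcomp (p q : seq nat) : seq nat := [seq nth 0%N p k | k <- q].
(** Conjugation by the labelling [c]: the result sends [c_i] to [c_(t_i)], [index] serving as the
    inverse of [c]. *)
Definition lconj (c t : seq nat) : seq nat :=
  [seq nth 0%N c (nth 0%N t (index k c)) | k <- iota 0 8].

Definition swapL (a b y : nat) : nat := if y == a then b else if y == b then a else y.
Definition cycL (c : seq nat) (y : nat) : nat :=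
  if c is a :: r then foldl (fun z b => swapL a.-1 b.-1 z) y r else y.
Definition prL (l : seq (seq nat)) : seq nat :=
  [seq foldl (fun z c => cycL c z) y l | y <- iota 0 8].

(** Breadth-first closure. Only soundness is proved (listed elements belong to the group); a list
    cut short would merely make a check evaluate to [false]. The fuel 64 is the largest group order
    that occurs. *)
Fixpoint span_perms (fuel : nat) (gens seen frontier : seq (seq nat)) : seq (seq nat) :=
  if fuel is fuel'.+1 then
    let step := foldl (fun acc x => if x \in acc.1 then acc else (x :: acc.1, x :: acc.2))
                  (seen, [::]) [seq lcomp g x | g <- gens, x <- frontier] in
    if step.2 is [::] then seen else span_perms fuel' gens step.1 step.2
  else seen.
Definition gen_perms (gens : seq (seq nat)) : seq (seq nat) :=
  span_perms 64 gens [:: iota 0 8] [:: iota 0 8].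

Lemma span_permsP (P : seq nat -> Prop) (gens : seq (seq nat)) :
  (forall g x, g \in gens -> P x -> P (lcomp g x)) ->
  forall fuel seen front, (forall x, x \in seen -> P x) -> (forall x, x \in front -> P x) ->
  forall x, x \in span_perms fuel gens seen front -> P x.
Proof.
move=> PM; elim=> [|fuel IH] seen front Hs Hf //=.
set l := [seq _ | g <- _, x <- _].
have Hl : forall x, x \in l -> P x.
  by move=> x /allpairsP [[g y] /= [gin yin ->]]; apply: PM => //; apply: Hf.
have : forall acc : seq (seq nat) * seq (seq nat),
    (forall x, x \in acc.1 -> P x) -> (forall x, x \in acc.2 -> P x) ->
    let acc' := foldl (fun acc x => if x \in acc.1 then acc else (x :: acc.1, x :: acc.2)) acc l in
    (forall x, x \in acc'.1 -> P x) /\ (forall x, x \in acc'.2 -> P x).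
  elim: l Hl => [|y l IHl] Hl acc H1 H2 //=.
  have Hy : P y by apply: Hl; rewrite inE eqxx.
  apply: IHl.
  - by move=> x xl; apply: Hl; rewrite inE xl orbT.
  - case: ifP => _ x /=; first exact: H1.
    by rewrite inE => /orP [/eqP ->|/H1 //].
  case: ifP => _ x /=; first exact: H2.
  by rewrite inE => /orP [/eqP ->|/H2 //].
move=> /(_ (seen, [::]) Hs) [//|H1 H2].
by case: (foldl _ _ _) H1 H2 => s' [|y f] /= H1 H2 //; apply: IH.
Qed.

Lemma gen_permsP (P : seq nat -> Prop) (gens : seq (seq nat)) :
  P (iota 0 8) -> (forall g x, g \in gens -> P x -> P (lcomp g x)) ->
  forall x, x \in gen_perms gens -> P x.
Proof.
by move=> P1 PM; apply: span_permsP => // x; rewrite inE => /eqP ->.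
Qed.

Lemma size_ptab s : size (ptab s) = 8%N.
Proof. by rewrite size_map size_enum_ord. Qed.

Lemma nth_ptab s (i : 'I_8) : nth 0%N (ptab s) i = s i.
Proof.
by rewrite (nth_map i) ?size_enum_ord // nth_ord_enum.
Qed.

Lemma ptab_inj : injective ptab.
Proof.
by move=> s t st; apply/permP => i; apply: val_inj; rewrite /= -!nth_ptab st.
Qed.

Lemma eq_ptab (s : 'S_8) (p : seq nat) : size p = 8%N -> (forall i : 'I_8, nth 0%N p i = s i) -> ptab s = p.
Proof.
move=> sp Hp; apply: (@eq_from_nth _ 0%N); first by rewrite size_ptab.
by move=> k; rewrite size_ptab => k8; rewrite (nth_ptab s (Ordinal k8)) -Hp.
Qed.

Lemma ptabM s t : ptab (s * t)%g = lcomp (ptab t) (ptab s).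
Proof.
apply: eq_ptab; first by rewrite size_map size_ptab.
move=> i; rewrite (nth_map 0%N) ?size_ptab // nth_ptab permM.
by rewrite nth_ptab.
Qed.

Lemma ptab1 : ptab 1%g = iota 0 8.
Proof. by apply: eq_ptab => // i; rewrite perm1 nth_iota. Qed.

Definition cyc_ok (c : seq nat) := all (fun k => (0 < k <= 8)%N) c.

Lemma pt_val k : (0 < k <= 8)%N -> val (pt k) = k.-1.
Proof. by move=> Hk; rewrite /pt /= inordK //; lia. Qed.

Lemma cycL_val c (i : 'I_8) : cyc_ok c -> val (cyc c i) = cycL c i.
Proof.
case: c => [|a r] /=; first by rewrite perm1.
move=> /andP [Ha]; rewrite /cyc /=.
elim: r i => [|b r IH] i /=; first by rewrite big_nil perm1.
move=> /andP [Hb Hr]; rewrite big_cons permM IH //; congr (foldl _ _ _).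
rewrite /swapL -!(pt_val Ha) -!(pt_val Hb) !val_eqE.
by case: tpermP => [->|->|/eqP/negPf -> /eqP/negPf ->] //; rewrite ?eqxx //; case: eqP => // ->.
Qed.

Lemma ptab_pr l : all cyc_ok l -> ptab (pr l) = prL l.
Proof.
move=> Hl; apply: eq_ptab; first by rewrite size_map size_iota.
move=> i; rewrite (nth_map 0%N) ?size_iota // nth_iota // add0n /pr.
elim: l i Hl => [|c l IH] i /=; first by rewrite big_nil perm1.
by move=> /andP [Hc Hl]; rewrite big_cons permM -IH // -cycL_val.
Qed.

Lemma gen_grp_gen (l : seq 'S_8) s : ptab s \in gen_perms (map ptab l) -> s \in gen_grp l.
Proof.
move=> Hs; have [t tin /ptab_inj -> //] : exists2 t, t \in gen_grp l & ptab s = ptab t.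
move: {s} (ptab s) Hs; apply: gen_permsP.
  by exists 1%g; rewrite ?group1 // ptab1.
move=> g x /mapP [h hl ->] [t tl ->]; exists (t * h)%g; last by rewrite ptabM.
by rewrite groupM // mem_gen // inE.
Qed.

(** In a finite group the products of generators, without inverses, already give everything. *)
Lemma gen_grp_ind (l : seq 'S_8) (P : 'S_8 -> Prop) :
  P 1%g -> (forall g s, g \in l -> P s -> P (s * g)%g) -> forall s, s \in gen_grp l -> P s.
Proof.
move=> P1 PM s /gen_prodgP [n [c Hc ->]].
elim: n c Hc => [|n IH] c Hc; first by rewrite big_ord0.
rewrite big_ord_recr /=; apply: PM; first by have := Hc ord_max; rewrite inE.
by apply: IH => i; apply: Hc.
Qed.

(** * Galois groups computed from permutations of a list of roots *)

Definition induces (R : seq algC) (u : {rmorphism algC -> algC}) (p : seq nat) : Prop :=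
  forall k, (k < 8)%N -> u (nth 0 R k) = nth 0 R (nth 0%N p k).

Lemma induces_id R : induces R idfun (iota 0 8).
Proof. by move=> k k8; rewrite nth_iota. Qed.

Lemma wfp_nth p k : wfp p -> (k < 8)%N -> (nth 0%N p k < 8)%N.
Proof. by move=> /andP [/eqP sp /allP Hp] k8; apply: Hp; rewrite mem_nth ?sp. Qed.

Lemma wfp_lcomp p q : wfp p -> wfp q -> wfp (lcomp p q).
Proof.
move=> Hp /andP [sq /allP Hq]; rewrite /wfp size_map sq; apply/allP => _ /mapP [k kq ->].
by apply: wfp_nth => //; apply: Hq.
Qed.

Lemma induces_comp R u v p q : wfp q ->
  induces R u p -> induces R v q -> induces R (u \o v) (lcomp p q).
Proof.
move=> Hq Hu Hv k k8 /=; rewrite Hv // Hu ?wfp_nth //.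
by rewrite (nth_map 0%N) //; case/andP: Hq => /eqP ->.
Qed.

(* A tuple of permutations with prescribed signs generates the whole group as soon as the
   signs separate the maximal subgroups (Burnside basis theorem); here it is
   tested by running through all the tuples. *)
Fixpoint generating (V : eqType) (Dom : seq (seq nat)) (sgn : seq nat -> V)
    (target : seq (seq nat)) (vs : seq V) (acc : seq (seq nat)) : bool :=
  if vs is v :: vs' then
    all (fun p => if sgn p == v then generating Dom sgn target vs' (p :: acc) else true) Dom
  else let S := gen_perms acc in all (fun g => g \in S) target.

Lemma generatingP (V : eqType) Dom (sgn : seq nat -> V) target vs acc (P : seq nat -> Prop) :
  (forall v, v \in vs -> exists p, [/\ p \in Dom, P p & sgn p = v]) ->
  (forall p, p \in acc -> P p) -> generating Dom sgn target vs acc ->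
  P (iota 0 8) -> (forall p q, P p -> P q -> P (lcomp p q)) ->
  forall g, g \in target -> P g.
Proof.
move=> Hvs Hacc Hg P1 PM; elim: vs acc Hvs Hacc Hg => [|v vs IH] acc /= Hvs Hacc.
  move=> /allP Ht g /Ht; apply: gen_permsP => // h x hin; apply: PM; exact: Hacc.
move=> /allP Hg; have [|p [pD Pp /eqP sp]] := Hvs v; first by rewrite inE eqxx.
have {Hg} := Hg p pD; rewrite sp; apply: IH => [w win|q].
  by apply: Hvs; rewrite inE win orbT.
by rewrite inE => /orP [/eqP ->|/Hacc].
Qed.

Definition label_ok (c : seq nat) := [&& wfp c & uniq c].

(** The list [c] is the labelling: point [i] of the abstract group, counted from 0, stands for root
    number [c_i]. *)
Definition galois_check (V : eqType) (Dom : seq (seq nat)) (sgn : seq nat -> V)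
    (vs : seq V) (c : seq nat) (gl : seq (seq (seq nat))) : bool :=
  let T := gen_perms (map prL gl) in
  let cT := map (lconj c) T in
  [&& all wfp Dom, label_ok c, all (all cyc_ok) gl, all wfp T,
      all (fun p => p \in cT) Dom
    & generating Dom sgn (map (lconj c) (map prL gl)) vs [::] ].

Lemma nth_lconj c t i : label_ok c -> (i < 8)%N ->
  nth 0%N (lconj c t) (nth 0%N c i) = nth 0%N c (nth 0%N t i).
Proof.
move=> /andP [wc uc] i8; have sc : size c = 8%N by case/andP: wc => /eqP.
by rewrite (nth_map 0%N) ?size_iota ?wfp_nth // nth_iota ?wfp_nth // add0n index_uniq ?sc.
Qed.

(** Upper bound: every automorphism induces an element of [Dom], hence of the relabelled group.
    Lower bound: the induced permutations are closed under composition and realize each sign vector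
    of [vs], and by the check any such choice of permutations generates the relabelled
    generators. *)
Lemma galois_group_check (V : eqType) (f : {poly int}) (R : seq algC) Dom
    (sgn : seq nat -> V) vs c gl :
  size R = 8%N -> uniq R -> (forall x, x \in R -> root (polyZC f) x) ->
  (forall u, exists2 p, p \in Dom & induces R u p) ->
  (forall v, v \in vs -> exists p, [/\ p \in Dom, exists u, induces R u p & sgn p = v]) ->
  galois_check Dom sgn vs c gl ->
  galois_group_is f (gen_grp (map pr gl)).
Proof.
move=> sR uR rR Hind Hreal /and5P [/allP wDom lc okgl /allP wT /andP [/allP HDom Hgen]].
have wc : wfp c by case/andP: lc.
have uc : uniq c by case/andP: lc.
have sc : size c = 8%N by case/andP: wc => /eqP.
pose e (i : 'I_8) := nth 0 R (nth 0%N c i).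
have Te : map ptab (map pr gl) = map prL gl.
  by rewrite -map_comp; apply/eq_in_map => l lin /=; rewrite ptab_pr //; move/allP: okgl; apply.
exists e; split.
- move=> i j /eqP; rewrite nth_uniq ?sR ?wfp_nth // nth_uniq ?sc // => /eqP.
  exact: val_inj.
- by move=> i; apply: rR; rewrite mem_nth // sR wfp_nth.
move=> s; split.
  move=> [u Hu]; have [p pD Hp] := Hind u.
  have /mapP [t tT Dp] := HDom p pD.
  apply: gen_grp_gen; rewrite Te; suff -> : ptab s = t by [].
  have wt := wT t tT; apply: eq_ptab; first by case/andP: wt => /eqP.
  move=> i; have := Hu i; rewrite /e Hp ?wfp_nth // Dp nth_lconj // => /eqP.
  have ti8 : (nth 0%N t i < 8)%N by apply: wfp_nth.
  by rewrite nth_uniq ?sR ?wfp_nth // nth_uniq ?sc // => /eqP ->.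
move: s; apply: gen_grp_ind.
  by exists idfun => i; rewrite perm1.
move=> g s gin [u Hu].
pose P p := wfp p /\ exists u, induces R u p.
have : P (lconj c (ptab g)).
  apply: (generatingP (P := P) _ _ Hgen) => //.
  - move=> v /Hreal [p [pD Hp sp]]; exists p; split=> //; split=> //; exact: wDom.
  - by split=> //; exists idfun; apply: induces_id.
  - move=> p q [wp [v Hv]] [wq [w Hw]]; split; first exact: wfp_lcomp.
    by exists (v \o w); apply: induces_comp.
  by rewrite -Te !map_f.
move=> [_ [v Hv]]; exists (v \o u) => i /=.
by rewrite Hu /e Hv ?wfp_nth // nth_lconj // nth_ptab permM.
Qed.

(** * Realizing all sign vectors by automorphisms *)

Lemma all_signs2 (V : bool -> bool -> Prop) :
  (forall a b a' b', V a b -> V a' b' -> V (a (+) a') (b (+) b')) ->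
  (exists b, V true b) -> (exists a, V a true) -> (exists a, V a (~~ a)) ->
  forall a b, V a b.
Proof.
move=> VD [b Vb] [a Va] [c Vc].
have V00 : V false false by have := VD _ _ _ _ Vb Vb; rewrite !addbb.
have V10 : V true false.
  case: b Vb => // Vb; case: c Vc => //= Vc.
  exact: VD Vb Vc.
have V01 : V false true.
  case: a Va => // Va; exact: VD Va V10.
by move=> [] []; [exact: VD V10 V01| | |].
Qed.

(** As in the two-dimensional case, [V] is a subspace of F_2^3 and each existence hypothesis says
    that one of the nonzero linear forms, here seven, does not vanish on it. A subspace contained in
    no hyperplane is the whole space. *)
Lemma all_signs3 (V : bool -> bool -> bool -> Prop) :
  (forall a b c a' b' c', V a b c -> V a' b' c' -> V (a (+) a') (b (+) b') (c (+) c')) ->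
  (exists b c, V true b c) -> (exists a c, V a true c) -> (exists a b, V a b true) ->
  (exists a c, V a (~~ a) c) -> (exists a b, V a b (~~ a)) -> (exists a b, V a b (~~ b)) ->
  (exists a b, V a b (~~ (a (+) b))) ->
  forall a b c, V a b c.
Proof.
move=> VD H1 H2 H3 H12 H13 H23 H123.
have V12 a b : exists c, V a b c.
  move: a b; apply: all_signs2 => [a b a' b' [c Vc] [c' Vc']|||].
  - by exists (c (+) c'); apply: VD.
  - by case: H1 => b [c Vc]; exists b, c.
  - by case: H2 => a [c Vc]; exists a, c.
  by case: H12 => a [c Vc]; exists a, c.
have V13 a b : exists c, V a c b.
  move: a b; apply: all_signs2 => [a b a' b' [c Vc] [c' Vc']|||].
  - by exists (c (+) c'); apply: VD.
  - by case: H1 => b [c Vc]; exists c, b.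
  - by case: H3 => a [c Vc]; exists a, c.
  by case: H13 => a [c Vc]; exists a, c.
(* The plane with middle coordinate [false] is covered by the two-dimensional case; its other coset
   is then reached by adding one vector from [H2]. *)
have V0 a c : V a false c.
  move: a c; apply: all_signs2 => [a b a' b' Va Vb|||].
  - exact: VD Va Vb.
  - by case: (V12 true false) => c; exists c.
  - have : forall b c, exists a, V a b c.
      apply: all_signs2 => [a b a' b' [c Vc] [c' Vc']|||].
      + by exists (c (+) c'); apply: VD.
      + by case: H2 => a [c Vc]; exists c, a.
      + by case: H3 => a [c Vc]; exists c, a.
      by case: H23 => a [c Vc]; exists c, a.
    by move=> /(_ false true).
  (* Here [s] is the sum of the outer coordinates: the pairs (first plus third, second) fill
     F_2^2. *)
  have : forall s b, exists a, V a b (s (+) a).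
    apply: all_signs2 => [s b s' b' [c Vc] [c' Vc']|||].
    + by exists (c (+) c'); rewrite addbACA; apply: VD.
    + by case: H13 => a [c Vc]; exists c, a.
    + by case: H2 => a [c Vc]; exists (a (+) c), a; rewrite addbAC addbb.
    case: H123 => a [b Vb]; exists (~~ b), a; rewrite negbK.
    by rewrite addbC -addbN in Vb *; rewrite addbN addNb in Vb *.
  by move=> /(_ true false) [a Va]; exists a.
move=> a [] c //; have [x [y Vxy]] := H2.
by have := VD _ _ _ _ _ _ (V0 (a (+) x) (c (+) y)) Vxy; rewrite -?addbA ?addbb ?addbF.
Qed.

(** The quadratic Kummer character attached to a square root [z], with its value read off the
    permutation of the roots. *)
Definition sign_char (R : seq algC) (Dom : seq (seq nat)) (sgn : seq nat -> bool) (z : algC) :=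
  forall u p, p \in Dom -> induces R u p -> u z = (-1) ^+ sgn p * z.

Lemma sign_charM R Dom s1 s2 z1 z2 : sign_char R Dom s1 z1 -> sign_char R Dom s2 z2 ->
  sign_char R Dom (fun p => s1 p (+) s2 p) (z1 * z2).
Proof.
move=> H1 H2 u p pD Hp; rewrite rmorphM (H1 u p) // (H2 u p) // signr_addb.
by rewrite mulrACA.
Qed.

Lemma sign_char_true R Dom s z (u : {rmorphism algC -> algC}) p : z != 0 ->
  sign_char R Dom s z -> p \in Dom -> induces R u p -> u z = - z -> s p.
Proof.
move=> z0 Hs pD Hp uz; have := Hs u p pD Hp; rewrite uz; case: (s p) => // /eqP.
by rewrite expr0 mul1r eq_sym -addr_eq0 -mulr2n mulrn_eq0 (negPf z0).
Qed.

Definition nonsquare (N : int) := forall k : int, N <> k ^+ 2.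

Lemma nonsquare_neq0 (z : algC) N : z ^+ 2 = N%:~R -> nonsquare N -> z != 0.
Proof.
move=> zN Nns; apply: contra_notN (Nns 0) => /eqP z0.
by move: zN; rewrite z0 !expr0n /= => /esym/eqP; rewrite intr_eq0 => /eqP.
Qed.

Lemma nonsquare_sign R Dom s z N :
  (forall u, exists2 p, p \in Dom & induces R u p) ->
  sign_char R Dom s z -> z ^+ 2 = N%:~R -> nonsquare N ->
  exists p, [/\ p \in Dom, exists u, induces R u p & s p].
Proof.
move=> Hind Hs zN Nns; have [u uz] := nonsquare_automorphism zN Nns.
have [p pD Hp] := Hind u; exists p; split=> //; first by exists u.
exact: (sign_char_true (nonsquare_neq0 zN Nns) Hs pD Hp uz).
Qed.

Lemma sign_char_comp R Dom s z (u v : {rmorphism algC -> algC}) p q t : z != 0 ->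
  sign_char R Dom s z -> p \in Dom -> induces R u p -> q \in Dom -> induces R v q ->
  t \in Dom -> induces R (u \o v) t -> s t = s p (+) s q.
Proof.
move=> z0 Hs pD Hp qD Hq tD Ht; have := Hs _ t tD Ht.
rewrite /= (Hs _ q qD Hq) rmorphM rmorph_sign (Hs _ p pD Hp) mulrA -signr_addb (addbC (s q)).
have zz : z <> - z by move=> /eqP; rewrite -addr_eq0 -mulr2n mulrn_eq0 (negPf z0).
by case: (s t) (s p (+) s q) => [] []; rewrite ?(mul1r, mulN1r) // => /esym.
Qed.

Lemma all_signs_realized2 R Dom s1 s2 z1 z2 N1 N2 :
  (forall u, exists2 p, p \in Dom & induces R u p) ->
  sign_char R Dom s1 z1 -> sign_char R Dom s2 z2 ->
  z1 ^+ 2 = N1%:~R -> z2 ^+ 2 = N2%:~R ->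
  nonsquare N1 -> nonsquare N2 -> nonsquare (N1 * N2) ->
  forall v : bool * bool, exists p,
    [/\ p \in Dom, exists u, induces R u p & (s1 p, s2 p) = v].
Proof.
move=> Hind H1 H2 z1N z2N n1 n2 n12; have H12 := sign_charM H1 H2.
have z10 := nonsquare_neq0 z1N n1; have z20 := nonsquare_neq0 z2N n2.
move=> [a b]; move: a b; apply: all_signs2.
- move=> a b a' b' [p [pD [u Hu] [<- <-]]] [q [qD [v Hv] [<- <-]]].
  have [t tD Ht] := Hind (u \o v); exists t; split=> //; first by exists (u \o v).
  by rewrite (sign_char_comp z10 H1 pD Hu qD Hv tD Ht) (sign_char_comp z20 H2 pD Hu qD Hv tD Ht).
- have [p [pD Hp sp]] := nonsquare_sign Hind H1 z1N n1.
  by exists (s2 p), p; split=> //; rewrite sp.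
- have [p [pD Hp sp]] := nonsquare_sign Hind H2 z2N n2.
  by exists (s1 p), p; split=> //; rewrite sp.
have [|p [pD Hp sp]] := nonsquare_sign Hind H12 _ n12; first by rewrite exprMn z1N z2N -intrM.
by exists (s1 p), p; split=> //; case: (s1 p) (s2 p) sp => [] [].
Qed.

(** A product of radicands that is not a square has a square root negated by some automorphism, so
    the corresponding linear form does not vanish on the realized sign vectors. The seven products
    correspond to the seven forms of [all_signs3]. *)
Lemma all_signs_realized3 R Dom s1 s2 s3 z1 z2 z3 N1 N2 N3 :
  (forall u, exists2 p, p \in Dom & induces R u p) ->
  sign_char R Dom s1 z1 -> sign_char R Dom s2 z2 -> sign_char R Dom s3 z3 ->
  z1 ^+ 2 = N1%:~R -> z2 ^+ 2 = N2%:~R -> z3 ^+ 2 = N3%:~R ->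
  nonsquare N1 -> nonsquare N2 -> nonsquare N3 ->
  nonsquare (N1 * N2) -> nonsquare (N1 * N3) -> nonsquare (N2 * N3) ->
  nonsquare (N1 * N2 * N3) ->
  forall v : bool * bool * bool, exists p,
    [/\ p \in Dom, exists u, induces R u p & (s1 p, s2 p, s3 p) = v].
Proof.
move=> Hind H1 H2 H3 z1N z2N z3N n1 n2 n3 n12 n13 n23 n123.
have H12 := sign_charM H1 H2; have H13 := sign_charM H1 H3.
have H23 := sign_charM H2 H3; have H123 := sign_charM H12 H3.
have z10 := nonsquare_neq0 z1N n1; have z20 := nonsquare_neq0 z2N n2.
have z30 := nonsquare_neq0 z3N n3.
move=> [[a b] c]; move: a b c; apply: all_signs3.
- move=> a b c a' b' c' [p [pD [u Hu] [<- <- <-]]] [q [qD [v Hv] [<- <- <-]]].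
  have [t tD Ht] := Hind (u \o v); exists t; split=> //; first by exists (u \o v).
  rewrite (sign_char_comp z10 H1 pD Hu qD Hv tD Ht) (sign_char_comp z20 H2 pD Hu qD Hv tD Ht).
  by rewrite (sign_char_comp z30 H3 pD Hu qD Hv tD Ht).
- have [p [pD Hp sp]] := nonsquare_sign Hind H1 z1N n1.
  by exists (s2 p), (s3 p), p; split=> //; rewrite sp.
- have [p [pD Hp sp]] := nonsquare_sign Hind H2 z2N n2.
  by exists (s1 p), (s3 p), p; split=> //; rewrite sp.
- have [p [pD Hp sp]] := nonsquare_sign Hind H3 z3N n3.
  by exists (s1 p), (s2 p), p; split=> //; rewrite sp.
- have [|p [pD Hp sp]] := nonsquare_sign Hind H12 _ n12; first by rewrite exprMn z1N z2N -intrM.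
  by exists (s1 p), (s3 p), p; split=> //; case: (s1 p) (s2 p) sp => [] [].
- have [|p [pD Hp sp]] := nonsquare_sign Hind H13 _ n13; first by rewrite exprMn z1N z3N -intrM.
  by exists (s1 p), (s2 p), p; split=> //; case: (s1 p) (s3 p) sp => [] [].
- have [|p [pD Hp sp]] := nonsquare_sign Hind H23 _ n23; first by rewrite exprMn z2N z3N -intrM.
  by exists (s1 p), (s2 p), p; split=> //; case: (s2 p) (s3 p) sp => [] [].
have [|p [pD Hp sp]] := nonsquare_sign Hind H123 _ n123.
  by rewrite !exprMn z1N z2N z3N -!intrM.
by exists (s1 p), (s2 p), p; split=> //; case: (s1 p) (s2 p) (s3 p) sp => [] [] [].
Qed.

(** * The roots of [polyF a b] *)

Lemma polyZC_aut (u : {rmorphism algC -> algC}) f x :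
  root (polyZC f) (u x) = root (polyZC f) x.
Proof.
rewrite -[in RHS](fmorph_root u) -map_poly_comp; congr (root _ _).
by apply: eq_map_poly => z /=; rewrite rmorph_int.
Qed.

Lemma map_polyF (A : comNzRingType) a b :
  map_poly intr (polyF a b) = 'X^8 + (a%:~R)%:P * 'X^4 + (b%:~R)%:P :> {poly A}.
Proof. by rewrite /polyF !rmorphD /= [map_poly _ (a%:P * _)]rmorphM /= !map_polyXn !map_polyC. Qed.

Lemma prim4i : 4.-primitive_root ('i : algC).
Proof.
have i2 : ('i : algC) ^+ 2 = -1 by rewrite sqrCi.
have n1 : (-1 : algC) != 1 by rewrite eq_sym -addr_eq0 -mulr2n pnatr_eq0.
have i1 : ('i : algC) != 1.
  by apply: contra n1 => /eqP i1; rewrite -i2 i1 expr1n.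
have i3 : ('i : algC) ^+ 3 != 1.
  apply: contra n1 => /eqP i3; have -> : (-1 : algC) = ('i ^+ 2) ^+ 3 by rewrite i2 -signr_odd expr1.
  by rewrite -exprM mulnC exprM i3 expr1n.
have i4 : ('i : algC) ^+ 4 = 1 by rewrite (exprM _ 2 2) i2 sqrrN expr1n.
apply/andP; split=> //; apply/forallP => -[k k4]; rewrite unity_rootE /=.
have [|k3] := eqVneq k 3%N; first by move=> ->; rewrite i4 !eqxx.
by move: k k4 k3 => [|[|[|[|k]]]] // _ _; rewrite ?expr1 ?i2 ?(negPf i1) ?(negPf n1) ?(negPf i3).
Qed.

Lemma exprI_mod k : ('i : algC) ^+ (k %% 4) = 'i ^+ k.
Proof. by rewrite expr_mod // prim_expr_order // prim4i. Qed.

Definition rootsF (r s : algC) : seq algC :=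
  mkseq (fun k => 'i ^+ k * (if (k < 4)%N then r else s)) 8.

(** The permutation coming from an automorphism that maps [r] and [s] to the roots of index [m] and
    [n] and, when [e] holds, 'i to its cube. Indices 4 to 7 need no shift in the exponent because 'i
    has order 4. *)
Definition permF (e : bool) (m n : nat) : seq nat :=
  mkseq (fun k => let t := if (k < 4)%N then m else n in
    (4 * (t %/ 4) + (t + (if e then 3 * k else k)) %% 4)%N) 8.
Definition DomF : seq (seq nat) :=
  [seq permF x.1.1 x.1.2 x.2 | x <- allpairs pair (allpairs pair [:: false; true] (iota 0 8)) (iota 0 8)
     & (x.1.2 < 4)%N != (x.2 < 4)%N].

(* The signs by which [permF e m n] acts on 'i, r^4 - s^4 and r^2 * s^2 *)
Definition sgI (p : seq nat) : bool := nth 0%N p 1 != (4 * (nth 0%N p 0 %/ 4) + (nth 0%N p 0 + 1) %% 4)%N.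
Definition sgD (p : seq nat) : bool := (4 <= nth 0%N p 0)%N.
Definition sgB (p : seq nat) : bool := odd (nth 0%N p 0 + nth 0%N p 4).

Lemma DomFP p : p \in DomF ->
  exists e m n, [/\ p = permF e m n, (m < 8)%N, (n < 8)%N & (m < 4)%N != (n < 4)%N].
Proof.
case/mapP => -[[e m] n]; rewrite mem_filter => /andP [mn /allpairsP [[x y] [xin yin [Dx Dy]]]] ->.
rewrite mem_iota in yin; move: xin; rewrite -Dx => /allpairsP [[x1 x2] [_ x2in [De Dm]]].
rewrite mem_iota in x2in; exists e, m, n; split=> //.
  by rewrite Dm.
by rewrite Dy.
Qed.

Lemma permF_Dom e m n : (m < 8)%N -> (n < 8)%N -> (m < 4)%N != (n < 4)%N -> permF e m n \in DomF.
Proof.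
move=> m8 n8 mn; apply/mapP; exists (e, m, n) => //; rewrite mem_filter; apply/andP; split=> //.
apply/allpairsP; exists ((e, m), n); split; [|by rewrite mem_iota|by []].
by apply/allpairsP; exists (e, m); split; [case: e|rewrite mem_iota|].
Qed.

Lemma permF_params e m n : (m < 8)%N -> (n < 8)%N ->
  [/\ nth 0%N (permF e m n) 0 = m, nth 0%N (permF e m n) 4 = n & sgI (permF e m n) = e].
Proof.
move=> m8 n8; have N k : (k < 8)%N -> nth 0%N (permF e m n) k =
    let t := if (k < 4)%N then m else n in
    (4 * (t %/ 4) + (t + (if e then 3 * k else k)) %% 4)%N by move=> k8; rewrite nth_mkseq.
have N0 : nth 0%N (permF e m n) 0 = m by rewrite N //=; case: (e); lia.
have N4 : nth 0%N (permF e m n) 4 = n by rewrite N //=; case: (e); lia.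
split=> //; rewrite /sgI N0 N //=; case: (e); [apply/eqP|apply/eqP]; lia.
Qed.

Section RootsF.
Variables (a b : int) (r s : algC).
Hypotheses (rs_add : r ^+ 4 + s ^+ 4 = - a%:~R) (rs_mul : r ^+ 4 * s ^+ 4 = b%:~R).
Hypotheses (b0 : b != 0) (d0 : a ^+ 2 - 4 * b != 0).

Lemma r_neq0 : r != 0.
Proof.
apply: contraNneq b0 => r0; move: rs_mul; rewrite r0 expr0n mul0r => /esym/eqP.
by rewrite intr_eq0.
Qed.

Lemma s_neq0 : s != 0.
Proof.
apply: contraNneq b0 => r0; move: rs_mul; rewrite r0 expr0n mulr0 => /esym/eqP.
by rewrite intr_eq0.
Qed.

Lemma sqr_rs4 : (r ^+ 4 - s ^+ 4) ^+ 2 = (a ^+ 2 - 4 * b)%:~R.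
Proof.
rewrite rmorphB rmorphXn /= intrM -rs_mul; have -> : a%:~R = - (r ^+ 4 + s ^+ 4) by rewrite rs_add opprK.
ring.
Qed.

Lemma rs_neq : r ^+ 4 != s ^+ 4.
Proof.
apply: contraNneq d0 => rs; move: sqr_rs4; rewrite rs subrr expr0n /= => /esym/eqP.
by rewrite intr_eq0.
Qed.

Lemma polyFE x : (polyZC (polyF a b)).[x] = (x ^+ 4 - r ^+ 4) * (x ^+ 4 - s ^+ 4).
Proof.
rewrite /polyZC map_polyF !(hornerD, hornerM, hornerX, hornerC).
have -> : a%:~R = - (r ^+ 4 + s ^+ 4) by rewrite rs_add opprK.
rewrite -rs_mul; ring.
Qed.

Lemma rootF_exp x : root (polyZC (polyF a b)) x = (x ^+ 4 == r ^+ 4) || (x ^+ 4 == s ^+ 4).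
Proof. by rewrite /root polyFE mulf_eq0 !subr_eq0. Qed.

Lemma exprI4 k : (('i : algC) ^+ k) ^+ 4 = 1.
Proof. by rewrite -exprM mulnC exprM (prim_expr_order prim4i) expr1n. Qed.

Lemma eq_exp4 (x y : algC) : x != 0 -> y ^+ 4 = x ^+ 4 -> exists2 m, (m < 4)%N & y = 'i ^+ m * x.
Proof.
move=> x0 yx; have : (y / x) ^+ 4 = 1 by rewrite expr_div_n yx divff // expf_neq0.
move=> /(prim_rootP prim4i) [m Hm]; exists m => //.
by rewrite -Hm divfK.
Qed.

Lemma nth_rootsF k : (k < 8)%N -> nth 0 (rootsF r s) k = 'i ^+ k * (if (k < 4)%N then r else s).
Proof. by move=> k8; rewrite nth_mkseq. Qed.

Lemma rootsFP x : root (polyZC (polyF a b)) x ->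
  exists2 m, (m < 8)%N & x = nth 0 (rootsF r s) m.
Proof.
rewrite rootF_exp => /orP [] /eqP.
  move=> /(eq_exp4 r_neq0) [m m4 ->]; exists m; first by lia.
  by rewrite nth_rootsF ?m4 //; lia.
move=> /(eq_exp4 s_neq0) [m m4 ->]; exists (4 + m)%N; first by lia.
  rewrite nth_rootsF; last by lia.
  have -> : (4 + m < 4)%N = false by lia.
by rewrite exprD (prim_expr_order prim4i) mul1r.
Qed.

Lemma rootsF_root x : x \in rootsF r s -> root (polyZC (polyF a b)) x.
Proof.
move=> /mapP [k _ ->]; rewrite rootF_exp exprMn exprI4 mul1r.
by case: ifP; rewrite eqxx ?orbT.
Qed.

Lemma uniq_rootsF : uniq (rootsF r s).
Proof.
apply/(uniqP 0) => j k; rewrite !inE !size_mkseq => j8 k8; rewrite !nth_rootsF // => jk.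
have blk : (j < 4)%N = (k < 4)%N.
  have := congr1 (fun x => x ^+ 4) jk; rewrite !exprMn !exprI4 !mul1r.
  have := rs_neq; case: (j < 4)%N (k < 4)%N => [] [] // /eqP H /esym // H'; by case: H.
move: jk; rewrite blk; have x0 : (if (k < 4)%N then r else s) != 0.
  by case: ifP => _; rewrite ?r_neq0 ?s_neq0.
move=> /(mulIf x0) /eqP; rewrite (eq_prim_root_expr prim4i) => /eqP; lia.
Qed.

(** The images of 'i, [r] and [s] determine everything; [r] and [s] land in different blocks because
    [r ^+ 4] and [s ^+ 4] differ. *)
Lemma indF u : exists2 p, p \in DomF & induces (rootsF r s) u p.
Proof.
have r0 := r_neq0; have s0 := s_neq0.
have N1 : (-1 : algC) <> 1 by move=> /eqP; rewrite eq_sym -addr_eq0 -mulr2n pnatr_eq0.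
have u2 (x : algC) : x ^+ 2 = 1 -> u 'i = x -> -1 = 1 :> algC.
  by move=> x2 ux; have := congr1 (fun y => y ^+ 2) ux; rewrite x2 -rmorphXn sqrCi rmorphN rmorph1.
have [e ui] : exists e : bool, u 'i = 'i ^+ (if e then 3 else 1).
  have : (u 'i) ^+ 4 = 1 by rewrite -rmorphXn (prim_expr_order prim4i) rmorph1.
  move=> /(prim_rootP prim4i) [[[|[|[|[|k]]]] //= Hk] ui].
  - by case: N1; apply: (u2 _ _ ui); rewrite ?expr0 ?expr1n.
  - by exists false.
  - by case: N1; apply: (u2 _ _ ui); rewrite ?sqrCi ?sqrrN ?expr1n.
  by exists true.
have [m m8 um] : exists2 m, (m < 8)%N & u r = nth 0 (rootsF r s) m.
  by apply: rootsFP; rewrite polyZC_aut rootF_exp eqxx.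
have [n n8 un] : exists2 n, (n < 8)%N & u s = nth 0 (rootsF r s) n.
  by apply: rootsFP; rewrite polyZC_aut rootF_exp eqxx orbT.
have mn : (m < 4)%N != (n < 4)%N.
  apply: contraNneq rs_neq => mn; rewrite -(inj_eq (fmorph_inj u)) !rmorphXn /= um un.
  by rewrite !nth_rootsF // !exprMn !exprI4 !mul1r mn.
exists (permF e m n); first exact: permF_Dom.
have key t k : (t < 8)%N -> nth 0 (rootsF r s) (4 * (t %/ 4) + (t + (if e then 3 * k else k)) %% 4)%N
   = (u 'i) ^+ k * nth 0 (rootsF r s) t.
  move=> t8; rewrite !nth_rootsF //; last by lia.
  have -> : (4 * (t %/ 4) + (t + (if e then 3 * k else k)) %% 4 < 4)%N = (t < 4)%N by lia.
  rewrite mulrA; congr (_ * _); rewrite ui -exprM -exprD -[LHS]exprI_mod -[RHS]exprI_mod.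
  by congr (_ ^+ _); case: (e); lia.
move=> k k8; rewrite [nth 0%N _ k]nth_mkseq // key; last by case: ifP.
rewrite nth_rootsF // rmorphM rmorphXn; congr (_ * _); case: ifP => _; by rewrite -?um -?un.
Qed.

Section Chars.
Variables (u : {rmorphism algC -> algC}) (p : seq nat).
Hypotheses (pD : p \in DomF) (Hp : induces (rootsF r s) u p).

Let m := nth 0%N p 0.
Let n := nth 0%N p 4.

Lemma charF_params : [/\ (m < 8)%N, (n < 8)%N, (m < 4)%N != (n < 4)%N,
  u r = 'i ^+ m * (if (m < 4)%N then r else s) & u s = 'i ^+ n * (if (n < 4)%N then r else s)].
Proof.
have [e [m' [n' [Dp m8 n8 mn]]]] := DomFP pD.
have [Em En _] := permF_params e m8 n8; rewrite -Dp -/m -/n in Em En.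
rewrite Em En; split=> //.
  by have := Hp (erefl : (0 < 8)%N); rewrite -/m Em !nth_rootsF // expr0 mul1r.
by have := Hp (erefl : (4 < 8)%N); rewrite -/n En !nth_rootsF // (prim_expr_order prim4i) mul1r.
Qed.

Lemma charF_i : u 'i = (-1) ^+ sgI p * 'i.
Proof.
have [e [m' [n' [Dp m8 n8 mn]]]] := DomFP pD.
have [Em En Es] := permF_params e m8 n8; rewrite -Dp -/m -/n in Em En Es; rewrite Es.
have [_ _ _ ur _] := charF_params; rewrite Em in ur.
have P1 : nth 0%N p 1 = (4 * (m' %/ 4) + (m' + (if e then 3 * 1 else 1)) %% 4)%N.
  by rewrite Dp nth_mkseq.
have := Hp (erefl : (1 < 8)%N); rewrite P1 !nth_rootsF //; last by case: (e); lia.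
rewrite [u (_ * _)]rmorphM /= expr1 ur.
have -> : (4 * (m' %/ 4) + (m' + (if e then 3 * 1 else 1)) %% 4 < 4)%N = (m' < 4)%N by lia.
rewrite mulrA; have x0 : (if (m' < 4)%N then r else s) != 0.
  by case: ifP => _; rewrite ?r_neq0 ?s_neq0.
move=> /(mulIf x0) H; apply: (mulIf (expf_neq0 m' (neq0Ci algC))); rewrite H.
rewrite -exprI_mod; case: (e) => /=.
  have -> : ((4 * (m' %/ 4) + (m' + 3 * 1) %% 4) %% 4 = (m' + 3) %% 4)%N by lia.
  by rewrite exprI_mod exprD (exprSr _ 2) sqrCi expr1; ring.
have -> : ((4 * (m' %/ 4) + (m' + 1) %% 4) %% 4 = (m' + 1) %% 4)%N by lia.
by rewrite exprI_mod exprD mul1r mulrC.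
Qed.

Lemma charF_d : u (r ^+ 4 - s ^+ 4) = (-1) ^+ sgD p * (r ^+ 4 - s ^+ 4).
Proof.
have [m8 n8 mn ur us] := charF_params.
rewrite rmorphB !rmorphXn /= ur us !exprMn !exprI4 !mul1r /sgD -/m.
move: mn; rewrite [(4 <= m)%N]leqNgt; case: (m < 4)%N (n < 4)%N => [] [] //= _; ring.
Qed.

Lemma charF_b : u (r ^+ 2 * s ^+ 2) = (-1) ^+ sgB p * (r ^+ 2 * s ^+ 2).
Proof.
have [m8 n8 mn ur us] := charF_params.
rewrite rmorphM !rmorphXn /= ur us !exprMn /sgB -/m -/n signr_odd.
have -> : (-1 : algC) ^+ (m + n) = ('i ^+ m) ^+ 2 * ('i ^+ n) ^+ 2.
  by rewrite -!exprM !(mulnC _ 2) !exprM sqrCi -exprD.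
by move: mn; case: (m < 4)%N (n < 4)%N => [] [] //= _; ring.
Qed.

End Chars.

End RootsF.

(** * Large Galois groups of [polyF] *)

Definition cycles8 (X : nat) : seq (seq (seq nat)) :=
  match X with
  | 2 => [:: [:: [:: 1;2]; [:: 3;4]; [:: 5;6]; [:: 7;8]]; [:: [:: 1;5;4;8]; [:: 2;6;3;7]]]
  | 3 => [:: [:: [:: 1;2]; [:: 3;4]; [:: 5;6]; [:: 7;8]]; [:: [:: 1;3]; [:: 2;4]; [:: 5;8]; [:: 6;7]];
             [:: [:: 1;5]; [:: 2;6]; [:: 3;8]; [:: 4;7]]]
  | 4 => [:: [:: [:: 1;2]; [:: 3;4]; [:: 5;7]; [:: 6;8]]; [:: [:: 1;5;4;8]; [:: 2;6;3;7]]]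
  | 6 => [:: [:: [:: 3;4]; [:: 5;8]; [:: 6;7]]; [:: [:: 1;5]; [:: 2;6]; [:: 3;7]; [:: 4;8]]]
  | 8 => [:: [:: [:: 3;4]; [:: 5;7]; [:: 6;8]]; [:: [:: 1;5;2;6]; [:: 3;7;4;8]]]
  | 9 => [:: [:: [:: 5;8]; [:: 6;7]]; [:: [:: 1;2]; [:: 3;4]; [:: 5;6]; [:: 7;8]];
             [:: [:: 1;5]; [:: 2;6]; [:: 3;7]; [:: 4;8]]]
  | 10 => [:: [:: [:: 5;7]; [:: 6;8]]; [:: [:: 1;5;2;6]; [:: 3;7;4;8]]]
  | 11 => [:: [:: [:: 3;4]; [:: 5;6]]; [:: [:: 1;3]; [:: 2;4]; [:: 5;8]; [:: 6;7]];
              [:: [:: 1;5]; [:: 2;6]; [:: 3;7]; [:: 4;8]]]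
  | 15 => [:: [:: [:: 5;6]; [:: 7;8]]; [:: [:: 3;4]; [:: 5;7]; [:: 6;8]];
              [:: [:: 1;5]; [:: 2;6]; [:: 3;7]; [:: 4;8]]]
  | 16 => [:: [:: [:: 3;4]; [:: 7;8]]; [:: [:: 1;5;3;7;2;6;4;8]]]
  | 17 => [:: [:: [:: 5;7;6;8]]; [:: [:: 1;5]; [:: 2;6]; [:: 3;8]; [:: 4;7]]]
  | 18 => [:: [:: [:: 5;6]; [:: 7;8]]; [:: [:: 5;7]; [:: 6;8]];
              [:: [:: 1;5]; [:: 2;6]; [:: 3;7]; [:: 4;8]]]
  | 22 => [:: [:: [:: 5;6]; [:: 7;8]]; [:: [:: 3;4]; [:: 7;8]]; [:: [:: 1;3]; [:: 2;4]; [:: 5;7]; [:: 6;8]];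
              [:: [:: 1;5]; [:: 2;6]; [:: 3;7]; [:: 4;8]]]
  | 26 => [:: [:: [:: 5;7;6;8]]; [:: [:: 3;4]; [:: 7;8]]; [:: [:: 1;5]; [:: 2;6]; [:: 3;7]; [:: 4;8]]]
  | _ => [::]
  end%N.

Lemma T8_cycles X : X \in [:: 2; 3; 4; 6; 8; 9; 10; 11; 15; 16; 17; 18; 22; 26]%N ->
  T8 X = gen_grp (map pr (cycles8 X)).
Proof. by rewrite !inE; do ![case/orP; [by move=> /eqP -> |]] => /eqP ->. Qed.

Definition signs3 : seq (bool * bool * bool) :=
  [:: (true, false, false); (false, true, false); (false, false, true)].

(** In this labelling the consecutive points 1 and 2, 3 and 4, 5 and 6, 7 and 8 are the pairs of
    opposite roots, which form a block system of the group. *)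
Lemma check26 : galois_check DomF (fun p => (sgI p, sgD p, sgB p)) signs3
  [:: 0; 2; 1; 3; 4; 6; 5; 7]%N (cycles8 26).
Proof. vm_cast_no_check (erefl true). Qed.

(** The permutations possible when [d] is minus a square, so that the signs of 'i and of the square
    root of [d] coincide. *)
Definition Dom17 := [seq p <- DomF | sgI p == sgD p].
Lemma check17 : galois_check Dom17 (fun p => (sgI p, sgB p)) [:: (true, false); (false, true)]
  [:: 0; 2; 1; 3; 4; 6; 5; 7]%N (cycles8 17).
Proof. vm_cast_no_check (erefl true). Qed.

(* Here z is a square root of 'i on which [p] acts as z |-> z^(zt p), the second case being s = z * r. *)
Definition Domz (zt : seq nat -> nat) :=
  [seq p <- DomF | (zt p %% 4)%N == (if sgI p then 3 else 1)%N].
(** The sign on the square root [z - z^3 = z + 1/z] of 2: the map [z |-> z^t] negates it exactly for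
    [t] congruent to 3 or 5 modulo 8. *)
Definition sg2 (zt : seq nat -> nat) p : bool := (zt p %% 8)%N \in [:: 3; 5]%N.
Definition zt_prod p : nat := (2 * (nth 0%N p 0 + nth 0%N p 4) + 1)%N.
(** The exponent for [z = s / r]. Writing [8 -] avoids truncated subtraction, and 7 is [-1] modulo
    8, for when [r] and [s] change blocks. *)
Definition zt_quot p : nat :=
  (2 * (nth 0 p 4 + (8 - nth 0 p 0)) + (if nth 0 p 0 < 4 then 1 else 7))%N.
Lemma check15 : galois_check (Domz zt_quot) (fun p => (sgI p, sgB p, sg2 zt_quot p)) signs3
  [:: 0; 2; 1; 3; 4; 6; 7; 5]%N (cycles8 15).
Proof. vm_cast_no_check (erefl true). Qed.

(** If [r * s = 1], the images of [r] and [s] are inverse to each other as well, so the exponents of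
    'i in them cancel. *)
Definition Dom9 := [seq p <- DomF | (4 %| nth 0 p 0 + nth 0 p 4)%N].
Definition sgU (p : seq nat) : bool := odd (nth 0%N p 0).
Lemma check9F : galois_check Dom9 (fun p => (sgI p, sgU p, sgU p (+) sgD p)) signs3
  [:: 0; 4; 6; 2; 1; 7; 5; 3]%N (cycles8 9).
Proof. vm_cast_no_check (erefl true). Qed.

Lemma nonsquareN1 : nonsquare (-1).
Proof. by move=> k; nia. Qed.

Lemma nonsquare2 : nonsquare 2.
Proof.
move=> k; have [] : k <= -2 \/ 2 <= k \/ (k == -1) || (k == 0) || (k == 1) by lia.
  by nia.
by move=> [|/orP [/orP [] |] /eqP ->] //; nia.
Qed.

Lemma sqrCi_int : ('i : algC) ^+ 2 = (-1)%:~R.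
Proof. by rewrite sqrCi rmorphN. Qed.

Lemma ind_filter R Dom (P : pred (seq nat)) :
  (forall u, exists2 p, p \in Dom & induces R u p) ->
  (forall u p, p \in Dom -> induces R u p -> P p) ->
  forall u, exists2 p, p \in [seq p <- Dom | P p] & induces R u p.
Proof.
move=> Hind HP u; have [p pD Hp] := Hind u; exists p => //.
by rewrite mem_filter pD (HP u p).
Qed.

Lemma sign_char_filter R Dom (P : pred (seq nat)) s z :
  sign_char R Dom s z -> sign_char R [seq p <- Dom | P p] s z.
Proof. by move=> H u p; rewrite mem_filter => /andP [_ pD]; apply: H. Qed.

Lemma rootsF_exist (a b : int) : exists r s : algC,
  r ^+ 4 + s ^+ 4 = - a%:~R /\ r ^+ 4 * s ^+ 4 = b%:~R.
Proof.
pose e := sqrtC ((a ^+ 2 - 4 * b)%:~R : algC).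
have e2 : e ^+ 2 = a%:~R ^+ 2 - 4 * b%:~R.
  by rewrite sqrtCK rmorphB rmorphXn /= intrM.
exists (4.-root ((- a%:~R + e) / 2)), (4.-root ((- a%:~R - e) / 2)).
rewrite !rootCK //; split; first by field.
have -> : (- a%:~R + e) / 2 * ((- a%:~R - e) / 2) = (a%:~R ^+ 2 - e ^+ 2) / 4 by field.
by rewrite e2; field.
Qed.

Section GaloisF.
Variables (a b : int) (r s : algC).
Hypotheses (rs_add : r ^+ 4 + s ^+ 4 = - a%:~R) (rs_mul : r ^+ 4 * s ^+ 4 = b%:~R).
Hypotheses (b0 : b != 0) (d0 : a ^+ 2 - 4 * b != 0).

Let Hind := indF rs_add rs_mul b0 d0.

Lemma sign_char_i : sign_char (rootsF r s) DomF sgI 'i.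
Proof. by move=> u p pD Hp; apply: (charF_i rs_mul b0 d0 pD Hp). Qed.

Lemma sign_char_d : sign_char (rootsF r s) DomF sgD (r ^+ 4 - s ^+ 4).
Proof. by move=> u p pD Hp; apply: charF_d pD Hp. Qed.

Lemma sign_char_b : sign_char (rootsF r s) DomF sgB (r ^+ 2 * s ^+ 2).
Proof. by move=> u p pD Hp; apply: charF_b pD Hp. Qed.

Lemma sqr_r2s2 : (r ^+ 2 * s ^+ 2) ^+ 2 = b%:~R.
Proof. by rewrite -rs_mul; ring. Qed.

Lemma galoisF_check (V : eqType) Dom (sgn : seq nat -> V) vs c X :
  X \in [:: 2; 3; 4; 6; 8; 9; 10; 11; 15; 16; 17; 18; 22; 26]%N ->
  (forall u, exists2 p, p \in Dom & induces (rootsF r s) u p) ->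
  (forall v, exists p, [/\ p \in Dom, exists u, induces (rootsF r s) u p & sgn p = v]) ->
  galois_check Dom sgn vs c (cycles8 X) -> galois_group_is (polyF a b) (T8 X).
Proof.
move=> HX HindD Hv Hc; rewrite (T8_cycles HX).
apply: (@galois_group_check _ _ (rootsF r s)) Hc => //.
- exact: uniq_rootsF rs_add rs_mul b0 d0.
exact: rootsF_root.
Qed.

End GaloisF.

Lemma galoisF26 (a b : int) : b != 0 -> a ^+ 2 - 4 * b != 0 ->
  (let d := a ^+ 2 - 4 * b in
   [/\ nonsquare d, nonsquare (- d), nonsquare b, nonsquare (- b)
      & nonsquare (d * b) /\ nonsquare (- (d * b))]) ->
  galois_group_is (polyF a b) (T8 26).
Proof.
move=> b0 d0 [nd nNd nb nNb [ndb nNdb]]; have [r [s [rs_add rs_mul]]] := rootsF_exist a b.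
have Hind := indF rs_add rs_mul b0 d0.
apply: (galoisF_check rs_add rs_mul b0 d0 _ Hind _ check26) => //.
move=> v; apply: (all_signs_realized3 Hind (sign_char_i rs_mul b0 d0) (sign_char_d (r := r) (s := s))
  (sign_char_b (r := r) (s := s)) sqrCi_int (sqr_rs4 rs_add rs_mul) (sqr_r2s2 rs_mul) nonsquareN1) => //;
  by rewrite mulN1r // mulNr.
Qed.

(* When d = - k^2, r^4 - s^4 is a rational multiple of 'i. *)
Lemma galoisF17 (a b k : int) : b != 0 -> k != 0 -> a ^+ 2 - 4 * b = - k ^+ 2 ->
  nonsquare b -> nonsquare (- b) -> galois_group_is (polyF a b) (T8 17).
Proof.
move=> b0 k0 dk nb nNb; have [r [s [rs_add rs_mul]]] := rootsF_exist a b.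
have d0 : a ^+ 2 - 4 * b != 0 by rewrite dk oppr_eq0 expf_neq0.
have Hind0 := indF rs_add rs_mul b0 d0.
have zk : exists2 c : rat, c != 0 & r ^+ 4 - s ^+ 4 = ratr c * 'i.
  have : (r ^+ 4 - s ^+ 4) ^+ 2 == (k%:~R * 'i) ^+ 2.
    by rewrite (sqr_rs4 rs_add rs_mul) dk exprMn sqrCi mulrN1 rmorphN rmorphXn.
  rewrite eqf_sqr => /orP [] /eqP ->; [exists k%:~R | exists (- k%:~R)];
   by rewrite ?oppr_eq0 ?intr_eq0 // ?rmorphN ?mulNr /= ?ratr_int.
have Hind : forall u, exists2 p, p \in Dom17 & induces (rootsF r s) u p.
  apply: ind_filter Hind0 _ => u p pD Hp; have [c c0 cE] := zk.
  have := sign_char_d pD Hp; rewrite cE rmorphM fmorph_rat (sign_char_i rs_mul b0 d0 pD Hp).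
  rewrite mulrCA => /(mulIf _) H; have {H} := H _.
  have ci : ratr c * 'i != 0 :> algC by rewrite mulf_neq0 ?neq0Ci // fmorph_eq0.
  move=> /(_ ci) /eqP; case: (sgI p) (sgD p) => [] [] //=; rewrite ?expr0 ?expr1.
    by rewrite eq_sym -addr_eq0 -mulr2n pnatr_eq0.
  by rewrite -addr_eq0 -mulr2n pnatr_eq0.
apply: (galoisF_check rs_add rs_mul b0 d0 _ Hind _ check17) => //.
move=> v; apply: (all_signs_realized2 Hind (sign_char_filter (sign_char_i rs_mul b0 d0))
  (sign_char_filter (sign_char_b (r := r) (s := s))) sqrCi_int (sqr_r2s2 rs_mul) nonsquareN1 nb).
by rewrite mulN1r.
Qed.

Section Zeta8.
Variables (r s z : algC) (zt : seq nat -> nat).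
Hypothesis z2 : z ^+ 2 = 'i.
Hypothesis Hind0 : forall u, exists2 p, p \in DomF & induces (rootsF r s) u p.
Hypothesis Hi : sign_char (rootsF r s) DomF sgI 'i.
Hypothesis Hz : forall u p, p \in DomF -> induces (rootsF r s) u p -> u z = z ^+ zt p.

Lemma z4 : z ^+ 4 = -1.
Proof. by rewrite (exprM _ 2 2) z2 sqrCi. Qed.

Lemma z8 : z ^+ 8 = 1.
Proof. by rewrite (exprM _ 4 2) z4 sqrrN expr1n. Qed.

Lemma zt_mod4 u p : p \in DomF -> induces (rootsF r s) u p ->
  (zt p %% 4)%N == (if sgI p then 3 else 1)%N.
Proof.
move=> pD Hp; have := Hi pD Hp; rewrite -{1}z2 rmorphXn /= (Hz pD Hp) -exprM mulnC exprM z2.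
have -> : (-1) ^+ sgI p * 'i = ('i : algC) ^+ (if sgI p then 3 else 1)%N.
  by case: (sgI p); rewrite ?(exprSr _ 2) ?sqrCi ?expr1 ?expr0 ?mul1r.
by move=> /eqP; rewrite (eq_prim_root_expr prim4i) => /eqP ->; case: (sgI p).
Qed.

Lemma indz u : exists2 p, p \in Domz zt & induces (rootsF r s) u p.
Proof. exact: ind_filter Hind0 zt_mod4 u. Qed.

Lemma sign_char_sqrt2 : sign_char (rootsF r s) (Domz zt) (sg2 zt) (z - z ^+ 3).
Proof.
move=> u p; rewrite mem_filter => /andP [t4 pD] Hp.
rewrite rmorphB rmorphXn /= (Hz pD Hp) /sg2 -(expr_mod (zt p) z8).
have : ((zt p %% 8) %% 4 = 1 \/ (zt p %% 8) %% 4 = 3)%N.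
  by move: t4; case: (sgI p) => /eqP; lia.
have : (zt p %% 8 < 8)%N by rewrite ltn_mod.
have Z : z ^+ 4 + 1 = 0 by rewrite z4 addNr.
move: (zt p %% 8)%N => [|[|[|[|[|[|[|[|t]]]]]]]] //= _ [] // _; rewrite ?inE /= ?expr0 ?expr1.
- by rewrite mul1r.
- have -> : (z ^+ 3) ^+ 3 = z * (z ^+ 4) ^+ 2 by ring.
  by rewrite z4; ring.
- have -> : z ^+ 5 - (z ^+ 5) ^+ 3 = z * z ^+ 4 - z ^+ 3 * (z ^+ 4) ^+ 3 by ring.
  by rewrite z4; ring.
have -> : z ^+ 7 - (z ^+ 7) ^+ 3 = z ^+ 3 * z ^+ 4 - z * (z ^+ 4) ^+ 5 by ring.
by rewrite z4; ring.
Qed.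

Lemma sqr_sqrt2 : (z - z ^+ 3) ^+ 2 = 2%:~R.
Proof.
have -> : (z - z ^+ 3) ^+ 2 = z ^+ 2 - 2 * z ^+ 4 + z ^+ 4 * z ^+ 2 by ring.
by rewrite z4; ring.
Qed.
End Zeta8.

Lemma aut_zeta8 (b : int) (r z : algC) : z ^+ 2 = 'i ->
  r ^+ 4 + (z * r) ^+ 4 = - (0 : int)%:~R -> r ^+ 4 * (z * r) ^+ 4 = b%:~R -> b != 0 ->
  forall u p, p \in DomF -> induces (rootsF r (z * r)) u p -> u z = z ^+ zt_quot p.
Proof.
move=> z2 rs_add rs_mul b0 u p; have Z8 := z8 z2; have r0 := r_neq0 rs_mul b0.
move=> pD Hp; have [m8 n8 mn ur us] := charF_params pD Hp.
have : u z * u r = u (z * r) by rewrite rmorphM.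
rewrite ur us /zt_quot; set m := nth 0%N p 0 in m8 mn *; set n := nth 0%N p 4 in n8 mn *.
have im : ('i : algC) ^+ m * 'i ^+ (8 - m) = 1.
  by rewrite -exprD subnKC 1?ltnW // (exprM _ 4 2) (prim_expr_order prim4i) expr1n.
have i0 : ('i : algC) ^+ m != 0 by rewrite expf_neq0 ?neq0Ci.
have E k : z ^+ (2 * (n + (8 - m)) + k) * 'i ^+ m = 'i ^+ n * z ^+ k.
  rewrite exprD exprM z2 exprD; transitivity ('i ^+ n * z ^+ k * ('i ^+ m * 'i ^+ (8 - m)) : algC).
    by ring.
  by rewrite im mulr1.
have z0 : z != 0 by apply: contra_eq_neq Z8 => ->; rewrite expr0n eq_sym oner_eq0.
move: mn; case: (m < 4)%N (n < 4)%N => [] [] //= _ H; apply: (mulIf i0); rewrite E.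
  by apply: (mulIf r0); rewrite -mulrA H expr1 mulrA.
apply: (mulIf (mulf_neq0 z0 r0)); rewrite -mulrA H.
by rewrite -[RHS]mulrA [z ^+ 7 * _]mulrA -exprSr Z8 mul1r.
Qed.

(** For [a = 0] the root of [d = - 4 b] depends on 'i and the root of [b]. The third independent
    sign comes from the square root of 2, available because [s / r] is a primitive eighth root of
    unity. *)
Lemma galoisF15 (b : int) : b != 0 ->
  nonsquare b -> nonsquare (- b) -> nonsquare (2 * b) -> nonsquare (- (2 * b)) ->
  galois_group_is (polyF 0 b) (T8 15).
Proof.
move=> b0 nb nNb n2b nN2b.
pose z : algC := sqrtC 'i; have z2 : z ^+ 2 = 'i by rewrite sqrtCK.
have Z4 := z4 z2.
pose r : algC := 8.-root (- b%:~R); have r8 : r ^+ 8 = - b%:~R by rewrite rootCK.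
have rs_add : r ^+ 4 + (z * r) ^+ 4 = - (0 : int)%:~R by rewrite exprMn Z4 mulN1r subrr oppr0.
have rs_mul : r ^+ 4 * (z * r) ^+ 4 = b%:~R.
  by rewrite exprMn Z4 mulN1r mulrN -exprD r8 opprK.
have d0 : (0 : int) ^+ 2 - 4 * b != 0 by rewrite expr0n sub0r oppr_eq0 mulf_neq0.
have Hind0 := indF rs_add rs_mul b0 d0.
have Hz := aut_zeta8 z2 rs_add rs_mul b0.
have Hi := sign_char_i rs_mul b0 d0.
have Hind := indz z2 Hind0 Hi Hz.
apply: (galoisF_check rs_add rs_mul b0 d0 _ Hind _ check15) => //.
move=> v; apply: (all_signs_realized3 Hind (sign_char_filter Hi)
  (sign_char_filter (sign_char_b (r := r) (s := z * r))) (sign_char_sqrt2 z2 Hz)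
  sqrCi_int (sqr_r2s2 rs_mul) (sqr_sqrt2 z2) nonsquareN1 nb) => //.
- exact: nonsquare2.
- by rewrite mulN1r.
- by move=> k; nia.
- by rewrite mulrC.
by rewrite mulN1r mulNr mulrC.
Qed.

Lemma ind9 (a : int) (r s : algC) : r ^+ 4 + s ^+ 4 = - a%:~R -> r * s = 1 -> a ^+ 2 - 4 * 1 != 0 :> int ->
  forall u, exists2 p, p \in Dom9 & induces (rootsF r s) u p.
Proof.
move=> rs_add rs1 d0; have rs_mul : r ^+ 4 * s ^+ 4 = (1 : int)%:~R by rewrite -exprMn rs1 expr1n.
apply: ind_filter (indF rs_add rs_mul _ d0) _ => // u p pD Hp.
have [m8 n8 mn ur us] := charF_params pD Hp.
have : u r * u s = 1 by rewrite -rmorphM rs1 rmorph1.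
rewrite ur us mulrACA -exprD.
have -> : (if (nth 0%N p 0 < 4)%N then r else s) * (if (nth 0%N p 4 < 4)%N then r else s) = 1.
  by move: mn; case: (_ < 4)%N (_ < 4)%N => [] [] //= _; rewrite // mulrC.
by rewrite mulr1 => /eqP; rewrite -(expr0 ('i : algC)) (eq_prim_root_expr prim4i).
Qed.

Lemma sign_char_sum r s : sign_char (rootsF r s) Dom9 sgU (r ^+ 2 + s ^+ 2).
Proof.
move=> u p; rewrite mem_filter => /andP [/dvdnP [k Hk] pD] Hp.
have [m8 n8 mn ur us] := charF_params pD Hp.
rewrite rmorphD !rmorphXn /= ur us !exprMn -!exprM ![(_ * 2)%N]mulnC !exprM sqrCi /sgU signr_odd.
have -> : (-1 : algC) ^+ nth 0%N p 4 = (-1) ^+ nth 0%N p 0.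
  rewrite -(signr_odd _ (nth 0%N p 4)) -(signr_odd _ (nth 0%N p 0)).
  move: (congr1 odd Hk); rewrite oddD oddM andbF.
  by do 2!case: (odd _) => /=.
by move: mn; case: (_ < 4)%N (_ < 4)%N => [] [] //= _; ring.
Qed.

Lemma sign_char_diff r s :
  sign_char (rootsF r s) Dom9 (fun p => sgU p (+) sgD p) (r ^+ 2 - s ^+ 2).
Proof.
move=> u p; rewrite mem_filter => /andP [/dvdnP [k Hk] pD] Hp.
have [m8 n8 mn ur us] := charF_params pD Hp.
rewrite rmorphB !rmorphXn /= ur us !exprMn -!exprM ![(_ * 2)%N]mulnC !exprM sqrCi.
rewrite signr_addb /sgU /sgD signr_odd [(4 <= _)%N]leqNgt.
have -> : (-1 : algC) ^+ nth 0%N p 4 = (-1) ^+ nth 0%N p 0.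
  rewrite -(signr_odd _ (nth 0%N p 4)) -(signr_odd _ (nth 0%N p 0)).
  move: (congr1 odd Hk); rewrite oddD oddM andbF.
  by do 2!case: (odd _) => /=.
by move: mn; case: (_ < 4)%N (_ < 4)%N => [] [] //= _; ring.
Qed.

(** Only [s ^+ 4] is prescribed, so [s] may be replaced by the fourth root [1 / r] of the same
    number. *)
Lemma rootsF1_exist (a : int) : exists r s : algC, r ^+ 4 + s ^+ 4 = - a%:~R /\ r * s = 1.
Proof.
have [r [s [rs_add rs_mul]]] := rootsF_exist a 1.
have r0 := r_neq0 rs_mul isT; exists r, r^-1; rewrite divff //; split=> //.
by rewrite -rs_add -[s ^+ 4](mulKf (expf_neq0 4 r0)) rs_mul mulr1 exprVn.
Qed.

Lemma sqr_sum (a : int) (r s : algC) : r ^+ 4 + s ^+ 4 = - a%:~R -> r * s = 1 ->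
  (r ^+ 2 + s ^+ 2) ^+ 2 = (2 - a)%:~R.
Proof.
move=> rs_add rs1; have -> : (r ^+ 2 + s ^+ 2) ^+ 2 = r ^+ 4 + s ^+ 4 + 2 * (r * s) ^+ 2 by ring.
by rewrite rs_add rs1 rmorphB /=; ring.
Qed.

Lemma sqr_diff (a : int) (r s : algC) : r ^+ 4 + s ^+ 4 = - a%:~R -> r * s = 1 ->
  (r ^+ 2 - s ^+ 2) ^+ 2 = (- 2 - a)%:~R.
Proof.
move=> rs_add rs1; have -> : (r ^+ 2 - s ^+ 2) ^+ 2 = r ^+ 4 + s ^+ 4 - 2 * (r * s) ^+ 2 by ring.
by rewrite rs_add rs1 rmorphB /=; ring.
Qed.

(** The radicands are -1, [2 - a] and [- 2 - a], the last two being the squares of [r^2 + s^2] and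
    [r^2 - s^2]; their product is [a^2 - 4], which is [d]. *)
Lemma galoisF9 (a : int) : a ^+ 2 - 4 != 0 ->
  [/\ nonsquare (2 - a), nonsquare (a - 2), nonsquare (- 2 - a), nonsquare (a + 2) &
      nonsquare (a ^+ 2 - 4) /\ nonsquare (4 - a ^+ 2)] ->
  galois_group_is (polyF a 1) (T8 9).
Proof.
move=> d0' [n1 n2 n3 n4 [n5 n6]]; have [r [s [rs_add rs1]]] := rootsF1_exist a.
have d0 : a ^+ 2 - 4 * 1 != 0 by rewrite mulr1.
have rs_mul : r ^+ 4 * s ^+ 4 = (1 : int)%:~R by rewrite -exprMn rs1 expr1n.
have Hind := ind9 rs_add rs1 d0.
apply: (galoisF_check rs_add rs_mul isT d0 _ Hind _ check9F) => //.
move=> v; apply: (all_signs_realized3 Hind (sign_char_filter (sign_char_i rs_mul isT d0))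
  (sign_char_sum (r := r) (s := s)) (sign_char_diff (r := r) (s := s))
  sqrCi_int (sqr_sum rs_add rs1) (sqr_diff rs_add rs1) nonsquareN1) => //.
- by move=> k; have := n2 k; lia.
- by move=> k; have := n4 k; lia.
- by move=> k; have := n5 k; nia.
by move=> k; have := n6 k; nia.
Qed.

(** * The roots of [polyG a b] *)

(* Bit 0 of [k] is the sign and bit 1 the inversion. *)
Definition klein (k : nat) (x : algC) : algC :=
  (-1) ^+ odd k * (if odd k./2 then x^-1 else x).
Definition klein_mul (j k : nat) : nat := (odd j (+) odd k) + 2 * (odd j./2 (+) odd k./2).

Definition rootsG (x y : algC) : seq algC :=
  mkseq (fun k => klein k (if (k < 4)%N then x else y)) 8.

(** Automorphisms commute with negation and inversion, so the images [m] of [x] and [n] of [y] fix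
    the whole permutation. *)
Definition permG (m n : nat) : seq nat :=
  mkseq (fun k => let t := if (k < 4)%N then m else n in (4 * (t %/ 4) + klein_mul t k)%N) 8.
Definition DomG : seq (seq nat) :=
  [seq permG mn.1 mn.2 | mn <- allpairs pair (iota 0 8) (iota 0 8) & (mn.1 < 4)%N != (mn.2 < 4)%N].

(** The sign on [x - 1/x]: negation and inversion each reverse it. For [x + 1/x] only the negation
    bit counts. *)
Definition sgNI (m : nat) : bool := odd m (+) odd m./2.
Definition sgP (p : seq nat) : bool := odd (nth 0%N p 0) (+) odd (nth 0%N p 4).
Definition sgQ (p : seq nat) : bool := sgNI (nth 0%N p 0) (+) sgNI (nth 0%N p 4).
Definition sgU1 (p : seq nat) : bool := odd (nth 0%N p 0).
Definition sgV1 (p : seq nat) : bool := sgNI (nth 0%N p 0).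

Lemma check18 : galois_check DomG (fun p => (sgD p, sgP p, sgQ p)) signs3
  [:: 0; 1; 2; 3; 4; 5; 6; 7]%N (cycles8 18).
Proof. vm_cast_no_check (erefl true). Qed.

(** What remains when [P = 1], where the product [(x + 1/x) (y + 1/y)] is rational. *)
Definition DomP := [seq p <- DomG | ~~ sgP p].
Definition DomQ := [seq p <- DomG | ~~ sgQ p].

Lemma check9G : galois_check DomP (fun p => (sgU1 p, sgU1 p (+) sgD p, sgQ p)) signs3
  [:: 0; 1; 3; 2; 4; 5; 7; 6]%N (cycles8 9).
Proof. vm_cast_no_check (erefl true). Qed.

Lemma DomGP p : p \in DomG ->
  exists m n, [/\ p = permG m n, (m < 8)%N, (n < 8)%N & (m < 4)%N != (n < 4)%N].
Proof.
case/mapP => -[m n]; rewrite mem_filter => /andP [mn /allpairsP [[x y] [xin yin [Dx Dy]]]] ->.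
rewrite mem_iota in yin; rewrite mem_iota in xin; exists m, n; split=> //.
  by rewrite Dx.
by rewrite Dy.
Qed.

Lemma permG_Dom m n : (m < 8)%N -> (n < 8)%N -> (m < 4)%N != (n < 4)%N -> permG m n \in DomG.
Proof.
move=> m8 n8 mn; apply/mapP; exists (m, n) => //; rewrite mem_filter; apply/andP; split=> //.
by apply/allpairsP; exists (m, n); split; rewrite ?mem_iota.
Qed.

Lemma permG_params m n : (m < 8)%N -> (n < 8)%N ->
  nth 0%N (permG m n) 0 = m /\ nth 0%N (permG m n) 4 = n.
Proof.
by move: m n => [|[|[|[|[|[|[|[|m]]]]]]]] [|[|[|[|[|[|[|[|n]]]]]]]].
Qed.

Lemma map_polyG (A : comNzRingType) a b :
  map_poly intr (polyG a b) = 'X^8 + (a%:~R)%:P * 'X^6 + (b%:~R)%:P * 'X^4 + (a%:~R)%:P * 'X^2 + 1%:P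
    :> {poly A}.
Proof.
by rewrite /polyG !rmorphD /= ![map_poly _ (_%:P * _)]rmorphM /= !map_polyXn !map_polyC rmorph1.
Qed.

Section RootsG.
Variables (a b : int) (x y : algC).
Hypotheses (x0 : x != 0) (y0 : y != 0).
Let w t : algC := t ^+ 2 + t ^- 2.
Hypotheses (w_add : w x + w y = - a%:~R) (w_mul : w x * w y = b%:~R - 2).
Hypotheses (D0 : a ^+ 2 - 4 * b + 8 != 0) (P0 : b + 2 - 2 * a != 0) (Q0 : b + 2 + 2 * a != 0).

Lemma sqr_wD : (w x - w y) ^+ 2 = (a ^+ 2 - 4 * b + 8)%:~R.
Proof.
have -> : (w x - w y) ^+ 2 = (w x + w y) ^+ 2 - 4 * (w x * w y) by ring.
rewrite w_add w_mul rmorphD rmorphB rmorphXn /= intrM; ring.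
Qed.

Lemma sqr_uP : ((x + x^-1) * (y + y^-1)) ^+ 2 = (b + 2 - 2 * a)%:~R.
Proof.
have -> : ((x + x^-1) * (y + y^-1)) ^+ 2 = w x * w y + 2 * (w x + w y) + 4.
  by rewrite /w; field; rewrite x0 y0.
by rewrite w_add w_mul rmorphB rmorphD /= intrM; ring.
Qed.

Lemma sqr_vQ : ((x - x^-1) * (y - y^-1)) ^+ 2 = (b + 2 + 2 * a)%:~R.
Proof.
have -> : ((x - x^-1) * (y - y^-1)) ^+ 2 = w x * w y - 2 * (w x + w y) + 4.
  by rewrite /w; field; rewrite x0 y0.
by rewrite w_add w_mul !rmorphD /= intrM; ring.
Qed.

Lemma wD_neq0 : w x != w y.
Proof.
apply: contraNneq D0 => wxy; move: sqr_wD; rewrite wxy subrr expr0n /= => /esym/eqP.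
by rewrite intr_eq0.
Qed.

Lemma uv_neq0 : [/\ x + x^-1 != 0, y + y^-1 != 0, x - x^-1 != 0 & y - y^-1 != 0].
Proof.
have H1 : (x + x^-1) * (y + y^-1) != 0.
  apply: contraNneq P0 => H; move: sqr_uP; rewrite H expr0n /= => /esym/eqP; by rewrite intr_eq0.
have H2 : (x - x^-1) * (y - y^-1) != 0.
  apply: contraNneq Q0 => H; move: sqr_vQ; rewrite H expr0n /= => /esym/eqP; by rewrite intr_eq0.
by move: H1 H2; rewrite !mulf_eq0 !negb_or => /andP [-> ->] /andP [-> ->].
Qed.

Lemma polyGE t : t != 0 ->
  (polyZC (polyG a b)).[t] = t ^+ 4 * ((w t - w x) * (w t - w y)).
Proof.
move=> t0; rewrite /polyZC map_polyG !(hornerD, hornerM, hornerX, hornerC).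
have -> : (w t - w x) * (w t - w y) = w t ^+ 2 - (w x + w y) * w t + w x * w y by ring.
by rewrite w_add w_mul /w; field; rewrite t0.
Qed.

Lemma rootG_neq0 t : root (polyZC (polyG a b)) t -> t != 0.
Proof.
apply: contraTneq => ->; rewrite /root /polyZC map_polyG !(hornerD, hornerM, hornerX, hornerC).
by rewrite !(mul0r, mulr0, add0r) oner_eq0.
Qed.

Lemma rootG_w t : t != 0 -> root (polyZC (polyG a b)) t = (w t == w x) || (w t == w y).
Proof.
by move=> t0; rewrite /root polyGE // mulf_eq0 expf_eq0 /= (negPf t0) mulf_eq0 !subr_eq0.
Qed.

Lemma eq_w t z : t != 0 -> z != 0 -> w t = w z -> exists2 k, (k < 4)%N & t = klein k z.
Proof.
move=> t0 z0 wtz; have : (t - z) * (t + z) * ((t - z^-1) * (t + z^-1)) == 0.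
  have -> : (t - z) * (t + z) * ((t - z^-1) * (t + z^-1)) = t ^+ 2 * (w t - w z).
    by rewrite /w; field; rewrite t0 z0.
  by rewrite wtz subrr mulr0.
rewrite !mulf_eq0 !subr_eq0 !addr_eq0 => /orP [/orP [] | /orP []] /eqP ->.
- by exists 0%N => //; rewrite /klein mul1r.
- by exists 1%N => //; rewrite /klein mulN1r.
- by exists 2%N => //; rewrite /klein mul1r.
by exists 3%N => //; rewrite /klein mulN1r.
Qed.

Lemma w_klein k t : w (klein k t) = w t.
Proof.
have wV : w t^-1 = w t by rewrite /w exprVn invrK addrC.
have wN z : w (- z) = w z by rewrite /w sqrrN.
by rewrite /klein; case: ifP => _; case: (odd k); rewrite ?(mul1r, mulN1r) ?wN.
Qed.

Lemma kleinM j k t : klein j (klein k t) = klein (klein_mul k j) t.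
Proof.
rewrite /klein /klein_mul; case: (odd j) (odd j./2) (odd k) (odd k./2) => [] [] [] [] /=;
  by rewrite ?(mul1r, mulN1r, invrN, invrK, opprK).
Qed.

Lemma klein_neq0 k t : t != 0 -> klein k t != 0.
Proof.
by move=> t0; rewrite /klein mulf_neq0 ?signr_eq0 //; case: ifP => _; rewrite ?invr_eq0.
Qed.

Lemma nth_rootsG k : (k < 8)%N -> nth 0 (rootsG x y) k = klein k (if (k < 4)%N then x else y).
Proof. by move=> k8; rewrite nth_mkseq. Qed.

Lemma rootsG_root t : t \in rootsG x y -> root (polyZC (polyG a b)) t.
Proof.
move=> /mapP [k _ ->]; rewrite rootG_w ?w_klein; first by case: ifP; rewrite eqxx ?orbT.
by apply: klein_neq0; case: ifP.
Qed.

Lemma rootsGP t : root (polyZC (polyG a b)) t ->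
  exists2 m, (m < 8)%N & t = nth 0 (rootsG x y) m.
Proof.
move=> rt; have t0 := rootG_neq0 rt; move: rt; rewrite rootG_w // => /orP [] /eqP.
  move=> /(eq_w t0 x0) [m m4 ->]; exists m; first by lia.
  by rewrite nth_rootsG ?m4 //; lia.
move=> /(eq_w t0 y0) [m m4 ->]; exists (m + 4)%N; first by lia.
rewrite nth_rootsG; last by lia.
by move: m m4 => [|[|[|[|m]]]].
Qed.

Lemma uniq_rootsG : uniq (rootsG x y).
Proof.
have [ux uy vx vy] := uv_neq0; have wxy := wD_neq0.
have K t k : t != 0 -> t + t^-1 != 0 -> t - t^-1 != 0 -> (k < 4)%N -> klein k t = t -> k = 0%N.
  move=> t0 ut vt; move: k => [|[|[|[|k]]]] //= _; rewrite /klein /= ?mul1r ?mulN1r => /eqP.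
  - by rewrite eq_sym -addr_eq0 -mulr2n mulrn_eq0 (negPf t0).
  - by rewrite eq_sym -subr_eq0 (negPf vt).
  by rewrite eqr_oppLR -addr_eq0 addrC (negPf ut).
apply/(uniqP 0) => j k; rewrite !inE !size_mkseq => j8 k8; rewrite !nth_rootsG // => jk.
have blk : (j < 4)%N = (k < 4)%N.
  have := congr1 w jk; rewrite !w_klein.
  by case: (j < 4)%N (k < 4)%N => [] [] // /eqP; rewrite ?(negPf wxy) // eq_sym (negPf wxy).
have jk' : klein (klein_mul k j) (if (k < 4)%N then x else y) = (if (k < 4)%N then x else y).
  have := congr1 (klein j) jk; rewrite !kleinM blk => <-.
  by rewrite /klein_mul !addbb /klein /= mul1r.
have : klein_mul k j = 0%N.
  move: jk'; case: (k < 4)%N => H; apply: (K _ _ _ _ _ _ H) => //;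
    by rewrite /klein_mul; do 2!case: (_ (+) _).
by move: j k j8 k8 blk {jk jk'} => [|[|[|[|[|[|[|[|j]]]]]]]] [|[|[|[|[|[|[|[|k]]]]]]]].
Qed.

Lemma klein_aut (u : {rmorphism algC -> algC}) k t : u (klein k t) = klein k (u t).
Proof. by rewrite /klein rmorphM rmorph_sign; case: ifP; rewrite ?fmorphV. Qed.

Lemma indG u : exists2 p, p \in DomG & induces (rootsG x y) u p.
Proof.
have [m m8 um] : exists2 m, (m < 8)%N & u x = nth 0 (rootsG x y) m.
  by apply: rootsGP; rewrite polyZC_aut rootG_w // eqxx.
have [n n8 un] : exists2 n, (n < 8)%N & u y = nth 0 (rootsG x y) n.
  by apply: rootsGP; rewrite polyZC_aut rootG_w // eqxx orbT.
have uw t : u (w t) = w (u t) by rewrite /w rmorphD fmorphV rmorphXn.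
have mn : (m < 4)%N != (n < 4)%N.
  apply: contraNneq wD_neq0 => mn; rewrite -(inj_eq (fmorph_inj u)) !uw um un.
  by rewrite !nth_rootsG // !w_klein mn.
exists (permG m n); first exact: permG_Dom.
have key t k : (t < 8)%N -> nth 0 (rootsG x y) (4 * (t %/ 4) + klein_mul t k)%N
   = klein k (nth 0 (rootsG x y) t).
  have k4 : (klein_mul t k < 4)%N by rewrite /klein_mul; do 2!case: (_ (+) _).
  move=> t8; rewrite !nth_rootsG //; last by lia.
  have -> : (4 * (t %/ 4) + klein_mul t k < 4)%N = (t < 4)%N by lia.
  rewrite kleinM; case: (leqP 4 t) => t4; last by rewrite divn_small.
  have -> : (t %/ 4 = 1)%N by lia.
  by rewrite muln1; move: (klein_mul t k) k4 => [|[|[|[|]]]].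
move=> k k8; rewrite [nth 0%N _ k]nth_mkseq // key; last by case: ifP.
by rewrite nth_rootsG // klein_aut; case: ifP => _; rewrite -?um -?un.
Qed.

Section Chars.
Variables (u : {rmorphism algC -> algC}) (p : seq nat).
Hypotheses (pD : p \in DomG) (Hp : induces (rootsG x y) u p).

Let m := nth 0%N p 0.
Let n := nth 0%N p 4.

Lemma charG_params : [/\ (m < 8)%N, (n < 8)%N, (m < 4)%N != (n < 4)%N,
  u x = klein m (if (m < 4)%N then x else y) & u y = klein n (if (n < 4)%N then x else y)].
Proof.
have [m' [n' [Dp m8 n8 mn]]] := DomGP pD.
have [Em En] := permG_params m8 n8; rewrite -Dp -/m -/n in Em En.
rewrite Em En; split=> //.
  by have := Hp (erefl : (0 < 8)%N); rewrite -/m Em !nth_rootsG // {1}/klein mul1r.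
by have := Hp (erefl : (4 < 8)%N); rewrite -/n En !nth_rootsG // {1}/klein mul1r.
Qed.

Lemma klein_u k (z : algC) : klein k z + (klein k z)^-1 = (-1) ^+ odd k * (z + z^-1).
Proof. by rewrite /klein; case: ifP => _; case: (odd k); rewrite ?(mul1r, mulN1r, invrN, invrK, opprD) // addrC. Qed.

Lemma klein_v k (z : algC) : klein k z - (klein k z)^-1 = (-1) ^+ sgNI k * (z - z^-1).
Proof.
by rewrite /klein /sgNI signr_addb; case: (odd k./2) (odd k) => [] [];
  rewrite ?(mul1r, mulN1r, invrN, invrK, opprD, opprK, expr0, expr1, mulr1) // addrC.
Qed.

Lemma charG_D : u (w x - w y) = (-1) ^+ sgD p * (w x - w y).
Proof.
have [m8 n8 mn ux uy] := charG_params.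
rewrite rmorphB /= {1 2}/w !rmorphD !fmorphV !rmorphXn /= ux uy -!/(w _) !w_klein /sgD -/m.
rewrite [(4 <= m)%N]leqNgt; move: mn; case: (m < 4)%N (n < 4)%N => [] [] //= _; ring.
Qed.

Lemma charG_u : u (x + x^-1) = (-1) ^+ odd m * (if (m < 4)%N then x + x^-1 else y + y^-1) /\
  u (y + y^-1) = (-1) ^+ odd n * (if (n < 4)%N then x + x^-1 else y + y^-1).
Proof.
have [m8 n8 mn ux uy] := charG_params.
by rewrite !rmorphD !fmorphV ux uy !klein_u; do 2!case: ifP.
Qed.

Lemma charG_v : u (x - x^-1) = (-1) ^+ sgNI m * (if (m < 4)%N then x - x^-1 else y - y^-1) /\
  u (y - y^-1) = (-1) ^+ sgNI n * (if (n < 4)%N then x - x^-1 else y - y^-1).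
Proof.
have [m8 n8 mn ux uy] := charG_params.
by rewrite !rmorphB !fmorphV ux uy !klein_v; do 2!case: ifP.
Qed.

Lemma charG_P : u ((x + x^-1) * (y + y^-1)) = (-1) ^+ sgP p * ((x + x^-1) * (y + y^-1)).
Proof.
have [_ _ mn _ _] := charG_params; have [ux uy] := charG_u.
rewrite rmorphM ux uy /sgP -/m -/n signr_addb.
by move: mn; case: (m < 4)%N (n < 4)%N => [] [] //= _; ring.
Qed.

Lemma charG_Q : u ((x - x^-1) * (y - y^-1)) = (-1) ^+ sgQ p * ((x - x^-1) * (y - y^-1)).
Proof.
have [_ _ mn _ _] := charG_params; have [ux uy] := charG_v.
rewrite rmorphM ux uy /sgQ -/m -/n signr_addb.
by move: mn; case: (m < 4)%N (n < 4)%N => [] [] //= _; ring.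
Qed.

Lemma charG_usum : odd m = odd n ->
  u (x + x^-1 + (y + y^-1)) = (-1) ^+ sgU1 p * (x + x^-1 + (y + y^-1)) /\
  u (x + x^-1 - (y + y^-1)) = (-1) ^+ (sgU1 p (+) sgD p) * (x + x^-1 - (y + y^-1)).
Proof.
move=> mn2; have [_ _ mn _ _] := charG_params; have [ux uy] := charG_u.
rewrite rmorphD rmorphB ux uy /sgU1 /sgD -/m -mn2 signr_addb [(4 <= m)%N]leqNgt.
by move: mn; case: (m < 4)%N (n < 4)%N => [] [] //= _; split; ring.
Qed.

Lemma charG_vsum : sgNI m = sgNI n ->
  u (x - x^-1 + (y - y^-1)) = (-1) ^+ sgV1 p * (x - x^-1 + (y - y^-1)) /\
  u (x - x^-1 - (y - y^-1)) = (-1) ^+ (sgV1 p (+) sgD p) * (x - x^-1 - (y - y^-1)).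
Proof.
move=> mn2; have [_ _ mn _ _] := charG_params; have [ux uy] := charG_v.
rewrite [u (_ + (_ - _))]rmorphD [u (_ - (_ - _))]rmorphB ux uy /sgV1 /sgD -/m -mn2 signr_addb [(4 <= m)%N]leqNgt.
by move: mn; case: (m < 4)%N (n < 4)%N => [] [] //= _; split; ring.
Qed.

End Chars.

Lemma sign_charG_D : sign_char (rootsG x y) DomG sgD (w x - w y).
Proof. by move=> u p pD Hp; apply: charG_D pD Hp. Qed.

Lemma sign_charG_P : sign_char (rootsG x y) DomG sgP ((x + x^-1) * (y + y^-1)).
Proof. by move=> u p pD Hp; apply: charG_P pD Hp. Qed.

Lemma sign_charG_Q : sign_char (rootsG x y) DomG sgQ ((x - x^-1) * (y - y^-1)).
Proof. by move=> u p pD Hp; apply: charG_Q pD Hp. Qed.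

Lemma galoisG_check (V : eqType) Dom (sgn : seq nat -> V) vs c X :
  X \in [:: 2; 3; 4; 6; 8; 9; 10; 11; 15; 16; 17; 18; 22; 26]%N ->
  (forall u, exists2 p, p \in Dom & induces (rootsG x y) u p) ->
  (forall v, exists p, [/\ p \in Dom, exists u, induces (rootsG x y) u p & sgn p = v]) ->
  galois_check Dom sgn vs c (cycles8 X) -> galois_group_is (polyG a b) (T8 X).
Proof.
move=> HX HindD Hv Hc; rewrite (T8_cycles HX).
apply: (@galois_group_check _ _ (rootsG x y)) Hc => //.
- exact: uniq_rootsG.
exact: rootsG_root.
Qed.

End RootsG.

(** * Large Galois groups of [polyG] *)

Lemma sqrDV_exist (w : algC) : exists2 x : algC, x != 0 & x ^+ 2 + x ^- 2 = w.
Proof.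
pose e := sqrtC (w ^+ 2 - 4); have e2 : e ^+ 2 = w ^+ 2 - 4 by rewrite sqrtCK.
(* The square of [x] is a root of [T^2 - w T + 1], whose two roots are mutually inverse. *)
pose x := sqrtC ((w + e) / 2); have x2 : x ^+ 2 = (w + e) / 2 by rewrite sqrtCK.
have H : (w + e) / 2 * ((w - e) / 2) = 1.
  have -> : (w + e) / 2 * ((w - e) / 2) = (w ^+ 2 - e ^+ 2) / 4 by field.
  by rewrite e2; field.
have we0 : (w + e) / 2 != 0 by apply: contra_eq_neq H => ->; rewrite mul0r eq_sym oner_neq0.
exists x; first by apply: contraNneq we0 => xe; rewrite -x2 xe expr0n.
have -> : x ^- 2 = (w - e) / 2 by rewrite x2; apply: (mulfI we0); rewrite H mulfV.
by rewrite x2; field.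
Qed.

Lemma rootsG_exist (a b : int) : exists x y : algC, [/\ x != 0, y != 0,
  (x ^+ 2 + x ^- 2) + (y ^+ 2 + y ^- 2) = - a%:~R &
  (x ^+ 2 + x ^- 2) * (y ^+ 2 + y ^- 2) = b%:~R - 2].
Proof.
pose e := sqrtC ((a ^+ 2 - 4 * b + 8)%:~R : algC).
have e2 : e ^+ 2 = a%:~R ^+ 2 - 4 * b%:~R + 8.
  by rewrite sqrtCK rmorphD rmorphB rmorphXn /= intrM.
have [x x0 Ex] := sqrDV_exist ((- a%:~R + e) / 2); have [y y0 Ey] := sqrDV_exist ((- a%:~R - e) / 2).
exists x, y; rewrite Ex Ey; split=> //; first by field.
have -> : (- a%:~R + e) / 2 * ((- a%:~R - e) / 2) = (a%:~R ^+ 2 - e ^+ 2) / 4 by field.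
by rewrite e2; field.
Qed.

Lemma galoisG18 (a b : int) (D := a ^+ 2 - 4 * b + 8) (P := b + 2 - 2 * a) (Q := b + 2 + 2 * a) :
  [/\ nonsquare D, nonsquare P & nonsquare Q] ->
  [/\ nonsquare (D * P), nonsquare (D * Q), nonsquare (P * Q) & nonsquare (D * P * Q)] ->
  galois_group_is (polyG a b) (T8 18).
Proof.
move=> [nD nP nQ] [nDP nDQ nPQ nDPQ]; have [x [y [x0 y0 w_add w_mul]]] := rootsG_exist a b.
have nz N : nonsquare N -> N != 0 by move=> nN; apply/eqP => N0; apply: (nN 0); rewrite N0.
have Hind := indG x0 y0 w_add w_mul (nz _ nD) (nz _ nP) (nz _ nQ).
apply: (galoisG_check x0 y0 w_add w_mul (nz _ nD) (nz _ nP) (nz _ nQ) _ Hind _ check18) => //.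
move=> v; exact: (all_signs_realized3 Hind (sign_charG_D (x := x) (y := y))
  (sign_charG_P (x := x) (y := y)) (sign_charG_Q (x := x) (y := y))
  (sqr_wD w_add w_mul) (sqr_uP x0 y0 w_add w_mul) (sqr_vQ x0 y0 w_add w_mul) nD nP nQ).
Qed.

(** Replacing [y] by [- y] leaves the list of roots unchanged as a set and removes the sign
    ambiguity of a product whose square is 1. *)
Lemma odd_choice (g : algC -> algC) (c y : algC) : (forall t, g (- t) = - g t) -> y != 0 ->
  (c * g y) ^+ 2 = 1 ->
  exists y', [/\ y' != 0, y' ^+ 2 + y' ^- 2 = y ^+ 2 + y ^- 2 & c * g y' = 1].
Proof.
move=> gN y0 /eqP; rewrite sqrf_eq1 => /orP [] /eqP E; first by exists y.
by exists (- y); rewrite oppr_eq0 sqrrN; split; rewrite // gN mulrN E opprK.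
Qed.

Lemma oddDV (t : algC) : - t + (- t)^-1 = - (t + t^-1).
Proof. by rewrite invrN opprD. Qed.

Lemma oddBV (t : algC) : - t - (- t)^-1 = - (t - t^-1).
Proof. by rewrite invrN opprD. Qed.

Section GaloisP1.
Variables (a b : int) (x y : algC).
Hypotheses (x0 : x != 0) (y0 : y != 0).
Hypothesis w_add : (x ^+ 2 + x ^- 2) + (y ^+ 2 + y ^- 2) = - a%:~R.
Hypothesis w_mul : (x ^+ 2 + x ^- 2) * (y ^+ 2 + y ^- 2) = b%:~R - 2.
Hypotheses (D0 : a ^+ 2 - 4 * b + 8 != 0) (P0 : b + 2 - 2 * a != 0) (Q0 : b + 2 + 2 * a != 0).

Lemma indP : (x + x^-1) * (y + y^-1) = 1 -> 
  forall u, exists2 p, p \in DomP & induces (rootsG x y) u p.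
Proof.
move=> uP; apply: ind_filter (indG x0 y0 w_add w_mul D0 P0 Q0) _ => u p pD Hp.
have := charG_P pD Hp; rewrite uP rmorph1 mulr1; case: (sgP p) => //= /eqP.
by rewrite expr1 -addr_eq0 -mulr2n pnatr_eq0.
Qed.

Lemma indQ : (x - x^-1) * (y - y^-1) = 1 -> 
  forall u, exists2 p, p \in DomQ & induces (rootsG x y) u p.
Proof.
move=> uP; apply: ind_filter (indG x0 y0 w_add w_mul D0 P0 Q0) _ => u p pD Hp.
have := charG_Q pD Hp; rewrite uP rmorph1 mulr1; case: (sgQ p) => //= /eqP.
by rewrite expr1 -addr_eq0 -mulr2n pnatr_eq0.
Qed.

Lemma sign_char_usum : sign_char (rootsG x y) DomP sgU1 (x + x^-1 + (y + y^-1)).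
Proof.
move=> u p; rewrite mem_filter => /andP [sp pD] Hp.
have /(charG_usum pD Hp) [] // : odd (nth 0%N p 0) = odd (nth 0%N p 4).
by move: sp; rewrite /sgP; do 2!case: (odd _).
Qed.

Lemma sign_char_udiff : sign_char (rootsG x y) DomP (fun p => sgU1 p (+) sgD p) (x + x^-1 - (y + y^-1)).
Proof.
move=> u p; rewrite mem_filter => /andP [sp pD] Hp.
have /(charG_usum pD Hp) [] // : odd (nth 0%N p 0) = odd (nth 0%N p 4).
by move: sp; rewrite /sgP; do 2!case: (odd _).
Qed.

Lemma sign_char_vsum : sign_char (rootsG x y) DomQ sgV1 (x - x^-1 + (y - y^-1)).
Proof.
move=> u p; rewrite mem_filter => /andP [sp pD] Hp.
have /(charG_vsum pD Hp) [] // : sgNI (nth 0%N p 0) = sgNI (nth 0%N p 4).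
by move: sp; rewrite /sgQ; do 2!case: (sgNI _).
Qed.

Lemma sign_char_vdiff : sign_char (rootsG x y) DomQ (fun p => sgV1 p (+) sgD p) (x - x^-1 - (y - y^-1)).
Proof.
move=> u p; rewrite mem_filter => /andP [sp pD] Hp.
have /(charG_vsum pD Hp) [] // : sgNI (nth 0%N p 0) = sgNI (nth 0%N p 4).
by move: sp; rewrite /sgQ; do 2!case: (sgNI _).
Qed.

Lemma sqr_usum : (x + x^-1) * (y + y^-1) = 1 ->
  (x + x^-1 + (y + y^-1)) ^+ 2 = (6 - a)%:~R /\ (x + x^-1 - (y + y^-1)) ^+ 2 = (2 - a)%:~R.
Proof.
move=> uP; have E : (x + x^-1) ^+ 2 + (y + y^-1) ^+ 2 = 4 - a%:~R.
  rewrite -w_add; field; by rewrite x0 y0.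
have sq (U V : algC) : (U + V) ^+ 2 = U ^+ 2 + V ^+ 2 + 2 * (U * V) by ring.
have sq' (U V : algC) : (U - V) ^+ 2 = U ^+ 2 + V ^+ 2 - 2 * (U * V) by ring.
by rewrite sq sq' E uP !rmorphB /=; split; ring.
Qed.

Lemma sqr_vsum : (x - x^-1) * (y - y^-1) = 1 ->
  (x - x^-1 + (y - y^-1)) ^+ 2 = (- 2 - a)%:~R /\ (x - x^-1 - (y - y^-1)) ^+ 2 = (- 6 - a)%:~R.
Proof.
move=> uP; have E : (x - x^-1) ^+ 2 + (y - y^-1) ^+ 2 = - 4 - a%:~R.
  rewrite -w_add; field; by rewrite x0 y0.
have sq (U V : algC) : (U + V) ^+ 2 = U ^+ 2 + V ^+ 2 + 2 * (U * V) by ring.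
have sq' (U V : algC) : (U - V) ^+ 2 = U ^+ 2 + V ^+ 2 - 2 * (U * V) by ring.
by rewrite sq sq' E uP !rmorphB /=; split; ring.
Qed.

End GaloisP1.

(** With [P = 1] one has [D = (6 - a) (2 - a)], and the two factors acquire square roots of their
    own, the sum and the difference of [x + 1/x] and [y + 1/y]. *)
Lemma galoisG9 (a b : int) (Q := b + 2 + 2 * a) : b + 2 - 2 * a = 1 ->
  [/\ nonsquare (6 - a), nonsquare (2 - a) & nonsquare Q] ->
  [/\ nonsquare ((6 - a) * (2 - a)), nonsquare ((6 - a) * Q), nonsquare ((2 - a) * Q) &
      nonsquare ((6 - a) * (2 - a) * Q)] ->
  galois_group_is (polyG a b) (T8 9).
Proof.
move=> P1 [n6 n2 nQ] [n62 n6Q n2Q n62Q]; have [x [z [x0 z0 w_add w_mul]]] := rootsG_exist a b.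
have nz N : nonsquare N -> N != 0 by move=> nN; apply/eqP => N0; apply: (nN 0); rewrite N0.
have P0 : b + 2 - 2 * a != 0 by rewrite P1.
have := sqr_uP x0 z0 w_add w_mul; rewrite P1 => /(odd_choice oddDV z0) [y [y0 yE uP]].
rewrite -yE in w_add w_mul.
have D0 : a ^+ 2 - 4 * b + 8 != 0.
  by rewrite (_ : _ - _ + _ = (6 - a) * (2 - a)) ?nz //; lia.
have Hind := indP x0 y0 w_add w_mul D0 P0 (nz _ nQ) uP.
apply: (galoisG_check x0 y0 w_add w_mul D0 P0 (nz _ nQ) _ Hind _ check9G) => //.
have [us ud] := sqr_usum x0 y0 w_add uP.
move=> v; exact: (all_signs_realized3 Hind (sign_char_usum (x := x) (y := y))
  (sign_char_udiff (x := x) (y := y)) (sign_char_filter (sign_charG_Q (x := x) (y := y)))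
  us ud (sqr_vQ x0 y0 w_add w_mul) n6 n2 nQ).
Qed.

(** * Integral elements of [Z[theta]] and Dedekind's criterion *)

Notation redp l := (map_poly (intr : int -> 'F_l)).

Lemma intr_Fp_eq0 l (z : int) : prime l -> (z%:~R == 0 :> 'F_l) = (l %| z)%Z.
Proof. by move=> pl; rewrite (dvdz_pcharf (pchar_Fp pl)). Qed.

Lemma redp_surj l (g : {poly 'F_l}) : exists h : {poly int}, redp l h = g.
Proof.
exists (map_poly (fun x : 'F_l => (val x)%:Z) g); apply/polyP => i.
rewrite coef_map /= coef_map_id0 //=; exact: natr_Zp.
Qed.

Lemma redp_eq0 l (g : {poly int}) : prime l -> redp l g = 0 -> exists h, g = l%:Z%:P * h.
Proof.
move=> pl g0; exists (\poly_(i < size g) (g`_i %/ l)%Z); apply/polyP => i.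
rewrite coefCM coef_poly; case: ltnP => ig; last by rewrite nth_default ?mulr0.
rewrite mulrC divzK // -intr_Fp_eq0 //.
by have /polyP/(_ i) := g0; rewrite coef_map coef0 => ->.
Qed.

Lemma redp_dvd l (f g : {poly int}) : prime l -> redp l f %| redp l g ->
  exists q h, g = f * q + l%:Z%:P * h.
Proof.
move=> pl /dvdpP [c cE]; have [q qE] := redp_surj c.
have [|h hE] := @redp_eq0 l (g - f * q) pl.
  by rewrite rmorphB rmorphM /= qE cE mulrC subrr.
by exists q, h; rewrite -hE addrC subrK.
Qed.

Lemma redp_l l (h : {poly int}) : prime l -> redp l (l%:Z%:P * h) = 0.
Proof.
move=> pl; rewrite rmorphM /= map_polyC /=.
by have /eqP -> : (l%:Z)%:~R == 0 :> 'F_l; rewrite ?mul0r // intr_Fp_eq0 // dvdzz.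
Qed.

Section Integral.
Variables (f : {poly int}) (theta : algC).
Hypotheses (f_monic : f \is monic).
Hypothesis f_irr : irreducible_poly (map_poly intr f : {poly rat}).
Hypothesis f_theta : root (polyZC f) theta.

Notation ev g := ((map_poly intr g : {poly algC}).[theta]).

(** The minimal polynomial of [theta] divides both [f] and [g]; by irreducibility it has the degree
    of [f]. *)
Lemma ev_lt (g : {poly int}) : (size g < size f)%N -> ev g = 0 -> g = 0.
Proof.
move=> sgf g0; have [p [_ p_mon] Hp] := minCpolyP theta.
have QZ (h : {poly int}) : map_poly ratr (map_poly intr h : {poly rat}) = map_poly intr h :> {poly algC}.
  by rewrite -map_poly_comp; apply: eq_map_poly => z /=; rewrite ratr_int.
have pf : p %| map_poly intr f by rewrite -Hp QZ.
have pg : p %| map_poly intr g by rewrite -Hp QZ /root g0.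
have sz (h : {poly int}) : size (map_poly intr h : {poly rat}) = size h.
  by rewrite size_map_inj_poly //; apply: intr_inj.
have sp : size p != 1%N.
  apply/negP => /size_poly1P [c c0 pc]; have : root (map_poly ratr p) theta by rewrite Hp.
  by rewrite pc map_polyC rootC fmorph_eq0 (negPf c0).
have := f_irr.2 _ sp pf => /eqp_size; rewrite sz => spf.
apply/eqP; rewrite -size_poly_eq0 -sz; apply: contraTT sgf => g0'; rewrite -leqNgt -spf -(sz g).
by apply: dvdp_leq; rewrite // -size_poly_eq0.
Qed.

Lemma ev_f q : ev (f * q) = 0.
Proof. by rewrite rmorphM hornerM (rootP f_theta) mul0r. Qed.

Lemma ev_eq0 (g : {poly int}) : ev g = 0 -> exists q, g = f * q.
Proof.
move=> g0; exists (Pdiv.Ring.rdivp g f); have E := Pdiv.RingMonic.rdivp_eq f_monic g; rewrite {1}E.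
have -> : Pdiv.Ring.rmodp g f = 0; last by rewrite addr0 mulrC.
apply: ev_lt; first by rewrite Pdiv.Ring.ltn_rmodpN0 ?monic_neq0.
by move: g0; rewrite {1}E rmorphD hornerD mulrC ev_f add0r.
Qed.

Lemma ev_Aint g : ev g \in Aint.
Proof.
have tA : theta \in Aint.
  apply: (root_monic_Aint f_theta); first by rewrite /polyZC monic_map.
  by apply/polyOverP => i; rewrite coef_map /= rpred_int.
rewrite horner_coef; apply: rpred_sum => i _; rewrite coef_map /= rpredM ?rpredX //.
by rewrite Aint_int.
Qed.

Lemma evM g h : ev (g * h) = ev g * ev h. Proof. by rewrite rmorphM hornerM. Qed.
Lemma evD g h : ev (g + h) = ev g + ev h. Proof. by rewrite rmorphD hornerD. Qed.
Lemma evB g h : ev (g - h) = ev g - ev h. Proof. by rewrite rmorphB hornerD hornerN. Qed.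
Lemma evC c : ev c%:P = c%:~R. Proof. by rewrite map_polyC hornerC. Qed.
Lemma evX g n : ev (g ^+ n) = ev g ^+ n. Proof. by rewrite rmorphXn horner_exp. Qed.

(** If [ev g / l] is a root of a monic integral polynomial of degree [n], clearing denominators
    expresses [g^n] through lower powers of [g] with coefficients divisible by [l]. So [g] is
    nilpotent modulo [l] and [f]. *)
Lemma integral_nilpotent l g : prime l -> ev g / l%:R \in Aint ->
  exists n, redp l f %| redp l g ^+ n.
Proof.
move=> pl; set be := ev g / _ => beA.
have l0 : (l%:R : algC) != 0 by rewrite pnatr_eq0 -lt0n prime_gt0.
have gbe : ev g = l%:R * be by rewrite mulrC divfK.
have [p [Dp p_mon] Hp] := minCpolyP be.
have /floorpP [m Dm] : minCpoly be \is a polyOver Num.int by have := beA; rewrite unfold_in.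
have m_mon : m \is monic.
  have := minCpoly_monic be; rewrite Dm !monicE lead_coef_map_inj ?rmorph0 //; last exact: intr_inj.
  by rewrite -[1]/(1%:~R) eqr_int.
have mbe : (map_poly intr m : {poly algC}).[be] = 0 by rewrite -Dm; apply/rootP/root_minCpoly.
set n := (size m).-1.
have sm : size m = n.+1 by rewrite prednK // size_poly_gt0 monic_neq0.
pose H := \sum_(i < n.+1) (m`_i * l%:Z ^+ (n - i))%:P * g ^+ i.
have H0 : ev H = 0.
  rewrite /H rmorph_sum horner_sum /=.
  transitivity (l%:R ^+ n * (map_poly intr m : {poly algC}).[be]); last by rewrite mbe mulr0.
  rewrite horner_coef size_map_inj_poly ?rmorph0 //; last exact: intr_inj.
  rewrite sm big_distrr /=; apply: eq_bigr => i _.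
  rewrite evM evC evX gbe coef_map /= rmorphM rmorphXn /= exprMn.
  have -> : (l%:R : algC) ^+ n = l%:R ^+ (n - i) * l%:R ^+ i by rewrite -exprD subnK // -ltnS.
  ring.
have [q Hq] := ev_eq0 H0.
exists n; have -> : redp l g ^+ n = redp l H; last by rewrite Hq rmorphM dvdp_mulr.
rewrite /H big_ord_recr rmorphD rmorph_sum /= big1 => [|i _].
  rewrite add0r subnn expr0 mulr1 [redp l (_%:P * _)]rmorphM /= map_polyC /= rmorphXn /=.
  have -> : m`_n = 1 by rewrite /n -lead_coefE (monicP m_mon).
  by rewrite rmorph1 mul1r.
have -> : (n - i = (n - i.+1).+1)%N by have := ltn_ord i; lia.
rewrite exprS mulrCA rmorphM /= -[RHS](mul0r (redp l (g ^+ i))) ; congr (_ * _).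
by rewrite polyCM redp_l.
Qed.

(** In other words, [l] does not divide the index of [Z[theta]] in the ring of integers. *)
Definition maximal_at l := forall g, ev g / l%:R \in Aint -> redp l f %| redp l g.

Lemma Z_theta_integral : (forall l, prime l -> maximal_at l) ->
  forall alpha, Qadj theta alpha -> alpha \in Aint ->
  exists q : {poly int}, (size q <= (size f).-1)%N /\ alpha = ev q.
Proof.
move=> Hmax alpha [p Dp] alA.
have [q [a a0 pE]] := rat_poly_scale p.
have aq : alpha = ev q / a%:~R.
  rewrite Dp pE /polyQC map_polyZ hornerZ -map_poly_comp mulrC fmorphV /= ratr_int; congr (_.[_] / _).
  by apply: eq_map_poly => z /=; rewrite ratr_int.
(* Strong induction on the denominator, from which one prime is cancelled at a time. *)
have key : forall n g, (0 < n)%N -> ev g / n%:R \in Aint -> exists h, ev g / n%:R = ev h.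
  elim/ltn_ind => n IH g n0 gA.
  have [n1|n1] := leqP n 1.
    have -> : n = 1%N by apply/eqP; rewrite eqn_leq n1 n0.
    by exists g; rewrite divr1.
  have pl := pdiv_prime n1; set l := pdiv n in pl.
  have [m nE] := dvdnP (pdiv_dvd n); rewrite -/l in nE.
  have m0 : (0 < m)%N by move: n0; rewrite nE muln_gt0 => /andP [].
  have l0 : (l%:R : algC) != 0 by rewrite pnatr_eq0 -lt0n prime_gt0.
  have mC : (m%:R : algC) != 0 by rewrite pnatr_eq0 -lt0n.
  have : ev g / l%:R \in Aint.
    have -> : ev g / l%:R = m%:R * (ev g / n%:R) by rewrite nE natrM; field; rewrite l0 mC.
    by rewrite rpredM // Aint_Cnat // natr_nat.
  move=> /(Hmax l pl) /(redp_dvd pl) [q' [h gE]].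
  have gh : ev g / n%:R = ev h / m%:R.
    by rewrite gE evD ev_f add0r evM evC nE natrM; field; rewrite l0 mC.
  rewrite gh; apply: IH => //; last by rewrite -gh.
  by rewrite nE -{1}[m]muln1 ltn_mul2l m0 prime_gt1.
have [h hE] : exists h, alpha = ev h.
  move: a0 aq {pE}; case: a => a a0 aq.
    by rewrite aq; apply: key; [case: a a0 {aq} | rewrite -[a%:R]/(a%:Z%:~R) -aq].
  have aqN : alpha = ev (- q) / a.+1%:R.
    by rewrite aq NegzE !rmorphN /= hornerN invrN mulrN mulNr.
  by rewrite aqN; apply: key => //; rewrite -aqN.
exists (Pdiv.Ring.rmodp h f); split.
  by rewrite -ltnS prednK ?size_poly_gt0 ?monic_neq0 // Pdiv.Ring.ltn_rmodpN0 ?monic_neq0.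
by rewrite hE {1}(Pdiv.RingMonic.rdivp_eq f_monic h) evD mulrC ev_f add0r.
Qed.

(** Dedekind's criterion: modulo [l], [phi] is the radical of [f], and the last hypothesis expresses
    that [phi], [h] and [F] have no common factor. *)
Lemma dedekind l (phi h F : {poly int}) N : prime l -> f = phi * h + l%:Z%:P * F ->
  redp l f %| redp l phi ^+ N ->
  (forall g n, redp l phi %| g ^+ n -> redp l phi %| g) ->
  (forall t, redp l phi %| redp l F * t -> redp l phi %| redp l h * t -> redp l phi %| t) ->
  maximal_at l.
Proof.
move=> pl fE fN rad cop g gA.
have l0 : (l%:R : algC) != 0 by rewrite pnatr_eq0 -lt0n prime_gt0.
have f0 : redp l f != 0.
  by rewrite monic_neq0 // monic_map.
have fb : redp l f = redp l phi * redp l h.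
  by rewrite fE rmorphD /= redp_l // addr0 rmorphM.
have phi0 : redp l phi != 0 by apply: contraNneq f0 => p0; rewrite fb p0 mul0r.
have phif : redp l phi %| redp l f by rewrite fb dvdp_mulr.
have nilp x : ev x / l%:R \in Aint -> redp l phi %| redp l x.
  move=> /(integral_nilpotent pl) [n /(dvdp_trans phif)]; exact: rad.
(* It suffices to cancel one factor [phi]: starting from [phi^N g], which [f] divides modulo [l],
   the powers are removed one by one. *)
suff main x : ev x / l%:R \in Aint -> redp l f %| redp l phi * redp l x -> redp l f %| redp l x.
  have : redp l f %| redp l (phi ^+ N * g) by rewrite rmorphM rmorphXn /= dvdp_mulr.
  elim: N {fN} => [|N IH]; first by rewrite expr0 mul1r.
  rewrite exprS -mulrA rmorphM /= => /main H; apply: IH; apply: H.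
  by rewrite evM -mulrA rpredM // ev_Aint.
move=> xA; rewrite -rmorphM => /(redp_dvd pl) [q [c cE]].
have ec : ev phi * (ev x / l%:R) = ev c.
  by rewrite mulrA -evM cE evD ev_f add0r evM evC; field.
have [q1 [e eE]] : exists q1 e, phi ^+ N = f * q1 + l%:Z%:P * e.
  by apply: redp_dvd; rewrite // rmorphXn.
(* Raised to the power [N], [c] becomes [phi^N (x/l)^N = l e (x/l)^N] at [theta], so [c^N / l] is
   integral and the radical property applies. *)
have phic : redp l phi %| redp l c.
  apply: (rad _ N); rewrite -rmorphXn; apply: nilp.
  rewrite evX -ec exprMn -evX eE evD ev_f add0r evM evC.
  have -> : l%:Z%:~R * ev e * (ev x / l%:R) ^+ N / l%:R = ev e * (ev x / l%:R) ^+ N.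
    by field; rewrite l0.
  by rewrite rpredM ?ev_Aint // rpredX.
have [s [r crE]] := redp_dvd pl phic.
pose x' := x - l%:Z%:P * s.
have xx' : redp l x = redp l x' by rewrite /x' rmorphB /= redp_l // subr0.
have x'A : ev x' / l%:R \in Aint.
  rewrite /x' evB evM evC mulrBl.
  have -> : l%:Z%:~R * ev s / l%:R = ev s by field.
  by rewrite rpredB ?ev_Aint.
(* After the correction by [l s], [phi x'] is divisible by [l^2] up to a multiple of [f]. Comparing
   with [f = phi h + l F] gives first [x' = h q2] and then [phi t1 = F q2] modulo [l]. *)
have [q2 q2E] : exists q2, phi * x' - l%:Z%:P ^+ 2 * r = f * q2.
  apply: ev_eq0; rewrite expr2 evB !evM evC /x' evB evM evC.
  have ex : ev phi * ev x = l%:R * (ev phi * ev s + l%:R * ev r).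
    have -> : ev x = l%:R * (ev x / l%:R) by field.
    by rewrite mulrCA ec crE evD !evM evC.
  by rewrite mulrBr ex; ring.
have x'q2 : redp l x' = redp l h * redp l q2.
  apply: (mulfI phi0); rewrite mulrA -fb -!rmorphM -q2E expr2 -mulrA rmorphB /=.
  by rewrite redp_l // subr0.
have [t1 t1E] : exists t1, x' - h * q2 = l%:Z%:P * t1.
  by apply: redp_eq0; rewrite // rmorphB rmorphM /= x'q2 subrr.
have lP0 : (l%:Z%:P : {poly int}) != 0 by rewrite polyC_eq0 -lt0n prime_gt0.
have Fq2 : phi * t1 = F * q2 + l%:Z%:P * r.
  apply: (mulfI lP0); rewrite mulrCA -t1E.
  have -> : phi * (x' - h * q2) = (phi * x' - l%:Z%:P ^+ 2 * r) + l%:Z%:P ^+ 2 * r - phi * h * q2 by ring.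
  by rewrite q2E fE; ring.
have phiq2 : redp l phi %| redp l q2.
  apply: cop; last by rewrite -x'q2 nilp.
  have := congr1 (redp l) Fq2; rewrite rmorphD /= redp_l // addr0 !rmorphM /= => <-.
  by rewrite dvdp_mulr.
by rewrite xx' x'q2 fb [X in X %| _]mulrC; apply: dvdp_mul.
Qed.

End Integral.

(** * Reducedness and coprimality modulo a prime *)

Definition rad_at (f : {poly int}) l :=
  forall (g : {poly 'F_l}) n, redp l f %| g ^+ n -> redp l f %| g.

(** The cofactor [e] of [gcd(p, g)] in [p] is prime to [g], because [p] has no repeated factor, yet
    it divides a power of [g]; so it is a unit. *)
Lemma coprimep_radical (K : fieldType) (p g : {poly K}) n :
  coprimep p p^`() -> p %| g ^+ n -> p %| g.
Proof.
move=> psep pgn; set d := gcdp p g.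
have dp : d %| p by rewrite dvdp_gcdl.
have /dvdpP [e pE] := dp.
have [p0|p0] := eqVneq p 0.
  by move: psep; rewrite p0 deriv0 coprimep0 -size_poly_eq1 size_poly0.
have de : coprimep d e.
  apply/coprimepP => c cd ce; have /coprimepP := psep; apply.
    by rewrite pE dvdp_mulr.
  by rewrite pE derivM; apply: dvdp_add; [apply: dvdp_mull | apply: dvdp_mulr].
have eg : coprimep e g.
  apply/coprimepP => c ce cg.
  have cd : c %| d by rewrite dvdp_gcd cg andbT pE dvdp_mulr.
  by have /coprimepP := de; apply.
have e1 : e %= 1.
  rewrite -size_poly_eq1 -coprimepp; have egn : coprimep e (g ^+ n) by rewrite coprimep_expr.
  have: e %| g ^+ n by apply: dvdp_trans pgn; rewrite [X in _ %| X]pE dvdp_mulr.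
  by move=> /coprimep_dvdl; apply.
have pd : p %= d by have := eqp_mulr d e1; rewrite mul1r -pE.
by rewrite (eqp_dvdl _ pd) dvdp_gcdr.
Qed.

(** One Bezout identity over the integers serves all primes outside [c]; every coprimality with
    explicit cofactors below is obtained this way. *)
Lemma coprimep_bezout l (p q u v : {poly int}) (c : int) : prime l ->
  u * p + v * q = c%:P -> ~~ (l %| c)%Z -> coprimep (redp l p) (redp l q).
Proof.
move=> pl E lc; apply/Bezout_coprimepP; exists (redp l u, redp l v) => /=.
rewrite -!rmorphM -rmorphD E /= map_polyC /=.
by rewrite -[X in X%:P]mulr1 polyCM mul_polyC eqp_scale // intr_Fp_eq0.
Qed.

Lemma separable_rad (f : {poly int}) l : coprimep (redp l f) (redp l f^`()) -> rad_at f l.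
Proof. by move=> H g n; apply: coprimep_radical; rewrite deriv_map. Qed.

Section Maximal.
Variables (f : {poly int}) (theta : algC).
Hypotheses (f_monic : f \is monic).
Hypothesis f_irr : irreducible_poly (map_poly intr f : {poly rat}).
Hypothesis f_theta : root (polyZC f) theta.

Lemma maximal_coprime l (phi h F : {poly int}) N : prime l -> f = phi * h + l%:Z%:P * F ->
  redp l f %| redp l phi ^+ N -> coprimep (redp l phi) (redp l phi^`()) ->
  coprimep (redp l phi) (redp l F) -> maximal_at f theta l.
Proof.
move=> pl fE fN sp cF; apply: (dedekind f_monic f_irr f_theta pl fE fN).
  by move=> g n; apply: coprimep_radical; rewrite deriv_map.
by move=> t; rewrite Gauss_dvdpr.
Qed.

Lemma maximal_separable l : prime l -> coprimep (redp l f) (redp l f^`()) -> maximal_at f theta l.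
Proof.
move=> pl sf; apply: (@dedekind _ _ f_monic f_irr f_theta l f 1 0 1%N pl).
- by rewrite mulr1 mulr0 addr0.
- by rewrite expr1.
- by move=> g n; apply: coprimep_radical; rewrite deriv_map.
by move=> t _; rewrite rmorph1 mul1r.
Qed.

End Maximal.

Lemma monogenic_of_maximal f : f \is monic ->
  irreducible_poly (map_poly intr f : {poly rat}) ->
  (forall theta, root (polyZC f) theta -> forall l, prime l -> maximal_at f theta l) -> monogenic f.
Proof.
move=> fm fi Hmax; split=> // theta ft alpha aQ aA.
exact: (Z_theta_integral fm ft (Hmax theta ft) aQ aA).
Qed.

Lemma Qadj_ev theta g : Qadj theta ((map_poly intr g : {poly algC}).[theta]).
Proof.
exists (map_poly intr g); rewrite /polyQC -map_poly_comp; congr _.[_].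
by apply: eq_map_poly => z /=; rewrite ratr_int.
Qed.

(** Coordinates in the power basis are unique, so those of [g(theta) / n] must be integers. *)
Lemma monogenic_dvd_coef f theta (n : nat) (g : {poly int}) : monogenic f -> root (polyZC f) theta ->
  (0 < n)%N -> (size g < size f)%N -> (map_poly intr g : {poly algC}).[theta] / n%:R \in Aint ->
  forall i, (n %| g`_i)%Z.
Proof.
move=> [fm fi Hf] ft n0 sg gA i.
have nC : (n%:R : algC) != 0 by rewrite pnatr_eq0 -lt0n.
have sf : (0 < size f)%N by rewrite size_poly_gt0 monic_neq0.
have [|q [sq qE]] := Hf theta ft _ _ gA.
  have [p pE] := Qadj_ev theta g; exists (n%:R^-1 *: p).
  by rewrite /polyQC map_polyZ hornerZ fmorphV /= ratr_nat mulrC pE.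
have gq : n%:Z%:P * q - g = 0.
  apply: (ev_lt fi ft).
    rewrite (leq_ltn_trans (size_polyD _ _)) // size_polyN gtn_max sg andbT.
    rewrite mul_polyC (leq_ltn_trans (size_scale_leq _ _)) //.
    by rewrite -[X in (_ < X)%N](prednK sf) ltnS.
  rewrite rmorphB rmorphM /= map_polyC /= !hornerE.
  by rewrite -[(map_poly _ q).[_]]qE; field.
have -> : g = n%:Z%:P * q by apply/eqP; rewrite eq_sym -subr_eq0 gq.
by rewrite coefCM dvdz_mulr.
Qed.

Lemma monic_ndvd (g : {poly int}) n : g \is monic -> (1 < n)%N -> ~ (forall i, (n %| g`_i)%Z).
Proof.
move=> gm n1 /(_ (size g).-1); rewrite -lead_coefE (monicP gm).
by rewrite dvdzE absz1 dvdn1 absz_nat => /eqP n1'; rewrite n1' in n1.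
Qed.

(** * Irreducibility and isomorphisms *)

(** A rational factor with one root has, by transitivity, all eight. Irreducibility of the families
    is thus a consequence of their Galois group. *)
Lemma irreducible_of_transitive f (H : {set 'S_8}) : f \is monic -> size f = 9%N ->
  (forall i j : 'I_8, exists2 s : 'S_8, s \in H & s i = j) -> galois_group_is f H ->
  irreducible_poly (map_poly intr f : {poly rat}).
Proof.
move=> fm sf Htr [e [einj er eH]].
have fQ : size (map_poly intr f : {poly rat}) = 9%N.
  by rewrite size_map_inj_poly //; apply: intr_inj.
split=> [|q q1 qf]; first by rewrite fQ.
have f0 : (map_poly intr f : {poly rat}) != 0 by rewrite -size_poly_eq0 fQ.
have q0 : q != 0 by apply: contraTneq qf => ->; rewrite dvd0p.
have QZ : map_poly ratr (map_poly intr f : {poly rat}) = polyZC f.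
  by rewrite -map_poly_comp; apply: eq_map_poly => z /=; rewrite ratr_int.
have qC : (map_poly ratr q : {poly algC}) %| polyZC f by rewrite -QZ dvdp_map.
have [t qt] : exists t, root (map_poly ratr q : {poly algC}) t.
  by apply/closed_rootP; rewrite size_map_poly.
have fC0 : polyZC f != 0 by rewrite -QZ map_poly_eq0.
have sfC : size (polyZC f) = 9%N by rewrite -QZ size_map_poly.
have [i Di] : exists i, t = e i.
  have [/mapP [i _ ->]|nt] := boolP (t \in map e (enum 'I_8)); first by exists i.
  have A : all (root (polyZC f)) (t :: map e (enum 'I_8)).
    have /dvdpP [c cE] := qC; rewrite /= {1}cE rootM qt orbT.
    by apply/allP => _ /mapP [i _ ->].
  have := max_poly_roots fC0 A.
  by rewrite /= nt map_inj_uniq ?enum_uniq // sfC size_map size_enum_ord => /(_ isT).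
have qe j : root (map_poly ratr q : {poly algC}) (e j).
  have [s sH si] := Htr i j; have [u Hu] := (eH s).2 sH; rewrite -si -Hu -Di.
  have <- : map_poly u (map_poly ratr q) = map_poly ratr q.
    by rewrite -map_poly_comp; apply: eq_map_poly => c /=; rewrite fmorph_rat.
  by rewrite fmorph_root.
rewrite -dvdp_size_eqp // fQ eqn_leq -{1}fQ dvdp_leq //=.
have qC0 : (map_poly ratr q : {poly algC}) != 0 by rewrite map_poly_eq0.
have A : all (root (map_poly ratr q : {poly algC})) (map e (enum 'I_8)).
  by apply/allP => _ /mapP [j _ ->].
have := max_poly_roots qC0 A.
by rewrite map_inj_uniq ?enum_uniq // size_map size_enum_ord size_map_poly => ->.
Qed.

Definition transitive_check X : bool :=
  let T := gen_perms (map prL (cycles8 X)) in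
  all (fun i => all (fun j => has (fun t => nth 0%N t i == j) T) (iota 0 8)) (iota 0 8)
  && all (all cyc_ok) (cycles8 X).

Lemma T8_transitive X : X \in [:: 9; 15; 17; 18; 26]%N ->
  forall i j : 'I_8, exists2 s : 'S_8, s \in T8 X & s i = j.
Proof.
move=> HX; have HX' : X \in [:: 2; 3; 4; 6; 8; 9; 10; 11; 15; 16; 17; 18; 22; 26]%N.
  by move: HX; rewrite !inE; do ![case/orP; [by move=> -> //; rewrite !orbT|]]; move=> ->; rewrite !orbT.
have : transitive_check X.
  by move: HX {HX'}; rewrite !inE; do ![case/orP; [by move=> /eqP ->; vm_compute|]]; move=> /eqP ->; vm_compute.
rewrite /transitive_check; set T := gen_perms _ => /andP [/allP H okc] i j.
have i8 : val i \in iota 0 8 by rewrite mem_iota ltn_ord.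
have j8 : val j \in iota 0 8 by rewrite mem_iota ltn_ord.
have /allP/(_ _ j8)/hasP [t tT /eqP tij] := H _ i8.
rewrite (T8_cycles HX').
have [s sT st] : exists2 s, s \in gen_grp (map pr (cycles8 X)) & ptab s = t.
  move: t tT {tij}; apply: gen_permsP.
    by exists 1%g; rewrite ?group1 // ptab1.
  move=> g x /mapP [l lc ->] [t tl <-]; exists (t * pr l)%g; last first.
    by rewrite ptabM ptab_pr //; move/allP: okc; apply.
  by rewrite groupM // mem_gen // inE map_f.
by exists s => //; apply: val_inj; rewrite /= -nth_ptab st.
Qed.

(* Being symmetric in the two fields, a graph is handier here than a function. *)
Definition field_graph t1 t2 (E : algC -> algC -> Prop) : Prop :=
  [/\ forall x, Qadj t1 x -> exists y, E x y, forall y, Qadj t2 y -> exists x, E x y,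
      (forall x y, E x y -> Qadj t1 x /\ Qadj t2 y) /\ E 1 1,
      (forall x y z, E x y -> E x z -> y = z) /\ (forall x y z, E x z -> E y z -> x = y)
    & forall x y x' y', E x y -> E x' y' -> E (x + x') (y + y') /\ E (x * x') (y * y')].

Lemma Qadj1 t : Qadj t 1.
Proof. by exists 1; rewrite /polyQC rmorph1 hornerC. Qed.
Lemma QadjD t x y : Qadj t x -> Qadj t y -> Qadj t (x + y).
Proof. by move=> [p ->] [q ->]; exists (p + q); rewrite /polyQC rmorphD hornerD. Qed.
Lemma QadjM t x y : Qadj t x -> Qadj t y -> Qadj t (x * y).
Proof. by move=> [p ->] [q ->]; exists (p * q); rewrite /polyQC rmorphM hornerM. Qed.

Lemma fields_iso_graph t1 t2 : fields_iso t1 t2 -> exists E, field_graph t1 t2 E.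
Proof.
move=> [phi [h1 h2 h3 [h4 h5] h6]].
exists (fun x y => Qadj t1 x /\ y = phi x); split.
- by move=> x Qx; exists (phi x).
- by move=> y /h2 [x Qx <-]; exists x.
- split; first by move=> x y [Qx ->]; split=> //; apply: h1.
  by split; [apply: Qadj1 | rewrite h4].
- split; first by move=> x y z [_ ->] [_ ->].
  by move=> x y z [Qx ->] [Qy]; apply: h3.
move=> x y x' y' [Qx ->] [Qx' ->]; split; split.
- exact: QadjD.
- by rewrite h5.
- exact: QadjM.
by rewrite h6.
Qed.

Lemma field_graph_sym t1 t2 E : field_graph t1 t2 E -> field_graph t2 t1 (fun x y => E y x).
Proof.
move=> [h1 h2 [h3 h4] [h5 h6] h7]; split=> //.
- by split=> // x y /h3 [].
- by split=> x y z; [apply: h6 | apply: h5].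
by move=> x y x' y'; apply: h7.
Qed.

Section Graph.
Variables (t1 t2 : algC) (E : algC -> algC -> Prop).
Hypothesis GE : field_graph t1 t2 E.

Lemma graphD x y x' y' : E x y -> E x' y' -> E (x + x') (y + y').
Proof. by case: GE => _ _ _ _ h A B; case: (h _ _ _ _ A B). Qed.

Lemma graphM x y x' y' : E x y -> E x' y' -> E (x * x') (y * y').
Proof. by case: GE => _ _ _ _ h A B; case: (h _ _ _ _ A B). Qed.

Lemma graph0 : E 0 0.
Proof.
case: GE => h1 h2 [h3 h4] [h5 h6] h7.
have [y Ey] : exists y, E 0 y by apply: h1; exists 0; rewrite /polyQC rmorph0 horner0.
have := graphD Ey Ey; rewrite addr0 => /(h5 _ _ _ Ey) /eqP.
by rewrite -subr_eq subrr eq_sym => /eqP y0; rewrite -{2}y0.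
Qed.

Lemma graphX x y n : E x y -> E (x ^+ n) (y ^+ n).
Proof.
move=> xy; elim: n => [|n IH]; first by rewrite !expr0; case: GE => _ _ [].
by rewrite !exprS; apply: graphM.
Qed.

Lemma graph_nat n : E n%:R n%:R.
Proof.
elim: n => [|n IH]; first exact: graph0.
by rewrite -addn1 natrD; apply: graphD => //; case: GE => _ _ [].
Qed.

Lemma graph_int (m : int) : E m%:~R m%:~R.
Proof.
case: m => n; first exact: graph_nat.
case: GE => h1 h2 [h3 h4] [h5 h6] h7.
have [y Ey] : exists y, E (Negz n)%:~R y.
  by apply: h1; exists (Negz n)%:~R%:P; rewrite /polyQC map_polyC hornerC /= ratr_int.
have Z : (Negz n)%:~R + n.+1%:R = 0 :> algC by rewrite NegzE rmorphN addNr.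
have := graphD Ey (graph_nat n.+1); rewrite Z => /(h5 _ _ _ graph0) /eqP.
rewrite eq_sym addr_eq0 => /eqP yE; move: Ey; rewrite yE.
by have -> : (Negz n)%:~R = - n.+1%:R :> algC by rewrite NegzE rmorphN.
Qed.

Lemma graph_horner (g : {poly int}) x y : E x y -> 
  E (map_poly intr g : {poly algC}).[x] (map_poly intr g : {poly algC}).[y].
Proof.
move=> xy; elim/poly_ind: g => [|g c IH]; first by rewrite rmorph0 !horner0; apply: graph0.
rewrite rmorphD rmorphM /= map_polyX map_polyC /= !hornerE; apply: graphD; last exact: graph_int.
exact: graphM.
Qed.

Lemma graph_Aint x y : E x y -> x \in Aint -> y \in Aint.
Proof.
move=> xy xA; have /floorpP [m Dm] : minCpoly x \is a polyOver Num.int by have := xA; rewrite unfold_in.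
have := graph_horner m xy; rewrite -Dm (rootP (root_minCpoly x)) => E0.
case: GE => _ _ _ [h5 _] _; have := h5 _ _ _ graph0 E0 => /esym Ey.
apply: (@root_monic_Aint (minCpoly x)).
- exact/rootP.
- exact: minCpoly_monic.
by have := xA; rewrite unfold_in.
Qed.

End Graph.

(** An isomorphism would identify the rings of integers modulo [l]. On the second side this ring is
    reduced; on the first [g(t1)] is nilpotent, but nonzero because [g] is monic of degree less than
    that of [f1]. *)
Lemma graph_not_iso t1 t2 E (f1 f2 : {poly int}) l (g : {poly int}) N :
  field_graph t1 t2 E -> monogenic f1 -> monogenic f2 ->
  root (polyZC f1) t1 -> root (polyZC f2) t2 -> prime l ->
  g \is monic -> (size g < size f1)%N -> redp l f1 %| redp l g ^+ N -> rad_at f2 l -> False.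
Proof.
move=> GE m1 m2 r1 r2 pl gm sg gN rad2.
have l0 : (l%:R : algC) != 0 by rewrite pnatr_eq0 -lt0n prime_gt0.
have [f1m f1i _] := m1; have [f2m f2i H2] := m2.
case: (GE) => h1 h2 [h3 h4] [h5 h6] h7.
pose x := (map_poly intr g : {poly algC}).[t1].
have [y xy] := h1 x (Qadj_ev t1 g).
have yA : y \in Aint by apply: (graph_Aint GE xy); apply: ev_Aint r1 _.
have [q [_ yE]] := H2 t2 r2 y (h3 _ _ xy).2 yA.
have [c [h gE]] : exists c h, g ^+ N = f1 * c + l%:Z%:P * h by apply: redp_dvd; rewrite // rmorphXn.
pose z1 := (map_poly intr h : {poly algC}).[t1].
have xN : x ^+ N = l%:R * z1.
  rewrite /x -horner_exp -rmorphXn gE rmorphD hornerD (ev_f r1) add0r.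
  by rewrite rmorphM hornerM /= map_polyC hornerC.
have [z zE] := h1 z1 (Qadj_ev t1 h).
have yN : y ^+ N = l%:R * z.
  by apply: (h5 (x ^+ N)); [apply: (graphX GE) | rewrite xN; apply: (graphM GE) => //; apply: (graph_nat GE)].
have zA : z \in Aint by apply: (graph_Aint GE zE); apply: ev_Aint r1 _.
have : (map_poly intr (q ^+ N) : {poly algC}).[t2] / l%:R \in Aint.
  rewrite rmorphXn horner_exp -[(map_poly _ q).[_]]yE yN.
  by have -> : l%:R * z / l%:R = z by field.
move=> /(integral_nilpotent f2m f2i r2 pl) [n]; rewrite rmorphXn /= => /rad2 /rad2.
move=> /(redp_dvd pl) [c2 [h' qE]].
have yl : y = l%:R * (map_poly intr h' : {poly algC}).[t2].
  rewrite yE qE /polyZC.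
  by rewrite rmorphD /= hornerD (ev_f r2) add0r rmorphM hornerM /= map_polyC hornerC.
have [w wE] := h2 _ (Qadj_ev t2 h').
have wA : w \in Aint.
  by apply: (graph_Aint (field_graph_sym GE) wE); apply: ev_Aint f2m r2 _.
have xl : x = l%:R * w.
  by apply: (h6 _ _ y) => //; rewrite yl; apply: (graphM GE) => //; apply: (graph_nat GE).
apply: (monic_ndvd gm (prime_gt1 pl)); apply: (monogenic_dvd_coef m1 r1 (prime_gt0 pl) sg).
by rewrite -/x xl; have -> : l%:R * w / l%:R = w by field.
Qed.

Lemma not_iso t1 t2 (f1 f2 : {poly int}) l (g : {poly int}) N : monogenic f1 -> monogenic f2 ->
  root (polyZC f1) t1 -> root (polyZC f2) t2 -> prime l ->
  g \is monic -> (size g < size f1)%N -> redp l f1 %| redp l g ^+ N -> rad_at f2 l ->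
  ~ fields_iso t1 t2 /\ ~ fields_iso t2 t1.
Proof.
move=> m1 m2 r1 r2 pl gm sg gN rad2; split=> /fields_iso_graph [E GE].
  exact: (graph_not_iso GE m1 m2 r1 r2 pl gm sg gN rad2).
exact: (graph_not_iso (field_graph_sym GE) m1 m2 r1 r2 pl gm sg gN rad2).
Qed.

(* [Mf k] bounds the primes at which the k-th polynomial is not squarefree; each new member is
   chosen beyond the product of the bounds of its predecessors. *)
Lemma infinite_family_of (adm : int -> int -> Prop) (P : int -> int -> {poly int}) (H : {set 'S_8})
    (good : pred nat) (par : nat -> int * int) (Mf : nat -> nat) :
  (forall M, exists k, (M < k)%N && good k) ->
  (forall k, good k -> [/\ adm (par k).1 (par k).2, monogenic (P (par k).1 (par k).2) &
     galois_group_is (P (par k).1 (par k).2) H]) ->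
  (forall k, good k -> (0 < Mf k)%N) ->
  (forall k l, good k -> prime l -> ~~ (l %| Mf k)%N -> rad_at (P (par k).1 (par k).2) l) ->
  (forall M k, good k -> (0 < M < k)%N -> exists l g N, [/\ prime l, ~~ (l %| M)%N, g \is monic,
     (size g < size (P (par k).1 (par k).2))%N & redp l (P (par k).1 (par k).2) %| redp l g ^+ N]) ->
  infinite_family adm P H.
Proof.
move=> Hex Hgood Mf0 Hrad Hbad.
pose next M := ex_minn (Hex M).
have nextP M : (M < next M)%N && good (next M) by rewrite /next; case: ex_minnP.
pose st := fix st n := if n is n'.+1 then (st n' * Mf (next (st n')))%N else 1%N.
have st0 n : (0 < st n)%N.
  by elim: n => //= n IH; rewrite muln_gt0 IH Mf0 //; case/andP: (nextP (st n)).
pose k n := next (st n).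
have gk n : good (k n) by case/andP: (nextP (st n)).
have dvd n m : (n < m)%N -> (Mf (k n) %| st m)%N.
  elim: m => // m IH; rewrite ltnS leq_eqVlt => /orP [/eqP -> /=|/IH nm /=]; first exact: dvdn_mull.
  exact: dvdn_mulr.
exists (fun n => par (k n)); split; first by move=> n; apply: Hgood.
have main n m : (n < m)%N -> forall t1 t2,
    root (polyZC (P (par (k m)).1 (par (k m)).2)) t1 -> root (polyZC (P (par (k n)).1 (par (k n)).2)) t2 ->
    ~ fields_iso t1 t2 /\ ~ fields_iso t2 t1.
  move=> nm t1 t2 r1 r2; have [_ m1 _] := Hgood _ (gk m); have [_ m2 _] := Hgood _ (gk n).
  have [|l [g [N [pl lM gm sg gN]]]] := Hbad (st m) (k m) (gk m).
    by rewrite st0; case/andP: (nextP (st m)).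
  apply: (not_iso m1 m2 r1 r2 pl gm sg gN); apply: Hrad => //.
  by apply: contra lM => /dvdn_trans; apply; apply: dvd.
move=> n m /eqP; rewrite neq_ltn => /orP [] nm t1 t2 r1 r2.
  by case: (main _ _ nm t2 t1 r2 r1).
by case: (main _ _ nm t1 t2 r1 r2).
Qed.

(** * Squarefree values of polynomials *)

Local Close Scope ring_scope.

Definition sqfree (n : nat) : bool := (0 < n) && all (fun p => ~~ (p ^ 2 %| n)) (primes n).

Lemma sqfreeP n : 0 < n -> reflect (forall p, prime p -> ~~ (p ^ 2 %| n)) (sqfree n).
Proof.
move=> n0; rewrite /sqfree n0; apply: (iffP allP) => H p; last by rewrite mem_primes => /and3P [/H].
move=> pp; apply/negP => pn; have /H/negP : p \in primes n.
  by rewrite mem_primes pp n0 (dvdn_trans _ pn) // dvdn_exp.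
by apply.
Qed.

Lemma sqfree_ndvd n p : sqfree n -> prime p -> ~~ (p ^ 2 %| n).
Proof. by move=> sn; have /andP [n0 _] := sn; move/(sqfreeP n0): sn; apply. Qed.

(** If all the primes of [n] divided [M], the squarefree [n] would divide the smaller number [M]. *)
Lemma sqfree_prime_factor n M : sqfree n -> 0 < M < n ->
  exists p (u : int), [/\ prime p, (n%:Z = p%:Z * u)%R & ~~ (p %| M)].
Proof.
move=> sn /andP [M0 Mn]; have /andP [n0 _] := sn.
have [/allP H|/allPn [p]] := boolP (all (fun p => p %| M) (primes n)); last first.
  by rewrite mem_primes => /and3P [pp _ /dvdnP [u ->]] pM; exists p, u; rewrite PoszM mulrC.
suff nM : n %| M by have := dvdn_leq M0 nM; rewrite leqNgt Mn.
apply/dvdn_partP => // p; rewrite mem_primes => /and3P [pp _ pn].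
have l1 : logn p n = 1.
  apply/eqP; rewrite eqn_leq logn_gt0 mem_primes pp n0 pn andbT.
  by rewrite andbT leqNgt -(pfactor_dvdn 2 pp n0); apply: sqfree_ndvd.
by rewrite p_part l1 expn1 H // mem_primes pp n0.
Qed.

Lemma count_residues (s L : seq nat) q N : 0 < q -> uniq s ->
  (forall k, k \in s -> k < N /\ k %% q \in L) -> size s <= size L * (N %/ q).+1.
Proof.
move=> q0 us Hs; pose g k := (k %% q, k %/ q).
have inj : injective g by move=> j k [h1 h2]; rewrite (divn_eq j q) (divn_eq k q) h1 h2.
rewrite -(size_map g) -(size_iota 0 (N %/ q).+1) -(size_allpairs pair).
apply: uniq_leq_size; first by rewrite map_inj_uniq.
move=> _ /mapP [k ks ->]; have [kN kL] := Hs k ks.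
apply/allpairsP; exists (g k); split; [exact: kL | | by []].
by rewrite mem_iota add0n ltnS leq_div2r // ltnW.
Qed.

(** The telescoping sum of [1 / (j (j + 1))], equal to [J / (J + 1)], with denominators cleared. *)
Lemma sum_div_squares c (q : nat -> nat) N J : (forall j, c * (j * j.+1) <= q j ^ 2) -> 
  (c * J.+1) * (\sum_(1 <= j < J.+1) N %/ q j ^ 2) <= N * J.
Proof.
move=> Hq; elim: J => [|J IH]; first by rewrite big_geq ?muln0.
rewrite big_nat_recr //=; set t := N %/ _; set S := \sum_(_ <= _ < _) _ in IH *.
have Ht : c * (J.+1 * J.+2) * t <= N.
  by apply: leq_trans (leq_trunc_div N (q J.+1 ^ 2)); rewrite mulnC leq_mul2l Hq orbT.
rewrite -(leq_pmul2r (ltn0Sn J)).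
have -> : c * J.+2 * (S + t) * J.+1 = J.+2 * (c * J.+1 * S) + c * (J.+1 * J.+2) * t by ring.
have -> : N * J.+1 * J.+1 = J.+2 * (N * J) + N by ring.
by rewrite leq_add // leq_mul2l IH orbT.
Qed.

(** With [rho] residue classes excluded modulo each [q j ^ 2], the bad numbers have density at most
    [rho / c], up to an error of [rho] per modulus. *)
Lemma sieve c rho (q : nat -> nat) (bad : nat -> nat -> bool) N J : 0 < c ->
  (forall j, c * (j * j.+1) <= q j ^ 2) ->
  (forall j, count (bad j) (iota 0 N) <= rho * (N %/ q j ^ 2).+1) ->
  c * count (fun k => has (fun j => bad j k) (index_iota 1 J.+1)) (iota 0 N) <= rho * N + rho * c * J.
Proof.
move=> c0 Hq Hbad.
have Hc : count (fun k => has (fun j => bad j k) (index_iota 1 J.+1)) (iota 0 N)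
   <= \sum_(1 <= j < J.+1) count (bad j) (iota 0 N).
  elim: (index_iota 1 J.+1) => [|j s IH]; first by rewrite big_nil /= count_pred0.
  rewrite big_cons /=; apply: leq_trans (leq_add (leqnn _) IH).
  by rewrite -count_predUI leq_addr.
pose S := \sum_(1 <= j < J.+1) N %/ q j ^ 2.
have Hs : \sum_(1 <= j < J.+1) count (bad j) (iota 0 N) <= rho * S + rho * J.
  have -> : rho * J = \sum_(1 <= j < J.+1) rho by rewrite sum_nat_const_nat subn1 mulnC.
  rewrite /S big_distrr -big_split /=; apply: leq_sum => j _.
  by rewrite -mulnSr.
have := sum_div_squares N J Hq; rewrite -/S => HS.
rewrite -(leq_pmul2l (ltn0Sn J)).
apply: (@leq_trans (J.+1 * (c * (rho * S + rho * J)))).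
  by do 2!apply: leq_mul => //; apply: leq_trans Hc Hs.
have -> : J.+1 * (c * (rho * S + rho * J)) = rho * (c * J.+1 * S) + J.+1 * (rho * c * J) by ring.
rewrite mulnDr leq_add // [J.+1 * (rho * N)]mulnCA leq_mul2l; apply/orP; right.
by apply: leq_trans HS _; rewrite mulnC leq_mul2r leqnSn orbT.
Qed.

Lemma count_bad_exists (P : pred nat) N M : count P (iota 0 N) + M.+1 < N ->
  exists k, (M < k < N) && ~~ P k.
Proof.
move=> H; have [/hasP [k] | /hasPn Hn] := boolP (has (fun k => (M < k) && ~~ P k) (iota 0 N)).
  by rewrite mem_iota => /andP [_ kN] /andP [Mk Pk]; exists k; rewrite Mk Pk kN.
have : count [predU P & [pred k | k <= M]] (iota 0 N) = N.
  rewrite -[RHS](size_iota 0); apply/eqP; rewrite -all_count; apply/allP => k /Hn /=.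
  by rewrite negb_and negbK -leqNgt orbC.
have := count_predUI P [pred k | k <= M] (iota 0 N).
have : count [pred k | k <= M] (iota 0 N) <= M.+1.
  have MN : M.+1 <= N by apply: leq_trans (ltnW H); rewrite leq_addl.
  rewrite -{1}(subnKC MN) iotaD count_cat add0n.
  have -> : count [pred k | k <= M] (iota M.+1 (N - M.+1)) = 0.
    by apply/eqP; rewrite -leqn0 leqNgt -has_count -all_predC; apply/allP => k; rewrite mem_iota /=; lia.
  by rewrite addn0 -{2}(size_iota 0 M.+1) count_size.
move=> h1 h2 h3; have : N <= count P (iota 0 N) + M.+1.
  rewrite h3 in h2; have := leq_addr (count (predI P [pred k | k <= M]) (iota 0 N)) N.
  by move=> h4; apply: (leq_trans h4); rewrite h2 leq_add2l.
by rewrite leqNgt H.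
Qed.

Lemma odd_prime_gt2 p : prime p -> odd p -> exists j, p = 2 * j + 1 /\ 0 < j.
Proof.
move=> pp op; exists p./2; have := odd_double_half p; have := prime_gt1 pp; rewrite op; lia.
Qed.

Definition lin (AB : nat * nat) k := AB.1 * k + AB.2.

(** A prime dividing the slope would also divide the intercept; so the slope is invertible and a
    single residue class modulo [p ^ 2] is excluded. *)
Lemma count_linear AB p N : prime p -> coprime AB.1 AB.2 ->
  count (fun k => p ^ 2 %| lin AB k) (iota 0 N) <= (N %/ p ^ 2).+1.
Proof.
case: AB => A B /= pp cAB; rewrite -size_filter; set s := filter _ _.
have q0 : 0 < p ^ 2 by rewrite expn_gt0 prime_gt0.
have us : uniq s by rewrite filter_uniq // iota_uniq.
have [->|[k0 k0s]] : s = [::] \/ exists k0, k0 \in s.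
  by case: (s) => [|k0 s']; [left | right; exists k0; rewrite inE eqxx].
  by [].
rewrite -[X in _ <= X]mul1n -[1]/(size [:: k0 %% p ^ 2]); apply: count_residues => // k ks.
move: k0s ks; rewrite !mem_filter !mem_iota !add0n /lin /= => /andP [d0 _] /andP [d1 kN].
split=> //; rewrite inE; have cp : coprime (p ^ 2) A.
  rewrite coprimeXl // prime_coprime //; apply/negP => pA.
  have : p %| B.
    have : p %| A * k + B by apply: dvdn_trans d1; rewrite dvdn_exp.
    by rewrite dvdn_addr // dvdn_mulr.
  by move: cAB => /eqP cAB pB; have := dvdn_gcd p A B; rewrite cAB pA pB dvdn1 => /eqP p1; rewrite p1 in pp.
have key m n : m <= n -> p ^ 2 %| A * m + B -> p ^ 2 %| A * n + B -> n == m %[mod p ^ 2].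
  by move=> mn dm dn; rewrite eqn_mod_dvd // -(Gauss_dvdr _ cp) mulnBr -(subnDr B) dvdn_sub.
have [le|/ltnW le] := leqP k0 k; first exact: key.
by rewrite eq_sym; apply: key.
Qed.

(** All values are odd, so only odd moduli [2 j + 1] matter and [c = 4]. Three forms then cost a
    density of at most 3/4, which leaves room. *)
Lemma linear_sieve (fs : seq (nat * nat)) : size fs <= 3 ->
  all (fun AB => [&& ~~ odd AB.1, odd AB.2, coprime AB.1 AB.2, AB.1 <= 240 & AB.2 <= 240]) fs ->
  forall M, exists k, (M < k) && all (fun AB => sqfree (lin AB k)) fs.
Proof.
move=> sfs /allP Hfs M.
(* The values stay below [(16 t)^2], so moduli up to [2 J + 1] suffice. The sieve gives at most
   [3 t^2 / 4 + 24 t] bad numbers, and [t (t - 96) / 4] exceeds [M + 1]. *)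
pose t := 100 + 4 * M.+1; pose N := t ^ 2; pose J := 8 * t.
pose q j := 2 * j + 1.
pose bad j k := prime (q j) && has (fun AB => q j ^ 2 %| lin AB k) fs.
have Hq j : 4 * (j * j.+1) <= q j ^ 2 by rewrite /q; nia.
have Hbad j : count (bad j) (iota 0 N) <= 3 * (N %/ q j ^ 2).+1.
  rewrite /bad; have [pq|pq] := boolP (prime (q j)); last by rewrite count_pred0.
  rewrite /=; apply: (@leq_trans (size fs * (N %/ q j ^ 2).+1)); last by rewrite leq_mul2r sfs orbT.
  elim: fs Hfs {sfs bad} => [|AB fs IH] Hfs; first by rewrite /= count_pred0.
  rewrite /=; apply: (@leq_trans (count (fun k => q j ^ 2 %| lin AB k) (iota 0 N) +
     count (fun k => has (fun AB => q j ^ 2 %| lin AB k) fs) (iota 0 N))).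
    by rewrite -count_predUI leq_addr.
  rewrite [(size fs).+1 * _]mulSn; apply: leq_add; last by apply: IH => x xfs; apply: Hfs; rewrite inE xfs orbT.
  by apply: count_linear => //; case/and5P: (Hfs AB (mem_head _ _)).
have := @sieve 4 3 q bad N J isT Hq Hbad; set cnt := count _ _ => Hcnt.
have [|k /andP [/andP [Mk kN] Hk]] := @count_bad_exists _ N M (_ : cnt + M.+1 < N).
  by move: Hcnt; rewrite /N /J /t; nia.
exists k; rewrite Mk; apply/allP => AB ABfs; have /and5P [oA oB _ A240 B240] := Hfs AB ABfs.
have oL : odd (lin AB k) by rewrite /lin oddD oddM (negPf oA) oB.
have L0 : 0 < lin AB k by case: (lin AB k) oL.
apply/sqfreeP => // p pp; apply: contra Hk => pL.
have op : odd p by apply: dvdn_odd oL; apply: dvdn_trans pL; rewrite dvdn_exp.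
have [j [pj j0]] := odd_prime_gt2 pp op.
have pqj : p = q j by [].
apply/hasP; exists j; last by rewrite /bad -pqj pp /=; apply/hasP; exists AB.
rewrite mem_index_iota j0 ltnS /=.
have := dvdn_leq L0 pL; rewrite /lin pj; move: kN A240 B240; rewrite /N /J.
case: AB {ABfs oA oB oL L0 pL} => A B /= kN A240 B240 H.
have AkN : A * k <= 240 * k by rewrite leq_mul2r A240 orbT.
rewrite leqNgt; apply/negP => jt.
have : (16 * t) ^ 2 < (2 * j + 1) ^ 2 by rewrite ltn_sqr; lia.
have tt : 10000 <= t ^ 2 by rewrite /t; nia.
rewrite expnMn; move: H kN tt; set T := t ^ 2; set U := (2 * j + 1) ^ 2; lia.
Qed.

(** For [p] congruent to 3 modulo 4, a square root [y] of -1 would satisfy both [y^p = y] and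
    [y^p = y^3 = - y]. *)
Lemma prime_sqr1 p x : prime p -> odd p -> p %| x ^ 2 + 1 -> p %% 4 = 1.
Proof.
move=> pp op px; have : p %% 4 = 1 \/ p %% 4 = 3 by lia.
case=> // p3; exfalso; have pE := divn_eq p 4; rewrite p3 in pE.
Local Open Scope ring_scope.
pose y : 'F_p := x%:R.
have y2 : y ^+ 2 = -1.
  apply/eqP; rewrite -addr_eq0 -natrX -[1]/(1%:R) -natrD.
  by rewrite -(dvdn_pcharf (pchar_Fp pp)).
have yp : y ^+ p = y by have := expf_card y; rewrite card_Fp.
have : y ^+ p = - y.
  transitivity (y ^+ (4 * (p %/ 4) + 3)); first by congr (_ ^+ _); rewrite mulnC.
  rewrite exprD exprM.
  have -> : y ^+ 4 = 1 by rewrite (exprM _ 2 2) y2 sqrrN expr1n.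
  by rewrite expr1n mul1r exprSr y2 mulN1r.
rewrite yp => /eqP; rewrite -addr_eq0 -mulr2n -mulr_natl mulf_eq0 => /orP [|/eqP y0].
  rewrite -(dvdn_pcharf (pchar_Fp pp)) => p2.
  have := dvdn_leq (isT : (0 < 2)%N) p2; have := prime_gt1 pp => p1 p2'.
  have p2E : p = 2%N by lia.
  by move: op; rewrite p2E.
move: y2; rewrite y0 expr0n /= => /eqP; rewrite eq_sym oppr_eq0 oner_eq0 //.
Local Close Scope ring_scope.
Qed.

(** Half of [(2 k + 1)^2 + 1]. *)
Definition quad k := 2 * k ^ 2 + 2 * k + 1.

(** For quadratic values the number of moduli is proportional to [N], so the error term is not
    negligible. The count closes because the prime divisors are all of the form [4 j + 1], which
    makes the moduli sparser and allows [c = 12]. *)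
Lemma quad_sieve M : exists k, (M < k) && sqfree (quad k).
Proof.
(* The sieve yields [12 cnt <= 2 N + 24 J = 176 (M + 1)], hence [cnt + M + 1 < N]; a prime beyond
   [q J] has a square above [576 (M + 1)^2], while the values are at most [512 (M + 1)^2]. *)
pose N := 16 * M.+1; pose J := 6 * M.+1; pose q j := 4 * j + 1.
pose bad j k := prime (q j) && (q j ^ 2 %| quad k).
have Hq j : 12 * (j * j.+1) <= q j ^ 2 by rewrite /q; nia.
have Hbad j : count (bad j) (iota 0 N) <= 2 * (N %/ q j ^ 2).+1.
  have [pp|/negPf pq] := boolP (prime (q j)); last first.
    by rewrite (@eq_count _ _ pred0) ?count_pred0 // => k; rewrite /bad pq.
  rewrite (@eq_count _ _ (fun k => q j ^ 2 %| quad k)); last by move=> k; rewrite /bad pp.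
  move: (q j) pp => p pp; rewrite -size_filter; set s := filter _ _.
  have q0 : 0 < p ^ 2 by rewrite expn_gt0 prime_gt0.
  have us : uniq s by rewrite filter_uniq // iota_uniq.
  have [->|[k0 k0s]] : s = [::] \/ exists k0, k0 \in s.
    by case: (s) => [|k0 s']; [left | right; exists k0; rewrite inE eqxx].
    by [].
  (* The two residue classes are those of [k0] and [- k0 - 1]; the multiple of [p ^ 2] keeps the
     subtraction from being truncated. *)
  rewrite -[2]/(size [:: k0 %% p ^ 2; (p ^ 2 * k0.+1 - k0.+1) %% p ^ 2]).
  apply: count_residues => // k ks.
  move: k0s ks; rewrite !mem_filter !mem_iota !add0n /= => /andP [d0 _] /andP [d1 kN].
  split=> //; rewrite !inE.
  have key m n : m <= n -> p ^ 2 %| quad m -> p ^ 2 %| quad n ->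
      (n == m %[mod p ^ 2]) || (p ^ 2 %| n + m + 1).
    move=> mn dm dn; have op : odd p.
      apply: (@dvdn_odd _ (quad m)); first by apply: dvdn_trans dm; rewrite dvdn_exp.
      by rewrite /quad -mulnDr oddD oddM.
    have E : quad n - quad m = 2 * ((n - m) * (n + m + 1)).
      rewrite -{1 3}(subnKC mn); set t := n - m.
      have -> : quad (m + t) = quad m + 2 * (t * (m + t + m + 1)) by rewrite /quad; ring.
      by rewrite addKn.
    have : p ^ 2 %| 2 * ((n - m) * (n + m + 1)) by rewrite -E dvdn_sub.
    rewrite Gauss_dvdr; last by rewrite coprimeXl // coprimen2.
    have [pn|pn] := boolP (p %| n - m); last first.
      rewrite Gauss_dvdr; last by rewrite coprimeXl // prime_coprime.
      by move=> ->; rewrite orbT.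
    have [pnm|pnm] := boolP (p %| n + m + 1); last first.
      rewrite Gauss_dvdl; last by rewrite coprimeXl // prime_coprime.
      by rewrite -eqn_mod_dvd // => ->.
    have p2m : p %| 2 * m + 1.
      have -> : 2 * m + 1 = (n + m + 1) - (n - m) by clear -mn; lia.
      by rewrite dvdn_sub.
    have : p %| 2 * quad m by apply: dvdn_mull; apply: dvdn_trans dm; rewrite dvdn_exp.
    have -> : 2 * quad m = (2 * m + 1) * (2 * m + 1) + 1 by rewrite /quad; ring.
    rewrite (dvdn_addr _ (dvdn_mulr (2 * m + 1) p2m)) dvdn1 => /eqP p1; by rewrite p1 in pp.
  have {key} : (k == k0 %[mod p ^ 2]) || (p ^ 2 %| k + k0 + 1).
    have [le|/ltnW le] := leqP k0 k; first exact: key.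
    by rewrite eq_sym (addnC k); apply: key.
  case/orP=> [->//|kk]; apply/orP; right.
  have le : k0.+1 <= p ^ 2 * k0.+1 by rewrite leq_pmull.
  rewrite -(eqn_modDr k0.+1) subnK // mulnC modnMl; apply/eqP/esym/eqP.
  by rewrite eq_sym addnS -addn1.
have := @sieve 12 2 q bad N J isT Hq Hbad; set cnt := count _ _ => Hcnt.
have [|k /andP [/andP [Mk kN] Hk]] := @count_bad_exists _ N M (_ : cnt + M.+1 < N).
  by move: Hcnt; rewrite /N /J; lia.
exists k; rewrite Mk; have Q0 : 0 < quad k by rewrite /quad addn1.
apply/sqfreeP => // p pp; apply: contra Hk => pQ.
have pQ1 : p %| quad k by apply: dvdn_trans pQ; rewrite dvdn_exp.
have op : odd p by apply: dvdn_odd pQ1 _; rewrite /quad -mulnDr oddD oddM.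
have p1 : p %% 4 = 1.
  apply: (@prime_sqr1 p (2 * k + 1)) => //.
  have -> : (2 * k + 1) ^ 2 + 1 = 2 * quad k by rewrite /quad; ring.
  by rewrite dvdn_mull.
have pj : p = q (p %/ 4) by rewrite /q; lia.
apply/hasP; exists (p %/ 4); last by rewrite /bad -pj pp pQ.
rewrite mem_index_iota; have := prime_gt1 pp => pg1; apply/andP; split; first by lia.
have := dvdn_leq Q0 pQ; rewrite ltnS leqNgt => H; apply/negP => Jp.
have : (24 * M.+1) ^ 2 < p ^ 2 by rewrite ltn_sqr; rewrite /J in Jp; lia.
have qk : quad k <= 2 * k.+1 ^ 2 by rewrite /quad -(addn1 k) sqrnD; lia.
have kN2 : k.+1 ^ 2 <= 256 * M.+1 ^ 2 by have := kN; rewrite -leq_sqr /N (expnMn 16).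
rewrite expnMn; have : 0 < M.+1 ^ 2 by rewrite expn_gt0.
by move: (M.+1 ^ 2) kN2 => T kN2; lia.
Qed.

Local Open Scope ring_scope.

(** * The families of polynomials [polyF a b] *)

Lemma monic_size_Xn n (g : {poly int}) : (size g <= n)%N ->
  'X^n + g \is monic /\ size ('X^n + g) = n.+1.
Proof.
move=> sg; have sX : (size g < size ('X^n : {poly int})%R)%N by rewrite size_polyXn.
by split; [rewrite monicE lead_coefDl // lead_coefXn | rewrite size_polyDl // size_polyXn].
Qed.

Lemma size_CXn (c : int) n m : (n < m)%N -> (size (c%:P * 'X^n)%R <= m)%N.
Proof.
by move=> nm; rewrite mul_polyC (leq_trans (size_scale_leq _ _)) // size_polyXn.
Qed.

Lemma monic_size_polyF a b : polyF a b \is monic /\ size (polyF a b) = 9%N.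
Proof.
rewrite /polyF -addrA; apply: monic_size_Xn.
rewrite (leq_trans (size_polyD _ _)) // geq_max size_CXn //.
by rewrite (leq_trans (size_polyC_leq1 _)).
Qed.

Lemma Euclid_dvdz (l : nat) (m n : int) : prime l -> (l %| m * n)%Z = (l %| m)%Z || (l %| n)%Z.
Proof. by move=> pl; rewrite !dvdzE abszM Euclid_dvdM. Qed.

Lemma separable_polyF l (a b : int) : prime l -> ~~ (l %| 2 * b * (a ^+ 2 - 4 * b))%Z ->
  coprimep (redp l (polyF a b)) (redp l (polyF a b)^`()).
Proof.
move=> pl; rewrite !Euclid_dvdz // !negb_or => /andP [/andP [l2 lb] ld].
pose A : {poly int} := a%:P; pose B : {poly int} := b%:P; pose f : {poly int} := polyF a b.
(* With [y = X^4], the identity is built from [y (y + a) = f - b] and [(2 y + a)^2 = 4 f + d]. *)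
apply: (@coprimep_bezout l _ _ (16 * f + 4 * (A ^+ 2 - 4 * B) - 16 * B)
   (- ('X * ('X^4 + A) * (2 * 'X^4 + A))) (2 * 2 * b * (a ^+ 2 - 4 * b))) => //.
  rewrite /f /polyF !derivE /= -/A -/B.
  ring.
by rewrite !Euclid_dvdz // !negb_or l2 lb ld.
Qed.

Section MaximalF.
Variables (a b : int) (theta : algC).
Hypothesis f_irr : irreducible_poly (map_poly intr (polyF a b) : {poly rat}).
Hypothesis f_theta : root (polyZC (polyF a b)) theta.

Let fm := (monic_size_polyF a b).1.

Lemma maximalF_separable l : prime l -> ~~ (l %| 2 * b * (a ^+ 2 - 4 * b))%Z ->
  maximal_at (polyF a b) theta l.
Proof. by move=> pl H; apply: maximal_separable => //; apply: separable_polyF. Qed.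

Lemma maximalF_eisenstein l (a' b' : int) : prime l -> a = l%:Z * a' -> b = l%:Z * b' ->
  ~~ (l %| b')%Z -> maximal_at (polyF a b) theta l.
Proof.
move=> pl Da Db lb'.
have fE : polyF a b = 'X * 'X^7 + l%:Z%:P * (a'%:P * 'X^4 + b'%:P) by rewrite /polyF Da Db; ring.
apply: (@maximal_coprime _ _ fm f_irr f_theta l _ _ _ 8 pl fE).
- by rewrite fE rmorphD /= redp_l // addr0 -exprS rmorphXn.
- by apply: (@coprimep_bezout l _ _ 0 1 1) => //; rewrite ?derivX ?mul0r ?add0r ?mul1r // dvdzE /= dvdn1; move: pl; case: l {fE Da Db lb'} => [|[]].
apply: (@coprimep_bezout l _ _ (- a'%:P * 'X^3) 1 b') => //; ring.
Qed.

(** Modulo [l] the polynomial is [X^4 (X^4 + a)], with radical [X (X^4 + a)]. *)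
Lemma maximalF_dvd_b l (b' : int) : prime l -> b = l%:Z * b' -> ~~ (l %| b')%Z ->
  ~~ (l %| 2 * a)%Z -> maximal_at (polyF a b) theta l.
Proof.
move=> pl Db lb'; rewrite Euclid_dvdz // negb_or => /andP [l2 la].
have fE : polyF a b = ('X * ('X^4 + a%:P)) * 'X^3 + l%:Z%:P * b'%:P by rewrite /polyF Db; ring.
have fr : redp l (polyF a b) = redp l ('X * ('X^4 + a%:P) * 'X^3).
  by rewrite fE rmorphD /= redp_l // addr0.
apply: (@maximal_coprime _ _ fm f_irr f_theta l _ _ _ 4 pl fE).
- rewrite fr -rmorphXn; apply/dvdpP; exists (redp l (('X^4 + a%:P) ^+ 3)); rewrite -rmorphM /=.
  by congr (map_poly _ _); ring.
- apply: (@coprimep_bezout l _ _ (25 * 'X^3) (- (5 * 'X^4 + 4 * a%:P)) (- (2 * 2 * a * a))) => //.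
    rewrite !derivE /=; ring.
  by rewrite -mulNr !Euclid_dvdz // !negb_or dvdzE abszN -dvdzE !Euclid_dvdz // !negb_or l2 la.
by apply: (@coprimep_bezout l _ _ 0 1 b') => //; ring.
Qed.

Lemma maximalF_dvd_d l (m t : int) : prime l -> a = 2 * m -> b = m ^+ 2 + l%:Z * t -> ~~ (l %| t)%Z ->
  ~~ (l %| 2 * m)%Z -> maximal_at (polyF a b) theta l.
Proof.
move=> pl Da Db lt; rewrite Euclid_dvdz // negb_or => /andP [l2 lm].
have fE : polyF a b = ('X^4 + m%:P) * ('X^4 + m%:P) + l%:Z%:P * t%:P by rewrite /polyF Da Db; ring.
apply: (@maximal_coprime _ _ fm f_irr f_theta l _ _ _ 2 pl fE).
- by rewrite fE rmorphD /= redp_l // addr0 rmorphM.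
- apply: (@coprimep_bezout l _ _ 4 (- 'X) (2 * 2 * m)) => //; first by rewrite !derivE /=; ring.
  by rewrite !Euclid_dvdz // !negb_or l2 lm.
by apply: (@coprimep_bezout l _ _ 0 1 t) => //; ring.
Qed.

(* modulo 2 the polynomial is a power of 'X - 1 *)
Lemma maximalF_two (a' : int) : a = 4 * a' -> b = 1 -> maximal_at (polyF a b) theta 2.
Proof.
move=> Da Db; pose F : {poly int} := (2 * a'%:P) * 'X^4 - (- 4 * 'X^7 + 14 * 'X^6 - 28 * 'X^5 + 35 * 'X^4
  - 28 * 'X^3 + 14 * 'X^2 - 4 * 'X).
have fE : polyF a b = ('X - 1%:P) * ('X - 1%:P) ^+ 7 + 2%:Z%:P * F.
  by rewrite /polyF Da Db /F; ring.
apply: (@maximal_coprime _ _ fm f_irr f_theta 2 _ _ _ 8 isT fE).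
- by rewrite fE rmorphD /= redp_l // addr0 -exprS rmorphXn.
- by apply: (@coprimep_bezout 2 _ _ 0 1 1) => //; rewrite derivXsubC; ring.
rewrite rmorphB /= map_polyX map_polyC /= coprimep_sym coprimep_XsubC.
have -> : (1%:~R : 'F_2) = (1 : int)%:~R by [].
rewrite /root horner_map /= intr_Fp_eq0 //.
by rewrite /F !(hornerD, hornerN, hornerM, hornerX, hornerC) ; lia.
Qed.
End MaximalF.

Lemma dvdz_comb (l : nat) (u v x y z : int) : (l %| x)%Z -> (l %| y)%Z -> z = u * x + v * y -> (l %| z)%Z.
Proof. by move=> lx ly ->; rewrite rpredD // dvdz_mull. Qed.

Lemma four_int : 4%:R = 2%:R * 2%:R :> int. Proof. by []. Qed.

Lemma prime_ndvd1 (l : nat) : prime l -> ~~ (l %| 1)%Z.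
Proof. by move=> pl; rewrite dvdzE /= dvdn1; apply/eqP => l1; rewrite l1 in pl. Qed.

Lemma prime_dvd2 (l : nat) : prime l -> (l %| 2)%Z = (l == 2%N).
Proof. by move=> pl; rewrite dvdzE /= dvdn_prime2. Qed.

Lemma nonsquare_neg (N : int) : N < 0 -> nonsquare N.
Proof. by move=> N0 k; nia. Qed.

Lemma nonsquare_prime (l : nat) (u N : int) : prime l -> N = l%:Z * u -> ~~ (l %| u)%Z -> nonsquare N.
Proof.
move=> pl -> lu k kE; have lk : (l %| k)%Z.
  have : (l %| k ^+ 2)%Z by rewrite -kE dvdz_mulr.
  by rewrite expr2 Euclid_dvdz // orbb.
have [c kc] := dvdzP lk; have l0 : l%:Z != 0 by rewrite -lt0n prime_gt0.
move/negP: lu; apply; apply/dvdzP; exists (c ^+ 2); apply: (mulfI l0); rewrite kE kc; ring.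
Qed.

Lemma sqfree_split (l A : nat) : prime l -> sqfree A -> (l %| A%:Z)%Z ->
  exists2 u : int, A%:Z = l%:Z * u & ~~ (l %| u)%Z.
Proof.
move=> pl sA /dvdzP [u uE]; exists u; first by rewrite mulrC.
apply: contra (sqfree_ndvd sA pl) => /dvdzP [v vE].
have : ((l ^ 2)%N %| A%:Z)%Z by apply/dvdzP; exists v; rewrite uE vE -mulrA -expr2; lia.
by rewrite dvdzE.
Qed.

Lemma sqfree_prime A : (1 < A)%N -> sqfree A -> exists2 l, prime l & (l %| A%:Z)%Z.
Proof. by move=> A1 sA; exists (pdiv A); [apply: pdiv_prime | rewrite dvdzE /= pdiv_dvd]. Qed.

Lemma redp_dvd_of l (f g c F : {poly int}) N : prime l -> g ^+ N = f * c + l%:Z%:P * F ->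
  redp l f %| redp l g ^+ N.
Proof. by move=> pl E; rewrite -rmorphXn /= E rmorphD /= redp_l // addr0 rmorphM dvdp_mulr. Qed.

(** What a family must supply: nonzero discriminant, Galois group, maximality at 2 and at the odd
    primes of [b] and [d], and a nilpotent element at a prime avoiding any given smaller [M]. *)
Lemma polyF_family X (good : pred nat) (par : nat -> int * int) :
  X \in [:: 9; 15; 17; 18; 26]%N ->
  (forall M, exists k, (M < k)%N && good k) ->
  (forall k, good k -> let: (a, b) := par k in
     [/\ 2 * b * (a ^+ 2 - 4 * b) != 0, galois_group_is (polyF a b) (T8 X) &
       (irreducible_poly (map_poly intr (polyF a b) : {poly rat}) ->
        forall theta, root (polyZC (polyF a b)) theta -> maximal_at (polyF a b) theta 2 /\
        forall l, prime l -> ~~ (l %| 2)%Z -> (l %| b)%Z || (l %| a ^+ 2 - 4 * b)%Z ->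
        maximal_at (polyF a b) theta l)]) ->
  (forall M k, good k -> (0 < M < k)%N -> let: (a, b) := par k in
     exists l g c F N, [/\ prime l, ~~ (l %| M)%N, g \is monic, (size g < 9)%N &
       g ^+ N = polyF a b * c + l%:Z%:P * F]) ->
  infinite_family admF polyF (T8 X).
Proof.
move=> HX Hex Hgood Hbad.
apply: (@infinite_family_of _ _ _ good par (fun k => absz (2 * (par k).2 * ((par k).1 ^+ 2 - 4 * (par k).2)))) => //.
- move=> k gk; have := Hgood k gk; case: (par k) => a b /= [n0 G Hmax].
  have [fm fs] := monic_size_polyF a b.
  have fi := irreducible_of_transitive fm fs (T8_transitive HX) G.
  split=> //; apply: monogenic_of_maximal => // theta ft l pl.
  have [H2 Hodd] := Hmax fi theta ft.
  have [d|nd] := boolP (l %| 2 * b * (a ^+ 2 - 4 * b))%Z; last exact: maximalF_separable.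
  have [l2|l2] := boolP (l %| 2)%Z; first by move: l2; rewrite prime_dvd2 // => /eqP ->.
  by move: d; rewrite !Euclid_dvdz // (negPf l2); apply: Hodd.
- by move=> k gk; have := Hgood k gk; case: (par k) => a b /= [n0 _ _]; rewrite absz_gt0.
- move=> k l gk pl lM; apply: separable_rad; apply: separable_polyF => //.
move=> M k gk Mk; have := Hbad M k gk Mk; case: (par k) => a b /= [l [g [c [F [N [pl lM gm sg E]]]]]].
exists l, g, N; split=> //; first by rewrite (monic_size_polyF a b).2.
exact: redp_dvd_of E.
Qed.

(** For [X^8 + 2 k] with [k] an odd prime, the discriminant involves only 2 and [k], and the
    polynomial is Eisenstein at both. *)
Lemma infinite_F15 : infinite_family admF polyF (T8 15).
Proof.
apply: (@polyF_family 15 (fun k => prime k && odd k) (fun k => (0, 2 * k%:Z))) => //.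
- move=> M; have [p Mp pp] := prime_above (maxn M 2); exists p.
  move: Mp; rewrite gtn_max => /andP [-> p2]; rewrite pp /=.
  by case: (even_prime pp) => // p2E; rewrite p2E in p2.
- move=> k /andP [pk ok]; have k0 : (0 < k)%N by apply: prime_gt0.
  have k2 : ~~ (2 %| k%:Z)%Z by rewrite dvdzE /= dvdn2 ok.
  have n2k : ~~ (k %| 2)%Z by rewrite prime_dvd2 //; apply: contraTneq ok => ->.
  split.
  + by rewrite expr0n /= sub0r; clear -k0; lia.
  + apply: galoisF15; first by clear -k0; lia.
    * exact: (nonsquare_prime (l := 2) (u := k%:Z)).
    * by apply: nonsquare_neg; clear -k0; lia.
    * by apply: (nonsquare_prime (l := k) (u := 4)) => //; [clear -k0; lia | rewrite (Euclid_dvdz 2 2 pk) orbb].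
    by apply: nonsquare_neg; clear -k0; lia.
  move=> fi theta ft; split.
    by apply: (maximalF_eisenstein fi ft (a' := 0) (b' := k%:Z)) => //; clear -k0; lia.
  move=> l pl l2; rewrite expr0n /= sub0r rpredN !Euclid_dvdz // (negPf l2) /=.
  rewrite four_int Euclid_dvdz // (negPf l2) /= orbb => lk.
  have -> : l = k by apply/eqP; rewrite -dvdn_prime2 //; move: lk; rewrite dvdzE.
  by apply: (maximalF_eisenstein fi ft (a' := 0) (b' := 2)) => //; clear -k0; lia.
move=> M k /andP [pk ok] /andP [M0 Mk].
exists k, 'X^4, 1, (- 2), 2%N; split=> //.
- by apply/negP => /(dvdn_leq M0); rewrite leqNgt Mk.
- exact: monicXn.
- by rewrite size_polyXn.
by rewrite /polyF; ring.
Qed.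

(** Taking [a] divisible by 4 secures the prime 2, and [a^2 - 4 = 4 (2 k + 1) (2 k + 3)] splits into
    coprime linear factors for the sieve. *)
Lemma infinite_F9 : infinite_family admF polyF (T8 9).
Proof.
apply: (@polyF_family 9 (fun k => [&& (0 < k)%N, sqfree (2 * k + 1) & sqfree (2 * k + 3)])
  (fun k => (4 * k%:Z + 4, 1))) => //.
- move=> M; have [|k /andP [Mk /and3P [h1 h2 _]]] := @linear_sieve [:: (2, 1); (2, 3)]%N isT _ M.
    by [].
  by exists k; rewrite Mk (leq_ltn_trans _ Mk) //= h1 h2.
- move=> k /and3P [k0 s1 s3]; pose A := (2 * k + 1)%N; pose B := (2 * k + 3)%N.
  have dE : (4 * k%:Z + 4) ^+ 2 - 4 = 4 * (A%:Z * B%:Z) by rewrite /A /B; clear -k0; lia.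
  have disj (l : nat) : prime l -> ~~ (l %| 2)%Z -> (l %| A%:Z)%Z -> (l %| B%:Z)%Z -> False.
    move=> pl l2 lA lB; move/negP: l2; apply; apply: (dvdz_comb (u := -1) (v := 1) lA lB); rewrite /A /B; clear -k0; lia.
  split.
  + by rewrite !mulr1 dE /A /B; clear -k0; lia.
  + have [p pp pA] := @sqfree_prime A (ltac:(by rewrite /A; clear -k0; lia)) s1.
    have [u uE pu] := sqfree_split pp s1 pA.
    have p2 : ~~ (p %| 2)%Z.
      rewrite prime_dvd2 //; apply/eqP => p2; move: pA; rewrite p2 dvdzE /= dvdn2 /A oddD oddM //.
    apply: galoisF9; first by rewrite dE /A /B; clear -k0; lia.
    split.
    * by apply: nonsquare_neg; clear -k0; lia.
    * apply: (nonsquare_prime (l := 2) (u := 2 * k%:Z + 1)) => //; first by clear -k0; lia.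
      by apply/negP => /dvdzP [q]; clear -k0; lia.
    * by apply: nonsquare_neg; clear -k0; lia.
    * apply: (nonsquare_prime (l := 2) (u := 2 * k%:Z + 3)) => //; first by clear -k0; lia.
      by apply/negP => /dvdzP [q]; clear -k0; lia.
    split; last by apply: nonsquare_neg; rewrite -opprB dE /A /B; clear -k0; lia.
    apply: (nonsquare_prime (l := p) (u := 4 * (u * B%:Z))) => //; first by rewrite dE uE; ring.
    rewrite four_int !Euclid_dvdz // (negPf p2) (negPf pu) /=.
    by apply/negP => /(disj p pp p2 pA).
  move=> fi theta ft; split.
    by apply: (maximalF_two fi ft (a' := k%:Z + 1)) => //; clear -k0; lia.
  move=> l pl l2; rewrite (negPf (prime_ndvd1 pl)) mulr1 dE four_int !Euclid_dvdz // (negPf l2) /=.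
  have main (t : int) : A%:Z * B%:Z = l%:Z * t -> ~~ (l %| t)%Z -> maximal_at (polyF (4 * k%:Z + 4) 1) theta l.
    move=> tE lt; apply: (maximalF_dvd_d fi ft (m := 2 * k%:Z + 2) (t := - t)) => //.
    - by clear -k0; lia.
    - by rewrite mulrN -tE /A /B; clear -k0; lia.
    - by rewrite rpredN.
    rewrite Euclid_dvdz // (negPf l2) /=; apply/negP => lm; move/negP: (prime_ndvd1 pl); apply.
    apply: (@dvdz_comb l (2 * k%:Z + 2) (- t) (2 * k%:Z + 2) l%:Z) => //.
    by rewrite mulNr [t * _]mulrC -tE /A /B; clear -k0; lia.
  case/orP => ld.
    have [u uE lu] := sqfree_split pl s1 ld; apply: (main (u * B%:Z)); first by rewrite uE mulrA.
    by rewrite Euclid_dvdz // (negPf lu) /=; apply/negP => /(disj l pl l2 ld).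
  have [u uE lu] := sqfree_split pl s3 ld; apply: (main (u * A%:Z)); first by rewrite mulrC uE mulrA.
  by rewrite Euclid_dvdz // (negPf lu) /=; apply/negP => lA; apply: (disj l pl l2 lA ld).
move=> M k /and3P [k0 s1 s3] /andP [M0 Mk].
have [|p [u [pp uE pM]]] := @sqfree_prime_factor (2 * k + 1) M s1; first by rewrite M0; clear -Mk; lia.
exists p, ('X^4 + (2 * k%:Z + 2)%:P), 1, (u * (2 * k%:Z + 3))%:P, 2%N; split=> //.
- by rewrite monicE lead_coefDl ?lead_coefXn // size_polyXn (leq_ltn_trans (size_polyC_leq1 _)).
- by rewrite size_polyDl size_polyXn // (leq_ltn_trans (size_polyC_leq1 _)).
have -> : p%:Z%:P * (u * (2 * k%:Z + 3))%:P = ((2 * k%:Z + 1) * (2 * k%:Z + 3))%:P.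
  by rewrite -polyCM mulrA -uE; congr _%:P; clear -k0; lia.
by rewrite /polyF; ring.
Qed.

Lemma odd_factor_ndvd2 p A : prime p -> odd A -> (p %| A%:Z)%Z -> ~~ (p %| 2)%Z.
Proof.
move=> pp oA pA; rewrite prime_dvd2 //; apply/eqP => p2.
by move: pA; rewrite p2 dvdzE /= dvdn2 oA.
Qed.

(** Here [b = 2 (2 k + 3)] and [d = - 8 (2 k + 1)]: Eisenstein at 2, with coprime odd parts.
    Negativity of [d] disposes of several nonsquare conditions. *)
Lemma infinite_F26 : infinite_family admF polyF (T8 26).
Proof.
apply: (@polyF_family 26 (fun k => [&& (0 < k)%N, sqfree (2 * k + 1) & sqfree (2 * k + 3)])
  (fun k => (4, 4 * k%:Z + 6))) => //.
- move=> M; have [|k /andP [Mk /and3P [h1 h2 _]]] := @linear_sieve [:: (2, 1); (2, 3)]%N isT _ M.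
    by [].
  by exists k; rewrite Mk (leq_ltn_trans _ Mk) //= h1 h2.
- move=> k /and3P [k0 s1 s3]; pose A := (2 * k + 1)%N; pose B := (2 * k + 3)%N.
  have oA : odd A by rewrite /A oddD oddM.
  have oB : odd B by rewrite /B oddD oddM.
  have bE : 4 * k%:Z + 6 = 2 * B%:Z by rewrite /B; clear -k0; lia.
  have dE : 4 ^+ 2 - 4 * (4 * k%:Z + 6) = - (2 * 2 * 2 * A%:Z) by rewrite /A; clear -k0; lia.
  have disj (l : nat) : prime l -> (l %| A%:Z)%Z -> (l %| B%:Z)%Z -> False.
    move=> pl lA lB; move/negP: (odd_factor_ndvd2 pl oA lA); apply.
    by apply: (dvdz_comb (u := -1) (v := 1) lA lB); rewrite /A /B; clear -k0; lia.
  split.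
  + by rewrite dE bE /A /B; clear -k0; lia.
  + have [p pp pA] := @sqfree_prime A (ltac:(by rewrite /A; clear -k0; lia)) s1.
    have [u uE pu] := sqfree_split pp s1 pA; have p2 := odd_factor_ndvd2 pp oA pA.
    have pB : ~~ (p %| B%:Z)%Z by apply/negP => /(disj p pp pA).
    have bns : nonsquare (4 * k%:Z + 6).
      apply: (nonsquare_prime (l := 2) (u := B%:Z)) => //.
      by apply/negP => /dvdzP [q]; rewrite /B; clear -k0; lia.
    apply: galoisF26; rewrite ?dE; [by clear -k0; lia | by rewrite /A; clear -k0; lia | split=> //].
    * by apply: nonsquare_neg; rewrite /A; clear -k0; lia.
    * apply: (nonsquare_prime (l := p) (u := 2 * 2 * 2 * u)) => //; first by rewrite uE; ring.
      by rewrite !Euclid_dvdz // (negPf p2) (negPf pu).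
    * by apply: nonsquare_neg; clear -k0; lia.
    split; first by apply: nonsquare_neg; rewrite /A; clear -k0; nia.
    apply: (nonsquare_prime (l := p) (u := 2 * 2 * 2 * 2 * u * B%:Z)) => //; first by rewrite bE uE; ring.
    by rewrite !Euclid_dvdz // (negPf p2) (negPf pu) (negPf pB).
  move=> fi theta ft; split.
    apply: (maximalF_eisenstein fi ft (a' := 2) (b' := B%:Z)) => //.
    by apply/negP => /dvdzP [q]; rewrite /B; clear -k0; lia.
  move=> l pl l2 H; have {H} : (l %| B%:Z)%Z || (l %| A%:Z)%Z.
    by move: H; rewrite dE bE rpredN !Euclid_dvdz // (negPf l2).
  case/orP => ld.
    have [u uE lu] := sqfree_split pl s3 ld.
    apply: (maximalF_dvd_b fi ft (b' := 2 * u)) => //; first by rewrite bE uE; ring.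
      by rewrite Euclid_dvdz // (negPf lu) (negPf l2).
    by rewrite four_int !Euclid_dvdz // (negPf l2).
  have [u uE lu] := sqfree_split pl s1 ld.
  apply: (maximalF_dvd_d fi ft (m := 2) (t := 2 * u)) => //.
  + by rewrite mulrCA -uE /A; clear -k0; lia.
  + by rewrite Euclid_dvdz // (negPf lu) (negPf l2).
  by rewrite Euclid_dvdz // (negPf l2).
move=> M k /and3P [k0 s1 s3] /andP [M0 Mk].
have [|p [u [pp uE pM]]] := @sqfree_prime_factor (2 * k + 1) M s1; first by rewrite M0; clear -Mk; lia.
exists p, ('X^4 + 2%:P), 1, (- (2 * u))%:P, 2%N; split=> //.
- by rewrite monicE lead_coefDl ?lead_coefXn // size_polyXn (leq_ltn_trans (size_polyC_leq1 _)).
- by rewrite size_polyDl size_polyXn // (leq_ltn_trans (size_polyC_leq1 _)).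
have -> : p%:Z%:P * (- (2 * u))%:P = (- (2 * (2 * k%:Z + 1)))%:P.
  by rewrite -polyCM mulrN mulrCA -uE; congr _%:P; clear -k0; lia.
by rewrite /polyF; ring.
Qed.

(** The parameters solve [a^2 - 4 b = - 4], that is [b = (a/2)^2 + 1] with [a/2] odd. As [d] is
    constant, the primes distinguishing the fields must divide [b], whence the quadratic sieve. *)
Lemma infinite_F17 : infinite_family admF polyF (T8 17).
Proof.
apply: (@polyF_family 17 (fun k => (0 < k)%N && sqfree (quad k))
  (fun k => (2 * (2 * k%:Z + 1), 2 * (quad k)%:Z))) => //.
- move=> M; have [k /andP [Mk sk]] := quad_sieve M.
  by exists k; rewrite Mk (leq_ltn_trans _ Mk) //= sk.
- move=> k /andP [k0 sk]; set A := quad k in sk *.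
  have AE : A%:Z = 2 * k%:Z ^+ 2 + 2 * k%:Z + 1 by rewrite /A /quad -mulnn; clear -k0; lia.
  have oA : odd A by rewrite /A /quad -mulnDr oddD oddM.
  have A2 : ~~ (2 %| A%:Z)%Z by rewrite dvdzE /= dvdn2 oA.
  have dE : (2 * (2 * k%:Z + 1)) ^+ 2 - 4 * (2 * A%:Z) = - 2 ^+ 2 by rewrite AE; ring.
  split.
  + by rewrite dE AE; clear -k0; nia.
  + apply: (galoisF17 (k := 2)) => //.
    * by rewrite AE; clear -k0; nia.
    * exact: (nonsquare_prime (l := 2) (u := A%:Z)).
    by apply: nonsquare_neg; rewrite AE; clear -k0; nia.
  move=> fi theta ft; split; first exact: (maximalF_eisenstein fi ft (a' := 2 * k%:Z + 1) (b' := A%:Z)).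
  move=> l pl l2; rewrite dE rpredN expr2 !Euclid_dvdz // (negPf l2) /= orbF => ld.
  have [u uE lu] := sqfree_split pl sk ld.
  apply: (maximalF_dvd_b fi ft (b' := 2 * u)) => //; first by rewrite uE; ring.
    by rewrite Euclid_dvdz // (negPf lu) (negPf l2).
  rewrite !Euclid_dvdz // (negPf l2) /=; apply/negP => lm; move/negP: (prime_ndvd1 pl); apply.
  by apply: (dvdz_comb (u := - (2 * k%:Z + 1)) (v := 2) lm ld); rewrite AE; ring.
move=> M k /andP [k0 sk] /andP [M0 Mk].
have [|p [u [pp uE pM]]] := @sqfree_prime_factor (quad k) M sk.
  by rewrite M0 (leq_trans Mk) // /quad -mulnn; clear -k0; lia.
pose m : int := 2 * (2 * k%:Z + 1).
(* Modulo [p] the polynomial is [X^4 (X^4 + m)], and the nilpotent element is [X^2 (X^4 + m)]. *)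
exists p, ('X^6 + m%:P * 'X^2), ('X^4 + m%:P), ((- (2 * u))%:P * ('X^4 + m%:P)), 2%N; split=> //.
- by rewrite monicE lead_coefDl ?lead_coefXn // size_polyXn (leq_ltn_trans (size_CXn _ (leqnn 3))).
- by rewrite size_polyDl size_polyXn // (leq_ltn_trans (size_CXn _ (leqnn 3))).
have -> : p%:Z%:P * ((- (2 * u))%:P * ('X^4 + m%:P)) = (- (2 * (quad k)%:Z))%:P * ('X^4 + m%:P).
  by rewrite mulrA -polyCM mulrN mulrCA -uE.
by rewrite /polyF -/m; ring.
Qed.

(** * The families of polynomials [polyG a b] *)

Lemma monic_size_polyG a b : polyG a b \is monic /\ size (polyG a b) = 9%N.
Proof.
rewrite /polyG -!addrA; apply: monic_size_Xn.
do 3![rewrite (leq_trans (size_polyD _ _)) // geq_max size_CXn //=].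
by rewrite size_poly1.
Qed.

(** From [X f' = 4 f + 2 (X^2 - 1) (X^2 + 1) W] with [W = 2 X^4 + a X^2 + 2]: modulo the three
    factors [f] is controlled by [Q], by [P], and by [D] through [W^2 = 4 f + D X^4]. *)
Lemma separable_polyG l (a b : int) : prime l ->
  ~~ (l %| 2 * (b + 2 - 2 * a) * (b + 2 + 2 * a) * (a ^+ 2 - 4 * b + 8))%Z ->
  coprimep (redp l (polyG a b)) (redp l (polyG a b)^`()).
Proof.
move=> pl; rewrite !Euclid_dvdz // !negb_or => /andP [/andP [/andP [l2 lP] lQ] lD].
pose A : {poly int} := a%:P; pose B : {poly int} := b%:P; pose f : {poly int} := polyG a b.
pose E : {poly int} := 2 * 'X^2 + A; pose W : {poly int} := 2 * 'X^4 + A * 'X^2 + 2.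
pose Q := B + 2 + 2 * A; pose P := B + 2 - 2 * A; pose D := A ^+ 2 - 4 * B + 8.
have c0 : coprimep (redp l f) (redp l 2%:P).
  by apply: (@coprimep_bezout l _ _ 0 1 2) => //; ring.
have c1 : coprimep (redp l f) (redp l ('X^2 - 1)).
  apply: (@coprimep_bezout l _ _ 1 (- (('X^2 - 1) * ('X^4 + (A + 2) * 'X^2 + 1) + Q * ('X^2 + 1)))
    (b + 2 + 2 * a)) => //; rewrite /f /polyG /Q /A /B; ring.
have c2 : coprimep (redp l f) (redp l ('X^2 + 1)).
  apply: (@coprimep_bezout l _ _ 1 (- (('X^2 + 1) * ('X^4 + (A - 2) * 'X^2 + 1) + P * ('X^2 - 1)))
    (b + 2 - 2 * a)) => //; rewrite /f /polyG /P /A /B; ring.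
have c3 : coprimep (redp l f) (redp l W).
  apply: (@coprimep_bezout l _ _ (- (4 * E ^+ 2)) (W * E ^+ 2 - D * W + 4 * D)
    (2 * 2 * (a ^+ 2 - 4 * b + 8))) => //; first by rewrite /f /polyG /W /E /D /A /B; ring.
  by rewrite !Euclid_dvdz // !negb_or l2 lD.
have fE : 'X * f^`() = 4 * f + 2%:P * ('X^2 - 1) * ('X^2 + 1) * W.
  by rewrite /f /polyG /W /A !derivE /=; ring.
rewrite -/f; clearbody f W; have : coprimep (redp l f) (redp l 'X * redp l f^`()).
  rewrite -rmorphM /= fE rmorphD /= [redp l (4 * f)]rmorphM /= coprimep_addl_mul.
  rewrite [redp l (_ * W)]rmorphM /= [redp l (_ * ('X^2 + 1))]rmorphM /= [redp l (2%:P * _)]rmorphM /=.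
  by rewrite !coprimepMr c0 c1 c2 c3.
by rewrite coprimepMr => /andP [].
Qed.

Section Quartic.
Variable l : nat.
Hypothesis pl : prime l.

Definition quartic (e : int) : {poly int} := 'X^4 + e%:P * 'X^2 + 1.

Lemma separable_quartic e : ~~ (l %| 2)%Z -> ~~ (l %| e ^+ 2 - 4)%Z ->
  coprimep (redp l (quartic e)) (redp l (quartic e)^`()).
Proof.
move=> l2 le; pose d : {poly int} := (e ^+ 2 - 4)%:P.
apply: (@coprimep_bezout l _ _ (8 * quartic e + 2 * d - 8)
  (- ('X * (2 * 'X^2 + e%:P) * ('X^2 + e%:P))) (2 * (e ^+ 2 - 4))) => //.
  by rewrite /quartic /d !derivE /=; ring.
by rewrite Euclid_dvdz // negb_or l2 le.
Qed.

Lemma coprime_quartic_x4 e t : ~~ (l %| t)%Z -> coprimep (redp l (quartic e)) (redp l (t%:P * 'X^4)).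
Proof.
move=> lt; apply: (@coprimep_bezout l _ _ (t%:P * (1 - 'X^2 * ('X^2 + e%:P))) (('X^2 + e%:P) ^+ 2) t) => //.
rewrite /quartic; ring.
Qed.

Lemma separable_mul_quartic e (s : int) : s ^+ 2 = 1 -> ~~ (l %| 2)%Z -> ~~ (l %| e ^+ 2 - 4)%Z ->
  coprimep (redp l (('X^2 + s%:P) * quartic e)) (redp l (('X^2 + s%:P) * quartic e)^`()).
Proof.
move=> s1 l2 le; have ls : ~~ (l %| s)%Z.
  by apply: contra (prime_ndvd1 pl) => /(dvdz_mulr s); rewrite -expr2 s1.
have s1P : (s%:P : {poly int}) ^+ 2 = 1 by rewrite -rmorphXn /= s1.
have l4 : ~~ (l %| 2 - s * e)%Z.
  apply: contra le => /dvdzP [q qE]; apply/dvdzP; exists (- q * (2 + s * e)).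
  by rewrite mulrAC mulNr -qE; transitivity (s ^+ 2 * e ^+ 2 - 4); [rewrite s1 mul1r | ring].
have cA : coprimep (redp l ('X^2 + s%:P)) (redp l ('X^2 + s%:P)^`()).
  apply: (@coprimep_bezout l _ _ 2 (- 'X) (2 * s)) => //; first by rewrite !derivE /=; ring.
  by rewrite Euclid_dvdz // negb_or l2 ls.
have cAB : coprimep (redp l ('X^2 + s%:P)) (redp l (quartic e)).
  apply: (@coprimep_bezout l _ _ (- ('X^2 + e%:P - s%:P)) 1 (2 - s * e)) => //.
  have -> : (2 - s * e)%:P = 1 + s%:P ^+ 2 - s%:P * e%:P :> {poly int} by rewrite s1P; ring.
  by rewrite /quartic; ring.
have cB := separable_quartic l2 le.
have := separable_mul (redp l ('X^2 + s%:P)) (redp l (quartic e)).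
rewrite !separable_poly.unlock -!rmorphM /= -!deriv_map in cA cB *; by rewrite cA cB cAB => ->.
Qed.
End Quartic.

Lemma polyG_family X (good : pred nat) (par : nat -> int * int) :
  X \in [:: 9; 15; 17; 18; 26]%N ->
  (forall M, exists k, (M < k)%N && good k) ->
  (forall k, good k -> let: (a, b) := par k in let P := b + 2 - 2 * a in let Q := b + 2 + 2 * a in
     let D := a ^+ 2 - 4 * b + 8 in
     [/\ a <> 0, 2 * P * Q * D != 0, galois_group_is (polyG a b) (T8 X) &
       (irreducible_poly (map_poly intr (polyG a b) : {poly rat}) ->
        forall theta, root (polyZC (polyG a b)) theta -> maximal_at (polyG a b) theta 2 /\
        forall l, prime l -> ~~ (l %| 2)%Z -> [|| (l %| P)%Z, (l %| Q)%Z | (l %| D)%Z] ->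
        maximal_at (polyG a b) theta l)]) ->
  (forall M k, good k -> (0 < M < k)%N -> let: (a, b) := par k in
     exists l g c F N, [/\ prime l, ~~ (l %| M)%N, g \is monic, (size g < 9)%N &
       g ^+ N = polyG a b * c + l%:Z%:P * F]) ->
  infinite_family admG polyG (T8 X).
Proof.
move=> HX Hex Hgood Hbad; pose disc (x : int * int) :=
  2 * (x.2 + 2 - 2 * x.1) * (x.2 + 2 + 2 * x.1) * (x.1 ^+ 2 - 4 * x.2 + 8).
apply: (@infinite_family_of _ _ _ good par (fun k => absz (disc (par k)))) => //.
- move=> k gk; have := Hgood k gk; case: (par k) => a b /= [a0 n0 G Hmax].
  have [fm fs] := monic_size_polyG a b.
  have fi := irreducible_of_transitive fm fs (T8_transitive HX) G.
  split=> //; apply: monogenic_of_maximal => // theta ft l pl.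
  have [H2 Hodd] := Hmax fi theta ft.
  have [d|nd] := boolP (l %| disc (a, b))%Z; last first.
    by apply: maximal_separable => //; apply: separable_polyG.
  have [l2|l2] := boolP (l %| 2)%Z; first by move: l2; rewrite prime_dvd2 // => /eqP ->.
  by move: d; rewrite /disc !Euclid_dvdz // (negPf l2) -orbA; apply: Hodd.
- by move=> k gk; have := Hgood k gk; case: (par k) => a b /= [_ n0 _ _]; rewrite absz_gt0.
- move=> k l gk pl lM; apply: separable_rad; apply: separable_polyG => //.
move=> M k gk Mk; have := Hbad M k gk Mk; case: (par k) => a b /= [l [g [c [F [N [pl lM gm sg E]]]]]].
exists l, g, N; split=> //; first by rewrite (monic_size_polyG a b).2.
exact: redp_dvd_of E.
Qed.

Section MaximalG.
Variables (a b : int) (theta : algC).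
Hypothesis f_irr : irreducible_poly (map_poly intr (polyG a b) : {poly rat}).
Hypothesis f_theta : root (polyZC (polyG a b)) theta.
Variable l : nat.
Hypothesis pl : prime l.

Let fm := (monic_size_polyG a b).1.

(** For the primes dividing [P] (with [s = 1]) or [Q] (with [s = -1]): exactly the factor [X^2 + s]
    is repeated modulo [l]. *)
Lemma maximalG_mul e (s t : int) : s ^+ 2 = 1 -> ~~ (l %| 2)%Z -> ~~ (l %| e ^+ 2 - 4)%Z -> ~~ (l %| t)%Z ->
  polyG a b = ('X^2 + s%:P) ^+ 2 * quartic e + (l%:Z * t)%:P * 'X^4 -> maximal_at (polyG a b) theta l.
Proof.
move=> s1 l2 le lt fE.
have fE' : polyG a b = (('X^2 + s%:P) * quartic e) * ('X^2 + s%:P) + l%:Z%:P * (t%:P * 'X^4).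
  by rewrite fE polyCM expr2 -!mulrA [quartic e * _]mulrC.
have fr : redp l (polyG a b) = redp l ((('X^2 + s%:P) * quartic e) * ('X^2 + s%:P)).
  by rewrite fE' rmorphD /= redp_l // addr0.
have ls : ~~ (l %| s)%Z by apply: contra (prime_ndvd1 pl) => /(dvdz_mulr s); rewrite -expr2 s1.
apply: (@maximal_coprime _ _ fm f_irr f_theta l _ _ _ 2 pl fE').
- rewrite fr -rmorphXn; apply/dvdpP; exists (redp l (quartic e)); rewrite -rmorphM /=.
  by congr (map_poly _ _); ring.
- exact: separable_mul_quartic.
rewrite [redp l (_ * quartic e)]rmorphM /= coprimepMl coprime_quartic_x4 // andbT.
apply: (@coprimep_bezout l _ _ (t%:P * (s%:P - 'X^2)) 1 t) => //.
have s1P : (s%:P : {poly int}) ^+ 2 = 1 by rewrite -rmorphXn /= s1.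
by transitivity (t%:P * (s%:P : {poly int}) ^+ 2); [ring | rewrite s1P mulr1].
Qed.

Lemma maximalG_square e (F : {poly int}) : ~~ (l %| 2)%Z -> ~~ (l %| e ^+ 2 - 4)%Z ->
  polyG a b = quartic e ^+ 2 + l%:Z%:P * F -> coprimep (redp l (quartic e)) (redp l F) ->
  maximal_at (polyG a b) theta l.
Proof.
move=> l2 le fE cF; rewrite expr2 in fE.
apply: (@maximal_coprime _ _ fm f_irr f_theta l _ _ _ 2 pl fE) => //.
- by rewrite fE rmorphD /= redp_l // addr0 rmorphM.
exact: separable_quartic.
Qed.
End MaximalG.

(** Modulo 2 this is [(X - 1)^8]. The coefficients 4, 14, 28, 35 in [F] are halves of binomial
    coefficients, and [F(1) = 1 + 2 (c + d)]. *)
Lemma maximalG_two (a b : int) theta (c d : int) :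
  irreducible_poly (map_poly intr (polyG a b) : {poly rat}) -> root (polyZC (polyG a b)) theta ->
  a = 2 * c -> b = 4 * d -> ~~ (2 %| 1 + 2 * (c + d))%Z -> maximal_at (polyG a b) theta 2.
Proof.
move=> fi ft Da Db cd; have fm := (monic_size_polyG a b).1.
pose F : {poly int} := c%:P * 'X^6 + 2 * d%:P * 'X^4 + c%:P * 'X^2 - (- 4 * 'X^7 + 14 * 'X^6 - 28 * 'X^5 + 35 * 'X^4
  - 28 * 'X^3 + 14 * 'X^2 - 4 * 'X).
have fE : polyG a b = ('X - 1%:P) * ('X - 1%:P) ^+ 7 + 2%:Z%:P * F.
  by rewrite /polyG Da Db /F; ring.
apply: (@maximal_coprime _ _ fm fi ft 2 _ _ _ 8 isT fE).
- by rewrite fE rmorphD /= redp_l // addr0 -exprS rmorphXn.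
- by apply: (@coprimep_bezout 2 _ _ 0 1 1) => //; rewrite derivXsubC; ring.
rewrite rmorphB /= map_polyX map_polyC /= coprimep_sym coprimep_XsubC.
have -> : (1%:~R : 'F_2) = (1 : int)%:~R by [].
rewrite /root horner_map /= intr_Fp_eq0 //; move: cd.
by rewrite /F !(hornerD, hornerN, hornerM, hornerX, hornerC); congr (~~ (_ %| _)%Z); lia.
Qed.

(* the reduction modulo 2 is the square of the irreducible 'X^4 + 'X^3 + 'X^2 + 'X + 1 *)
Lemma maximalG_two_odd (k : int) theta (a := 4 * k + 3) (b := 2 * a - 1) :
  irreducible_poly (map_poly intr (polyG a b) : {poly rat}) -> root (polyZC (polyG a b)) theta ->
  maximal_at (polyG a b) theta 2.
Proof.
move=> fi ft; have fm := (monic_size_polyG a b).1.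
pose phi : {poly int} := 'X^4 + 'X^3 + 'X^2 + 'X + 1.
pose F : {poly int} := - 'X^7 - 'X + 2%:P * (k%:P * 'X^6 - 'X^5 + 2 * k%:P * 'X^4 - 'X^3 + k%:P * 'X^2).
have fE : polyG a b = phi * phi + 2%:Z%:P * F by rewrite /polyG /b /a /phi /F; ring.
apply: (@maximal_coprime _ _ fm fi ft 2 _ _ _ 2 isT fE).
- by rewrite fE rmorphD /= redp_l // addr0 rmorphM.
- have -> : phi^`() = 4 * 'X^3 + 3 * 'X^2 + 2 * 'X + 1 by rewrite /phi !derivE /=; ring.
  by apply: (@coprimep_bezout 2 _ _ (5 - 4 * 'X) ('X^2 - 'X) 5) => //; rewrite /phi; ring.
have -> : redp 2 F = redp 2 (- 'X^7 - 'X) by rewrite rmorphD /= redp_l // addr0.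
by apply: (@coprimep_bezout 2 _ _ (1 + ('X^2 + 1) * 'X^2 * ('X - 1)) ('X^2 + 1) 1) => //; rewrite /phi; ring.
Qed.

(** The parameters give [P = 2 (6 k + 1)], [Q = 2 (6 k + 5)] and [D = - 4 (12 k + 1)]. The
    coefficient 12 keeps 3 away from these values, as needed for the quartic cofactors with [e = 4]
    and [e = 1]. *)
Lemma infinite_G18 : infinite_family admG polyG (T8 18).
Proof.
apply: (@polyG_family 18
  (fun k => [&& (0 < k)%N, sqfree (6 * k + 1), sqfree (6 * k + 5) & sqfree (12 * k + 1)])
  (fun k => (2, 12 * k%:Z + 4))) => //.
- move=> M; have [|k /andP [Mk /and4P [h1 h2 h3 _]]] :=
    @linear_sieve [:: (6, 1); (6, 5); (12, 1)]%N isT _ M; first by [].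
 
  by exists k; rewrite Mk (leq_ltn_trans _ Mk) //= h1 h2 h3.
- move=> k /and4P [k0 sA sB sC].
  pose A := (6 * k + 1)%N; pose B := (6 * k + 5)%N; pose C := (12 * k + 1)%N.
  have oA : odd A by rewrite /A oddD oddM.
  have PE : 12 * k%:Z + 4 + 2 - 2 * 2 = 2 * A%:Z by rewrite /A; clear; lia.
  have QE : 12 * k%:Z + 4 + 2 + 2 * 2 = 2 * B%:Z by rewrite /B; clear; lia.
  have DE : 2 ^+ 2 - 4 * (12 * k%:Z + 4) + 8 = - (2 * 2 * C%:Z) by rewrite /C; clear; lia.
  have n3 (l : nat) (x : int) : prime l -> (l %| 3 * x + 1)%Z || (l %| 3 * x + 2)%Z -> ~~ (l %| 3)%Z.
    move=> pl Hx; apply/negP => l3; move/negP: (prime_ndvd1 pl); apply.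
    case/orP: Hx => lx; first by apply: (dvdz_comb (u := - x) (v := 1) l3 lx); ring.
    by apply: (dvdz_comb (u := x + 1) (v := - 1) l3 lx); ring.
  split=> //.
  + by rewrite PE QE DE /A /B /C; clear -k0; nia.
  + have [p pp pA] := @sqfree_prime A (ltac:(by rewrite /A; clear -k0; lia)) sA.
    have [u uE pu] := sqfree_split pp sA pA; have p2 := odd_factor_ndvd2 pp oA pA.
    have pB : ~~ (p %| B%:Z)%Z.
      apply/negP => pB; move/negP: p2; apply; have : (p %| 2 * 2)%Z.
        by apply: (dvdz_comb (u := - 1) (v := 1) pA pB); rewrite /A /B; clear; lia.
      by rewrite Euclid_dvdz // orbb.
    apply: galoisG18; rewrite PE QE DE; split.
    * by apply: nonsquare_neg; rewrite /C; clear; lia.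
    * apply: (nonsquare_prime (l := 2) (u := A%:Z)) => //.
      by apply/negP => /dvdzP [q]; rewrite /A; clear; lia.
    * apply: (nonsquare_prime (l := 2) (u := B%:Z)) => //.
      by apply/negP => /dvdzP [q]; rewrite /B; clear; lia.
    * by apply: nonsquare_neg; rewrite /A /C; clear; nia.
    * by apply: nonsquare_neg; rewrite /B /C; clear; nia.
    * apply: (nonsquare_prime (l := p) (u := 2 * 2 * u * B%:Z)) => //; first by rewrite uE; ring.
      by rewrite !Euclid_dvdz // (negPf p2) (negPf pu) (negPf pB).
    by apply: nonsquare_neg; rewrite /A /B /C; clear; nia.
  move=> fi theta ft; split.
    apply: (maximalG_two fi ft (c := 1) (d := 3 * k%:Z + 1)) => //; first by clear; lia.
    by apply/negP => /dvdzP [q]; clear; lia.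
  move=> l pl l2; rewrite PE QE DE rpredN !Euclid_dvdz // (negPf l2) /=.
  case/or3P => ld.
  + have [u uE lu] := sqfree_split pl sA ld.
    apply: (maximalG_mul fi ft pl (e := 0) (s := 1) (t := 2 * u)) => //.
    * by rewrite expr0n /= sub0r rpredN four_int Euclid_dvdz // (negPf l2).
    * by rewrite Euclid_dvdz // (negPf lu) (negPf l2).
    rewrite [l%:Z * (2 * u)]mulrCA -uE; have -> : 2 * A%:Z = 12 * k%:Z + 2 by rewrite /A; clear; lia.
    by rewrite /polyG /quartic; ring.
  + have [u uE lu] := sqfree_split pl sB ld.
    apply: (maximalG_mul fi ft pl (e := 4) (s := -1) (t := 2 * u)) => //.
    * have -> : 4 ^+ 2 - 4 = 2 * 2 * 3 :> int by [].
      rewrite !Euclid_dvdz // (negPf l2) /=; apply: (n3 _ (2 * k%:Z + 1) pl); apply/orP; right.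
      by have -> : 3 * (2 * k%:Z + 1) + 2 = B%:Z by rewrite /B; clear; lia.
    * by rewrite Euclid_dvdz // (negPf lu) (negPf l2).
    rewrite [l%:Z * (2 * u)]mulrCA -uE; have -> : 2 * B%:Z = 12 * k%:Z + 10 by rewrite /B; clear; lia.
    by rewrite /polyG /quartic; ring.
  have [u uE lu] := sqfree_split pl sC ld.
  apply: (maximalG_square fi ft pl (e := 1) (F := u%:P * 'X^4)) => //.
  + have l3 : ~~ (l %| 3)%Z; last first.
      by apply: contra l3 => h; apply: (dvdz_comb (u := - 1) (v := 0) h h).
    apply: (n3 _ (4 * k%:Z) pl); apply/orP; left.
    by have -> : 3 * (4 * k%:Z) + 1 = C%:Z by rewrite /C; clear; lia.
  + rewrite mulrA -polyCM -uE; have -> : C%:Z = 12 * k%:Z + 1 by rewrite /C; clear; lia.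
    by rewrite /polyG /quartic; ring.
  exact: coprime_quartic_x4.
move=> M k /and4P [k0 sA sB sC] /andP [M0 Mk].
have [|p [u [pp uE pM]]] := @sqfree_prime_factor (6 * k + 1) M sA; first by rewrite M0; clear -Mk; lia.
have [gm gs] := @monic_size_Xn 6 ('X^4 + 'X^2 + 1) (ltac:(
  by rewrite (leq_trans (size_polyD _ _)) // geq_max size_poly1 andbT (leq_trans (size_polyD _ _)) // geq_max !size_polyXn)).
(* This is [(X^2 + 1) (X^4 + 1)], the radical of [(X^2 + 1)^2 (X^4 + 1)], to which the polynomial
   reduces modulo a prime dividing [P]. *)
exists p, ('X^6 + ('X^4 + 'X^2 + 1)), ('X^4 + 1), ((- (2 * u))%:P * ('X^4 * ('X^4 + 1))), 2%N.
split=> //; first by rewrite gs.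
have -> : p%:Z%:P * ((- (2 * u))%:P * ('X^4 * ('X^4 + 1))) = (- (12 * k%:Z + 2))%:P * ('X^4 * ('X^4 + 1)).
  by rewrite [LHS]mulrA -polyCM mulrN [p%:Z * (2 * u)]mulrCA -uE; congr ((- _)%:P * _); clear; lia.
by rewrite /polyG; ring.
Qed.

(** The condition [b = 2 a - 1] means [P = 1]; then [Q = 4 a + 1] and [D = (a - 2) (a - 6)]. The
    class of 55 modulo 60 gives [a = 3] modulo 4 for the prime 2 and keeps the relevant factors
    prime to 3 and 5, the odd primes of the numbers [e^2 - 4] that occur. *)
Lemma infinite_G9 : infinite_family admG polyG (T8 9).
Proof.
apply: (@polyG_family 9
  (fun k => [&& (0 < k)%N, sqfree (60 * k + 53), sqfree (60 * k + 49) & sqfree (240 * k + 221)])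
  (fun k => (60 * k%:Z + 55, 2 * (60 * k%:Z + 55) - 1))) => //.
- move=> M; have [|k /andP [Mk /and4P [h1 h2 h3 _]]] :=
    @linear_sieve [:: (60, 53); (60, 49); (240, 221)]%N isT _ M; first by [].
 
  by exists k; rewrite Mk (leq_ltn_trans _ Mk) //= h1 h2 h3.
move=> k /and4P [k0 sA sB sC].
  set a := 60 * k%:Z + 55; set b := 2 * a - 1.
  pose A := (60 * k + 53)%N; pose B := (60 * k + 49)%N; pose C := (240 * k + 221)%N.
  have oA : odd A by rewrite /A oddD oddM.
  have aA : a = A%:Z + 2 by rewrite /a /A; clear; lia.
  have aB : a = B%:Z + 6 by rewrite /a /B; clear; lia.
  have aC : 4 * a = C%:Z - 1 by rewrite /a /C; clear; lia.
  have PE : b + 2 - 2 * a = 1 by rewrite /b; clear; lia.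
  have QE : b + 2 + 2 * a = C%:Z by rewrite /b; clear -aC; lia.
  have DE : a ^+ 2 - 4 * b + 8 = A%:Z * B%:Z.
    have -> : a ^+ 2 - 4 * b + 8 = (a - 2) * (a - 6) by rewrite /b; ring.
    by rewrite {1}aA aB; congr (_ * _); clear; lia.
  have C3 (l : nat) : prime l -> (l %| C%:Z)%Z -> ~~ (l %| 3)%Z.
    move=> pl lC; apply/negP => l3; move/negP: (prime_ndvd1 pl); apply.
    by apply: (dvdz_comb (u := 80 * k%:Z + 74) (v := - 1) l3 lC); rewrite /C; clear; lia.
  have C5 (l : nat) : prime l -> (l %| C%:Z)%Z -> ~~ (l %| 5)%Z.
    move=> pl lC; apply/negP => l3; move/negP: (prime_ndvd1 pl); apply.
    by apply: (dvdz_comb (u := - (48 * k%:Z + 44)) (v := 1) l3 lC); rewrite /C; clear; lia.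
  split.
  + by rewrite /a; clear; lia.
  + by rewrite PE QE DE /A /B /C; clear -k0; nia.
  + have [p pp pA] := @sqfree_prime A (ltac:(by rewrite /A; clear -k0; lia)) sA.
    have [u uE pu] := sqfree_split pp sA pA; have p2 := odd_factor_ndvd2 pp oA pA.
    have pB : ~~ (p %| B%:Z)%Z.
      apply/negP => pB; move/negP: p2; apply; have : (p %| 2 * 2)%Z.
        by apply: (dvdz_comb (u := 1) (v := - 1) pA pB); rewrite /A /B; clear; lia.
      by rewrite Euclid_dvdz // orbb.
    have [q qq qC] := @sqfree_prime C (ltac:(by rewrite /C; clear -k0; lia)) sC.
    have [v vE qv] := sqfree_split qq sC qC.
    have qA : ~~ (q %| A%:Z)%Z.
      apply/negP => qA; move/negP: (C3 q qq qC); apply; have : (q %| 3 * 3)%Z.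
        by apply: (dvdz_comb (u := - 4) (v := 1) qA qC); rewrite /A /C; clear; lia.
      by rewrite Euclid_dvdz // orbb.
    have qB : ~~ (q %| B%:Z)%Z.
      apply/negP => qB; move/negP: (C5 q qq qC); apply; have : (q %| 5 * 5)%Z.
        by apply: (dvdz_comb (u := - 4) (v := 1) qB qC); rewrite /B /C; clear; lia.
      by rewrite Euclid_dvdz // orbb.
    have E6 : 6 - a = - B%:Z by rewrite aB; clear; lia.
    have E2 : 2 - a = - A%:Z by rewrite aA; clear; lia.
    apply: galoisG9 => //; rewrite QE E6 E2; split.
    * by apply: nonsquare_neg; rewrite /B; clear; lia.
    * by apply: nonsquare_neg; rewrite /A; clear; lia.
    * by apply: (nonsquare_prime (l := q) (u := v)).
    * rewrite mulrNN; apply: (nonsquare_prime (l := p) (u := u * B%:Z)) => //; first by rewrite uE; ring.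
      by rewrite !Euclid_dvdz // (negPf pu) (negPf pB).
    * by apply: nonsquare_neg; rewrite /B /C; clear; nia.
    * by apply: nonsquare_neg; rewrite /A /C; clear; nia.
    rewrite mulrNN; apply: (nonsquare_prime (l := q) (u := v * (B%:Z * A%:Z))) => //; first by rewrite vE; ring.
    by rewrite !Euclid_dvdz // (negPf qv) (negPf qA) (negPf qB).
  move=> fi theta ft; split.
    have aE : a = 4 * (15 * k%:Z + 13) + 3 by rewrite /a; clear; lia.
    by have := @maximalG_two_odd (15 * k%:Z + 13) theta; rewrite -aE => H; apply: H.
  move=> l pl l2; rewrite PE QE DE (negPf (prime_ndvd1 pl)) Euclid_dvdz //=.
  case/or3P => ld.
  + have [u uE lu] := sqfree_split pl sC ld.
    apply: (maximalG_mul fi ft pl (e := a + 2) (s := -1) (t := u)) => //.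
    * have -> : (a + 2) ^+ 2 - 4 = a * (a + 4) by ring.
      rewrite Euclid_dvdz //; apply/negP => /orP [la|la].
        move/negP: (prime_ndvd1 pl); apply.
        by apply: (dvdz_comb (u := - 4) (v := 1) la ld); clear -aC; lia.
      have : (l %| 3 * 5)%Z.
        apply: (dvdz_comb (u := 4) (v := - 1) la ld); clear -aC; lia.
      by rewrite Euclid_dvdz // (negPf (C3 l pl ld)) (negPf (C5 l pl ld)).
    rewrite -uE; have -> : C%:Z = 4 * a + 1 by rewrite aC; clear; lia.
    by rewrite /polyG /quartic /b; ring.
  + have [u uE lu] := sqfree_split pl sA ld.
    apply: (maximalG_square fi ft pl (e := 1) (F := u%:P * ('X^2 * ('X^2 + 1) ^+ 2))) => //.
    * apply/negP => l3; move/negP: (prime_ndvd1 pl); apply.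
      by apply: (dvdz_comb (u := - (20 * k%:Z + 18)) (v := - 1) l3 ld); rewrite /A; clear; lia.
    * rewrite mulrA -polyCM -uE; have -> : A%:Z = a - 2 by rewrite aA; clear; lia.
      by rewrite /polyG /quartic /b; ring.
    apply: (@coprimep_bezout l _ _ (u%:P * (1 - 'X^2 * ('X^2 + 1))) 'X^2 u) => //.
    by rewrite /quartic; ring.
  have [u uE lu] := sqfree_split pl sB ld.
  apply: (maximalG_square fi ft pl (e := 3) (F := u%:P * ('X^2 * ('X^2 + 1) ^+ 2))) => //.
  + apply/negP => l3; move/negP: (prime_ndvd1 pl); apply.
    by apply: (dvdz_comb (u := 12 * k%:Z + 10) (v := - 1) l3 ld); rewrite /B; clear; lia.
  + rewrite mulrA -polyCM -uE; have -> : B%:Z = a - 6 by rewrite aB; clear; lia.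
    by rewrite /polyG /quartic /b; ring.
  pose q : {poly int} := 'X^2.
  apply: (@coprimep_bezout l _ _ (u%:P * ((q + 3) ^+ 2 * q - quartic 3 + 2)) (- (q + 3) ^+ 2) u) => //.
  by rewrite /quartic /q; ring.
move=> M k /and4P [k0 sA sB sC] /andP [M0 Mk].
have [|p [u [pp uE pM]]] := @sqfree_prime_factor (60 * k + 53) M sA; first by rewrite M0; clear -Mk; lia.
have [gm gs] := @monic_size_Xn 4 ('X^2 + 1) (ltac:(
  by rewrite (leq_trans (size_polyD _ _)) // geq_max size_poly1 size_polyXn)).
exists p, ('X^4 + ('X^2 + 1)), 1, ((- u)%:P * ('X^2 * ('X^2 + 1) ^+ 2)), 2%N.
split=> //; first by rewrite gs.
have -> : p%:Z%:P * ((- u)%:P * ('X^2 * ('X^2 + 1) ^+ 2)) = (- (60 * k%:Z + 53))%:P * ('X^2 * ('X^2 + 1) ^+ 2).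
  by rewrite [LHS]mulrA -polyCM mulrN -uE; congr ((- _)%:P * _); clear; lia.
by rewrite /polyG; ring.
Qed.

(** * Small Galois groups *)

Lemma wfp_ptab s : wfp (ptab s).
Proof.
by rewrite /wfp size_map size_enum_ord; apply/allP => _ /mapP [i _ ->]; apply: ltn_ord.
Qed.

(* All the permutations in [Dom] preserve the partition of the points into [k < 4] and [4 <= k];
   testing this on a labelling first is only a matter of speed. *)
Definition block_perm (c g : seq nat) : bool :=
  all (fun i => (nth 0 c (nth 0 g i) < 4) == ((nth 0 c i < 4) == (nth 0 c (nth 0 g 0) < 4)))%N (iota 0 8).

(** The labelling of the roots in [galois_group_is] is unknown, so all are tried. The list of roots
    can be started at [e ord0], which leaves [7!] labellings; each one carrying the generators into
    [Dom] must make some character trivial on all of them. *)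
Definition label_check (Dom : seq (seq nat)) (chars : seq (seq nat -> bool)) (gl : seq (seq (seq nat))) : bool :=
  let gens := map prL gl in
  [&& all (all cyc_ok) gl, all wfp Dom, all (block_perm (iota 0 8)) Dom &
  all (fun c => if all (block_perm (0%N :: c)) gens then
      let hs := map (lconj (0%N :: c)) gens in
      if all (fun p => p \in Dom) hs then has (fun s => all (fun p => ~~ s p) hs) chars else true
    else true) (permutations (iota 1 7))].

Definition group_on (e : 'I_8 -> algC) (H : {set 'S_8}) :=
  forall s : 'S_8, (exists u : {rmorphism algC -> algC}, forall i, u (e i) = e (s i)) <-> s \in H.

Section Labelling.
Variables (R : seq algC) (Dom : seq (seq nat)) (e : 'I_8 -> algC) (gl : seq (seq (seq nat))).
Hypotheses (sR : size R = 8%N) (uR : uniq R) (e_inj : injective e) (eR : forall i, e i \in R).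
Hypothesis e0 : nth 0 R 0 = e ord0.
Hypothesis Hind : forall u, exists2 p, p \in Dom & induces R u p.
Hypothesis He : group_on e (gen_grp (map pr gl)).

Lemma small_group_square (chars : seq (seq nat -> bool)) (data : nat -> algC * int) :
  label_check Dom chars gl ->
  (forall i, (i < size chars)%N -> sign_char R Dom (nth (fun _ => false) chars i) (data i).1 /\
     (data i).1 ^+ 2 = (data i).2%:~R) ->
  exists2 i, (i < size chars)%N & exists k : int, (data i).2 = k ^+ 2.
Proof.
move=> /and4P [okgl /allP wD /allP bD /allP Hc] Hdata.
pose c := [seq index (e i) R | i <- enum 'I_8].
have sc : size c = 8%N by rewrite size_map size_enum_ord.
have nc (i : 'I_8) : nth 0%N c i = index (e i) R.
  by rewrite (nth_map i) ?size_enum_ord // nth_ord_enum.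
have Rc (i : 'I_8) : nth 0 R (nth 0%N c i) = e i by rewrite nc nth_index.
have uc : uniq c.
  rewrite map_inj_in_uniq ?enum_uniq // => i j _ _ ij; apply: e_inj.
  by rewrite -[e i](nth_index 0 (eR i)) ij nth_index.
have wc : wfp c.
  by rewrite /wfp sc eqxx /=; apply/allP => k /mapP [i _ ->]; rewrite -sR index_mem.
have lc : label_ok c by rewrite /label_ok wc.
have [c' cE] : exists c', c = 0%N :: c'.
  have : nth 0%N c 0 = 0%N.
    by rewrite (nc ord0) -e0 index_uniq // sR.
  by move: sc; case: (c) => // x c' _ /= ->; exists c'.
have pc : c' \in permutations (iota 1 7).
  rewrite mem_permutations -(perm_cons 0%N) -cE; apply: uniq_perm => //.
  have [|||_] := @uniq_min_size _ c (iota 0 8) => //; last by rewrite sc.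
  by move=> k kc; rewrite mem_iota; case/andP: wc => _ /allP; apply.
have cP k : (k < 8)%N -> exists i : 'I_8, k = nth 0%N c i.
  move=> k8; have : k \in c.
    rewrite cE -(perm_mem (_ : perm_eq (iota 0 8) _)) ?mem_iota //.
    by rewrite perm_sym -[iota 0 8]/(0%N :: iota 1 7) perm_cons -mem_permutations.
  by move=> /mapP [i _ ->]; exists i; rewrite nc.
have ind_e u p (s : 'S_8) : wfp p -> induces R u p -> (forall i, u (e i) = e (s i)) ->
    p = lconj c (ptab s).
  move=> wp Hp Hu; apply: (@eq_from_nth _ 0%N); first by rewrite size_map size_iota; case/andP: wp => /eqP.
  have -> : size p = 8%N by case/andP: wp => /eqP.
  move=> k k8; have [i ->] := cP k k8; rewrite nth_lconj // nth_ptab.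
  have := Hp _ (wfp_nth wc (ltn_ord i)); rewrite Rc Hu -Rc => /eqP.
  by rewrite nth_uniq ?sR ?wfp_nth // => /eqP ->.
have tE l : l \in gl -> ptab (pr l) = prL l by move=> lin; rewrite ptab_pr //; move/allP: okgl; apply.
have gens l : l \in gl -> exists u, [/\ lconj c (prL l) \in Dom, induces R u (lconj c (prL l)) &
    forall i, u (e i) = e (pr l i)].
  move=> lin; have [u Hu] : exists u : {rmorphism algC -> algC}, forall i, u (e i) = e (pr l i).
    by apply/He; rewrite mem_gen // inE map_f.
  have [p pD Hp] := Hind u; exists u; rewrite -tE // -(ind_e u p (pr l)) //; exact: wD.
have HD : all (fun p => p \in Dom) (map (lconj c) (map prL gl)).
  by apply/allP => _ /mapP [_ /mapP [l lin ->] ->]; have [u []] := gens l lin.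
have HB : all (block_perm c) (map prL gl).
  apply/allP => _ /mapP [l lin ->]; have [u [pD _ _]] := gens l lin.
  have lt8 i : i \in iota 0 8 -> (i < 8)%N by rewrite mem_iota.
  have wg : wfp (prL l) by rewrite -tE // wfp_ptab.
  apply/allP => i /lt8 i8.
  have := allP (bD _ pD) (nth 0%N c i); rewrite mem_iota => /(_ (wfp_nth wc i8)).
  rewrite (nth_iota _ _ (wfp_nth wc i8)) add0n nth_lconj //.
  have c0 : nth 0%N c 0 = 0%N by rewrite cE.
  have p0 := @nth_lconj c (prL l) 0 lc isT; rewrite c0 in p0.
  by rewrite p0 !nth_iota ?add0n ?wfp_nth.
have := Hc c' pc; rewrite /= -cE HB HD.
move=> /(has_nthP (fun _ => false)) [i isz /allP Hs]; exists i => //.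
have [Hsgn zN] := Hdata i isz; apply: (Crat_sqr_int zN).
have fixz : forall s : 'S_8, s \in gen_grp (map pr gl) -> exists2 u : {rmorphism algC -> algC},
    (forall j, u (e j) = e (s j)) & u (data i).1 = (data i).1.
  apply: gen_grp_ind; first by exists idfun => // j; rewrite perm1.
  move=> g s /mapP [l lin ->] [u Hu uz]; have [v [vD Hv Hve]] := gens l lin.
  exists (v \o u) => [j|] /=; first by rewrite Hu Hve permM.
  rewrite uz (Hsgn v _ vD Hv) (negPf (Hs _ _)) ?mul1r //.
  by apply: map_f; apply: map_f.
(* Every automorphism permutes the roots as some element of the group, hence as an automorphism
   already known to fix this square root; the sign depends only on the permutation. *)
have all_fix (v : {rmorphism algC -> algC}) : v (data i).1 = (data i).1.
  have [p pD Hp] := Hind v; have wp := wD p pD.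
  have veR j : v (e j) \in R by rewrite -Rc Hp ?wfp_nth // mem_nth // sR wfp_nth // wfp_nth.
  have ve j : exists k, e k = v (e j).
    have [k kE] := cP (index (v (e j)) R) (ltac:(by rewrite -sR index_mem)).
    by exists k; rewrite -Rc -kE nth_index.
  pose g j := odflt ord0 [pick k | e k == v (e j)].
  have gE j : e (g j) = v (e j).
    rewrite /g; case: pickP => [k /eqP //|H]; have [k kE] := ve j; by have := H k; rewrite kE eqxx.
  have ginj : injective g.
    by move=> j k jk; apply: e_inj; apply: (fmorph_inj v); rewrite -!gE jk.
  have vs j : v (e j) = e (perm ginj j) by rewrite permE gE.
  have sH : perm ginj \in gen_grp (map pr gl) by apply/He; exists v.
  have [u Hu uz] := fixz _ sH; have [q qD Hq] := Hind u.
  have pq : p = q by rewrite (ind_e v p _ wp Hp vs) (ind_e u q _ (wD q qD) Hq Hu).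
  by rewrite (Hsgn v p pD Hp) pq -(Hsgn u q qD Hq).
have [//|nQ] := boolP ((data i).1 \in Crat).
have [|u uz] := @quadratic_automorphism (data i).1 _ nQ; first by rewrite zN rpred_int.
have := all_fix u; rewrite uz => /eqP; rewrite eq_sym -addr_eq0 -mulr2n mulrn_eq0 /= => /eqP E.
by rewrite E rpred0 in nQ.
Qed.
End Labelling.

Definition finF := [:: 2; 3; 4; 6; 8; 11; 16; 22]%N.

Lemma small_checkF : all (fun X => label_check DomF
  [:: sgB; (fun p => sgI p (+) sgB p); (fun p => sgD p (+) sgB p); (fun p => sgI p (+) (sgD p (+) sgB p))]
  (cycles8 X)) finF.
Proof. vm_cast_no_check (erefl true). Qed.

(** Second round for [b = 1], where the sign of the root of [b] is trivial and tells nothing. The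
    radicands are -1, [a + 2], [a - 2] and [4 - a^2]. *)
Lemma small_check9 : all (fun X => label_check Dom9
  [:: sgI; (fun p => sgI p (+) (sgU p (+) sgD p)); (fun p => sgI p (+) sgU p);
     (fun p => sgI p (+) (sgU p (+) (sgU p (+) sgD p)))]
  (cycles8 X)) finF.
Proof. vm_cast_no_check (erefl true). Qed.

(** Second round for [b = -1], with [r * s = z]. Of the radicands -1, 2, -2, [2 d] and [- 2 d], only
    [2 d] can be a square, as [d = a^2 + 4] is positive. *)
Lemma small_check_prod : all (fun X => label_check (Domz zt_prod)
  [:: sgI; sg2 zt_prod; (fun p => sgI p (+) sg2 zt_prod p); (fun p => sgD p (+) sg2 zt_prod p);
     (fun p => sgI p (+) (sgD p (+) sg2 zt_prod p))]
  (cycles8 X)) finF.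
Proof. vm_cast_no_check (erefl true). Qed.

(** Second round for [a = 0], with [s = z * r]; the radicands are [b], 2, -2, [2 b] and [- 2 b]. *)
Lemma small_check_quot : all (fun X => label_check (Domz zt_quot)
  [:: sgB; sg2 zt_quot; (fun p => sgI p (+) sg2 zt_quot p); (fun p => sgB p (+) sg2 zt_quot p);
     (fun p => sgI p (+) (sgB p (+) sg2 zt_quot p))]
  (cycles8 X)) finF.
Proof. vm_cast_no_check (erefl true). Qed.

Lemma small_checkG : all (fun X => label_check DomG
  [:: (fun p => sgP p (+) sgQ p); (fun p => sgD p (+) sgP p); (fun p => sgD p (+) sgQ p);
     (fun p => sgD p (+) (sgP p (+) sgQ p))]
  (cycles8 X)) [:: 2; 3; 10]%N.
Proof. vm_cast_no_check (erefl true). Qed.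

Lemma small_checkG4 : label_check DomG
  [:: (fun p => sgP p (+) sgQ p); sgP; sgQ] (cycles8 4).
Proof. vm_cast_no_check (erefl true). Qed.

(** For 8T4 the first round may end with [P] or [Q] a square, hence equal to 1. This second round,
    and its analogue for [Q], still bounds [a] then. *)
Lemma small_checkP : label_check DomP
  [:: (fun p => sgU1 p (+) sgQ p); (fun p => (sgU1 p (+) sgD p) (+) sgQ p)] (cycles8 4).
Proof. vm_cast_no_check (erefl true). Qed.

Lemma small_checkQ : label_check DomQ
  [:: (fun p => sgV1 p (+) sgP p); (fun p => (sgV1 p (+) sgD p) (+) sgP p)] (cycles8 4).
Proof. vm_cast_no_check (erefl true). Qed.

Definition is_sqr (N : int) := exists k : int, N = k ^+ 2.

Lemma is_sqr0 : is_sqr 0. Proof. by exists 0. Qed.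

Lemma has_is_sqr (zs : seq (algC * int)) :
  (exists2 i, (i < size zs)%N & is_sqr (nth (0, 0) zs i).2) ->
  foldr (fun z P => is_sqr z.2 \/ P) False zs.
Proof.
move=> [i]; elim: zs i => [|z zs IH] [|i] //=; first by left.
by rewrite ltnS => isz H; right; apply: IH H.
Qed.

Section RootF.
Variables (a b : int) (X : nat) (e : 'I_8 -> algC).
Hypotheses (XF : X \in finF) (e_inj : injective e) (e_root : forall i, root (polyZC (polyF a b)) (e i)).
Hypothesis He : group_on e (T8 X).
Let r := e ord0.

Lemma rootF_eq t : root (polyZC (polyF a b)) t -> t ^+ 8 + a%:~R * t ^+ 4 + b%:~R = 0.
Proof.
by move=> /rootP; rewrite /polyZC map_polyF !(hornerD, hornerM, hornerX, hornerC, hornerXn).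
Qed.

(** Since [r] is already the first root of the given labelling, only [s] is left to choose; any
    fourth root will do, so it can be adapted to the extra relation of each special case. *)
Lemma second_root s : s ^+ 4 = - a%:~R - r ^+ 4 ->
  r ^+ 4 + s ^+ 4 = - a%:~R /\ r ^+ 4 * s ^+ 4 = b%:~R.
Proof.
move=> ->; split; first by ring.
by have /eqP := rootF_eq (e_root ord0); rewrite addr_eq0 => /eqP H; apply: oppr_inj; rewrite -H -/r; ring.
Qed.

Hypotheses (b0 : b != 0) (d0 : a ^+ 2 - 4 * b != 0).

Lemma small_squareF s Dom chars (zs : seq (algC * int)) :
  s ^+ 4 = - a%:~R - r ^+ 4 ->
  (forall u, exists2 p, p \in Dom & induces (rootsF r s) u p) ->
  all (fun X => label_check Dom chars (cycles8 X)) finF -> size chars = size zs ->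
  (forall i, (i < size zs)%N ->
    sign_char (rootsF r s) Dom (nth (fun _ => false) chars i) (nth (0, 0) zs i).1 /\
    (nth (0, 0) zs i).1 ^+ 2 = (nth (0, 0) zs i).2%:~R) ->
  foldr (fun z P => is_sqr z.2 \/ P) False zs.
Proof.
move=> sE Hind /allP Hchk sz Hdata; apply: has_is_sqr; rewrite -sz.
have [rs_add rs_mul] := second_root sE.
apply: (@small_group_square (rootsF r s) Dom e (cycles8 X) _ _ e_inj _ _ Hind _ chars) => //.
- exact: uniq_rootsF rs_add rs_mul b0 d0.
- by move=> i; have [k k8 ->] := rootsFP rs_add rs_mul b0 d0 (e_root i); rewrite mem_nth.
- by rewrite nth_rootsF // expr0 mul1r.
- rewrite -T8_cycles //; move: XF; rewrite !inE.
  by do ![case/orP; [by move=> -> //; rewrite !orbT|]]; move=> ->; rewrite !orbT.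
- exact: Hchk.
by rewrite sz.
Qed.

End RootF.

Lemma finF_square a b X : X \in finF -> galois_group_is (polyF a b) (T8 X) ->
  let d := a ^+ 2 - 4 * b in [\/ is_sqr b, is_sqr (- b), is_sqr (d * b) | is_sqr (- (d * b))].
Proof.
move=> XF [e [einj er He]] d; have [b0|b0] := eqVneq b 0.
  by constructor 1; rewrite b0; apply: is_sqr0.
have [d0|d0] := eqVneq d 0; first by constructor 3; rewrite d0 mul0r; apply: is_sqr0.
pose r := e ord0; pose s := 4.-root (- a%:~R - r ^+ 4).
have sE : s ^+ 4 = - a%:~R - r ^+ 4 by rewrite rootCK.
have [rs_add rs_mul] := second_root er sE.
have Hb := sqr_r2s2 rs_mul; have Hd := sqr_rs4 rs_add rs_mul.
have Ci := sign_char_i rs_mul b0 d0; have Cd := sign_char_d (r := r) (s := s).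
have Cb := sign_char_b (r := r) (s := s).
have [] := small_squareF XF einj er He b0 d0 (s := s)
  (zs := [:: (r ^+ 2 * s ^+ 2, b); ('i * (r ^+ 2 * s ^+ 2), - b);
   ((r ^+ 4 - s ^+ 4) * (r ^+ 2 * s ^+ 2), d * b);
   ('i * ((r ^+ 4 - s ^+ 4) * (r ^+ 2 * s ^+ 2)), - (d * b))]) sE
   (indF rs_add rs_mul b0 d0) small_checkF erefl.
- move=> [|[|[|[|i]]]] isz; [split | split | split | split | by []].
  + exact: Cb.
  + exact: Hb.
  + exact: sign_charM.
  + by rewrite [LHS]exprMn Hb sqrCi mulN1r -rmorphN.
  + exact: sign_charM.
  + by rewrite [LHS]exprMn Hb Hd -intrM.
  + by apply: sign_charM => //; apply: sign_charM.
  by rewrite [LHS]exprMn [X in _ * X]exprMn Hb Hd sqrCi mulN1r -intrM -rmorphN.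
- by constructor 1.
by move=> [|[|[|]]] //; [constructor 2 | constructor 3 | constructor 4].
Qed.

Lemma finF_square1 a X : X \in finF -> galois_group_is (polyF a 1) (T8 X) ->
  [\/ is_sqr (2 + a), is_sqr (a - 2) | is_sqr (4 - a ^+ 2)].
Proof.
move=> XF [e [einj er He]]; have [d0|d0] := eqVneq (a ^+ 2 - 4 * 1) 0.
  by constructor 3; exists 0; lia.
pose r := e ord0; pose s := r^-1.
have rE := rootF_eq (er ord0); rewrite -/r in rE.
have r0 : r != 0.
  by apply: contra_eq_neq rE => ->; rewrite !expr0n mulr0 !add0r oner_eq0.
have rs1 : r * s = 1 by rewrite divff.
have sE : s ^+ 4 = - a%:~R - r ^+ 4.
  apply: (mulfI (expf_neq0 4 r0)); rewrite -exprMn rs1 expr1n; apply/eqP.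
  by rewrite -subr_eq0 -rE; apply/eqP; ring.
have [rs_add rs_mul] := second_root er sE.
have Hs := sqr_sum rs_add rs1; have Hd := sqr_diff rs_add rs1.
have Ci := sign_char_filter (P := fun p => (4 %| nth 0 p 0 + nth 0 p 4)%N) (sign_char_i rs_mul isT d0).
have Cs := sign_char_sum (r := r) (s := s); have Cd := sign_char_diff (r := r) (s := s).
have [] := small_squareF XF einj er He isT d0 (s := s)
  (zs := [:: ('i, -1); ('i * (r ^+ 2 - s ^+ 2), 2 + a); ('i * (r ^+ 2 + s ^+ 2), a - 2);
   ('i * ((r ^+ 2 + s ^+ 2) * (r ^+ 2 - s ^+ 2)), 4 - a ^+ 2)]) sE
   (ind9 rs_add rs1 d0) small_check9 erefl.
- move=> [|[|[|[|i]]]] isz; [split | split | split | split | by []].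
  + exact: Ci.
  + exact: sqrCi_int.
  + exact: sign_charM.
  + by rewrite [LHS]exprMn sqrCi Hd mulN1r -rmorphN /=; congr _%:~R; ring.
  + exact: sign_charM.
  + by rewrite [LHS]exprMn sqrCi Hs mulN1r -rmorphN /=; congr _%:~R; lia.
  + by apply: sign_charM => //; apply: sign_charM.
  by rewrite [LHS]exprMn [X in _ * X]exprMn sqrCi Hs Hd mulN1r -intrM -rmorphN /=; congr _%:~R; nia.
- by case=> k /=; nia.
by move=> [|[|[|]]] //; [constructor 1 | constructor 2 | constructor 3].
Qed.

Lemma finF_squareN1 a X : X \in finF -> galois_group_is (polyF a (-1)) (T8 X) ->
  let d := a ^+ 2 + 4 in is_sqr (2 * d).
Proof.
move=> XF [e [einj er He]] d; have d0 : a ^+ 2 - 4 * (-1) != 0 :> int by lia.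
have dE : a ^+ 2 - 4 * (-1) = d :> int by lia.
have b0 : (-1 : int) != 0 by [].
pose z : algC := sqrtC 'i; have z2 : z ^+ 2 = 'i by rewrite sqrtCK.
pose r := e ord0; pose s := z / r.
have rE := rootF_eq (er ord0); rewrite -/r in rE.
have r0 : r != 0.
  by apply: contra_eq_neq rE => ->; rewrite !expr0n mulr0 !add0r rmorphN oppr_eq0 oner_eq0.
have rs1 : r * s = z by rewrite mulrCA divff ?mulr1.
have sE : s ^+ 4 = - a%:~R - r ^+ 4.
  apply: (mulfI (expf_neq0 4 r0)); rewrite -exprMn rs1 (z4 z2); apply/eqP.
  by rewrite -subr_eq0 -rE; apply/eqP; rewrite rmorphN; ring.
have [rs_add rs_mul] := second_root er sE.
have Hind0 := indF rs_add rs_mul b0 d0.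
have Hi := sign_char_i rs_mul b0 d0.
have Hz u p : p \in DomF -> induces (rootsF r s) u p -> u z = z ^+ zt_prod p.
  move=> pD Hp; have [m8 n8 mn ur us] := charF_params pD Hp.
  rewrite -{1}rs1 rmorphM ur us /zt_prod exprD exprM z2 expr1 exprD -rs1.
  by move: mn; case: (_ < 4)%N (_ < 4)%N => [] [] //= _; ring.
have Hind := indz z2 Hind0 Hi Hz.
have C2 := sign_char_sqrt2 z2 Hz; have H2 := sqr_sqrt2 z2.
pose P p := (zt_prod p %% 4)%N == (if sgI p then 3 else 1)%N.
have Ci := sign_char_filter (P := P) Hi; have Cd := sign_char_filter (P := P) (sign_char_d (r := r) (s := s)).
have Hd := sqr_rs4 rs_add rs_mul; rewrite dE in Hd.
have [] := small_squareF XF einj er He b0 d0 (s := s)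
  (zs := [:: ('i, -1); (z - z ^+ 3, 2); ('i * (z - z ^+ 3), -2); ((r ^+ 4 - s ^+ 4) * (z - z ^+ 3), 2 * d);
   ('i * ((r ^+ 4 - s ^+ 4) * (z - z ^+ 3)), - (2 * d))]) sE
   Hind small_check_prod erefl.
- move=> [|[|[|[|[|i]]]]] isz; [split | split | split | split | split | by []].
  + exact: Ci.
  + exact: sqrCi_int.
  + exact: C2.
  + exact: H2.
  + exact: sign_charM.
  + by rewrite [LHS]exprMn sqrCi H2 mulN1r -rmorphN.
  + exact: sign_charM.
  + by rewrite [LHS]exprMn H2 Hd -intrM mulrC.
  + by apply: sign_charM => //; apply: sign_charM.
  by rewrite [LHS]exprMn [X in _ * X]exprMn sqrCi H2 Hd mulN1r -intrM -rmorphN mulrC.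
- by case=> k /=; nia.
by move=> [[k /nonsquare2] //|[[k /=]|[//|[[k /=]|//]]]]; nia.
Qed.

Lemma finF_square0 b X : X \in finF -> galois_group_is (polyF 0 b) (T8 X) ->
  [\/ is_sqr b, is_sqr (2 * b) | is_sqr (- (2 * b))].
Proof.
move=> XF [e [einj er He]]; have [b0|b0] := eqVneq b 0.
  by constructor 1; rewrite b0; apply: is_sqr0.
have d0 : 0 ^+ 2 - 4 * b != 0 :> int by lia.
pose z : algC := sqrtC 'i; have z2 : z ^+ 2 = 'i by rewrite sqrtCK.
pose r := e ord0; pose s := z * r.
have sE : s ^+ 4 = - (0 : int)%:~R - r ^+ 4 by rewrite exprMn (z4 z2); ring.
have [rs_add rs_mul] := second_root er sE.
have Hind0 := indF rs_add rs_mul b0 d0.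
have Hi := sign_char_i rs_mul b0 d0.
have Hz := aut_zeta8 z2 rs_add rs_mul b0.
have Hind := indz z2 Hind0 Hi Hz.
have C2 := sign_char_sqrt2 z2 Hz; have H2 := sqr_sqrt2 z2.
pose P p := (zt_quot p %% 4)%N == (if sgI p then 3 else 1)%N.
have Ci := sign_char_filter (P := P) Hi; have Cb := sign_char_filter (P := P) (sign_char_b (r := r) (s := s)).
have Hb := sqr_r2s2 rs_mul.
have [] := small_squareF XF einj er He b0 d0 (s := s)
  (zs := [:: (r ^+ 2 * s ^+ 2, b); (z - z ^+ 3, 2); ('i * (z - z ^+ 3), -2);
   (r ^+ 2 * s ^+ 2 * (z - z ^+ 3), 2 * b);
   ('i * (r ^+ 2 * s ^+ 2 * (z - z ^+ 3)), - (2 * b))]) sE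
   Hind small_check_quot erefl.
- move=> [|[|[|[|[|i]]]]] isz; [split | split | split | split | split | by []].
  + exact: Cb.
  + exact: Hb.
  + exact: C2.
  + exact: H2.
  + exact: sign_charM.
  + by rewrite [LHS]exprMn sqrCi H2 mulN1r -rmorphN.
  + exact: sign_charM.
  + by rewrite [LHS]exprMn H2 Hb -intrM mulrC.
  + by apply: sign_charM => //; apply: sign_charM.
  by rewrite [LHS]exprMn [X in _ * X]exprMn sqrCi H2 Hb mulN1r -intrM -rmorphN mulrC.
- by constructor 1.
move=> [[k /nonsquare2] //|[[k /=]|[|[|//]]]]; [nia | by constructor 2 | by constructor 3].
Qed.

Section RootG.
Variables (a b : int) (X : nat) (e : 'I_8 -> algC).
Hypotheses (XF : X \in [:: 2; 3; 4; 10]%N) (e_inj : injective e).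
Hypothesis e_root : forall i, root (polyZC (polyG a b)) (e i).
Hypothesis He : group_on e (T8 X).
Let x := e ord0.

Lemma second_rootG (y : algC) : y != 0 -> y ^+ 2 + y ^- 2 = - a%:~R - (x ^+ 2 + x ^- 2) ->
  [/\ x != 0, (x ^+ 2 + x ^- 2) + (y ^+ 2 + y ^- 2) = - a%:~R &
  (x ^+ 2 + x ^- 2) * (y ^+ 2 + y ^- 2) = b%:~R - 2].
Proof.
move=> y0 yE; have x0 := rootG_neq0 (e_root ord0); rewrite -/x in x0; rewrite yE; split=> //; first by ring.
have /rootP := e_root ord0; rewrite -/x /polyZC map_polyG !(hornerD, hornerM, hornerX, hornerC, hornerXn) => E.
apply: (mulfI (expf_neq0 4 x0)); apply/eqP; rewrite -subr_eq0 -oppr_eq0 -E; apply/eqP; field.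
by rewrite x0.
Qed.

Hypotheses (D0 : a ^+ 2 - 4 * b + 8 != 0) (P0 : b + 2 - 2 * a != 0) (Q0 : b + 2 + 2 * a != 0).

Lemma small_squareG y Dom chars (zs : seq (algC * int)) :
  y != 0 -> y ^+ 2 + y ^- 2 = - a%:~R - (x ^+ 2 + x ^- 2) ->
  (forall u, exists2 p, p \in Dom & induces (rootsG x y) u p) ->
  label_check Dom chars (cycles8 X) -> size chars = size zs ->
  (forall i, (i < size zs)%N ->
    sign_char (rootsG x y) Dom (nth (fun _ => false) chars i) (nth (0, 0) zs i).1 /\
    (nth (0, 0) zs i).1 ^+ 2 = (nth (0, 0) zs i).2%:~R) ->
  foldr (fun z P => is_sqr z.2 \/ P) False zs.
Proof.
move=> y0 yE Hind Hchk sz Hdata; apply: has_is_sqr; rewrite -sz.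
have [x0 w_add w_mul] := second_rootG y0 yE.
apply: (@small_group_square (rootsG x y) Dom e (cycles8 X) _ _ e_inj _ _ Hind _ chars) => //.
- exact: uniq_rootsG x0 y0 w_add w_mul D0 P0 Q0.
- by move=> i; have [k k8 ->] := rootsGP x0 y0 w_add w_mul D0 P0 Q0 (e_root i); rewrite mem_nth.
- by rewrite nth_rootsG // /klein /= expr0 mul1r.
- rewrite -T8_cycles //; move: XF; rewrite !inE.
  by do ![case/orP; [by move=> -> //; rewrite !orbT|]]; move=> ->; rewrite !orbT.
by rewrite sz.
Qed.

End RootG.

Lemma finG_square a b X (D := a ^+ 2 - 4 * b + 8) (P := b + 2 - 2 * a) (Q := b + 2 + 2 * a) :
  X \in [:: 2; 3; 10]%N -> galois_group_is (polyG a b) (T8 X) ->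
  [\/ is_sqr (P * Q), is_sqr (D * P), is_sqr (D * Q) | is_sqr (D * (P * Q))].
Proof.
move=> XF [e [einj er He]].
have [P0|P0] := eqVneq P 0; first by constructor 1; rewrite P0 mul0r; apply: is_sqr0.
have [Q0|Q0] := eqVneq Q 0; first by constructor 1; rewrite Q0 mulr0; apply: is_sqr0.
have [D0|D0] := eqVneq D 0; first by constructor 2; rewrite D0 mul0r; apply: is_sqr0.
pose x := e ord0; have [y y0 yE] := sqrDV_exist (- a%:~R - (x ^+ 2 + x ^- 2)).
have [x0 w_add w_mul] := second_rootG er y0 yE; rewrite -/x in x0 w_add w_mul.
have HD := sqr_wD w_add w_mul; have HP := sqr_uP x0 y0 w_add w_mul; have HQ := sqr_vQ x0 y0 w_add w_mul.
have CD := sign_charG_D (x := x) (y := y); have CP := sign_charG_P (x := x) (y := y).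
have CQ := sign_charG_Q (x := x) (y := y).
have CPQ := sign_charM CP CQ.
have XF' : X \in [:: 2; 3; 4; 10]%N by move: XF; rewrite !inE => /or3P [] ->; rewrite ?orbT.
have [] := small_squareG XF' einj er He D0 P0 Q0 (y := y)
  (zs := [:: ((x + x^-1) * (y + y^-1) * ((x - x^-1) * (y - y^-1)), P * Q);
    ((x ^+ 2 + x ^- 2 - (y ^+ 2 + y ^- 2)) * ((x + x^-1) * (y + y^-1)), D * P);
    ((x ^+ 2 + x ^- 2 - (y ^+ 2 + y ^- 2)) * ((x - x^-1) * (y - y^-1)), D * Q);
    ((x ^+ 2 + x ^- 2 - (y ^+ 2 + y ^- 2)) * ((x + x^-1) * (y + y^-1) * ((x - x^-1) * (y - y^-1))), D * (P * Q))])
   y0 yE (indG x0 y0 w_add w_mul D0 P0 Q0) (allP small_checkG X XF) erefl.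
- move=> [|[|[|[|i]]]] isz; [split | split | split | split | by []].
  + exact: CPQ.
  + by rewrite [LHS]exprMn HP HQ -intrM.
  + exact: sign_charM CD CP.
  + by rewrite [LHS]exprMn HD HP -intrM.
  + exact: sign_charM CD CQ.
  + by rewrite [LHS]exprMn HD HQ -intrM.
  + exact: sign_charM CD CPQ.
  by rewrite [LHS]exprMn [X in _ * X]exprMn HD HP HQ -!intrM.
- by constructor 1.
by move=> [|[|[|]]] //; [constructor 2 | constructor 3 | constructor 4].
Qed.

Lemma finG_square4 a b (P := b + 2 - 2 * a) (Q := b + 2 + 2 * a) :
  a ^+ 2 - 4 * b + 8 != 0 -> galois_group_is (polyG a b) (T8 4) ->
  [\/ is_sqr (P * Q), is_sqr P | is_sqr Q].
Proof.
move=> D0 [e [einj er He]].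
have [P0|P0] := eqVneq P 0; first by constructor 1; rewrite P0 mul0r; apply: is_sqr0.
have [Q0|Q0] := eqVneq Q 0; first by constructor 1; rewrite Q0 mulr0; apply: is_sqr0.
pose x := e ord0; have [y y0 yE] := sqrDV_exist (- a%:~R - (x ^+ 2 + x ^- 2)).
have [x0 w_add w_mul] := second_rootG er y0 yE; rewrite -/x in x0 w_add w_mul.
have HP := sqr_uP x0 y0 w_add w_mul; have HQ := sqr_vQ x0 y0 w_add w_mul.
have CP := sign_charG_P (x := x) (y := y); have CQ := sign_charG_Q (x := x) (y := y).
have [] := small_squareG (isT : 4%N \in [:: 2; 3; 4; 10]%N) einj er He D0 P0 Q0 (y := y)
  (zs := [:: ((x + x^-1) * (y + y^-1) * ((x - x^-1) * (y - y^-1)), P * Q);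
    ((x + x^-1) * (y + y^-1), P); ((x - x^-1) * (y - y^-1), Q)])
   y0 yE (indG x0 y0 w_add w_mul D0 P0 Q0) small_checkG4 erefl.
- move=> [|[|[|i]]] isz; [split | split | split | by []].
  + exact: sign_charM CP CQ.
  + by rewrite [LHS]exprMn HP HQ -intrM.
  + exact: CP.
  + exact: HP.
  + exact: CQ.
  exact: HQ.
- by constructor 1.
by move=> [|[|]] //; [constructor 2 | constructor 3].
Qed.

Lemma finG_squareP a b (Q := b + 2 + 2 * a) : a ^+ 2 - 4 * b + 8 != 0 -> Q != 0 ->
  b + 2 - 2 * a = 1 -> galois_group_is (polyG a b) (T8 4) ->
  is_sqr ((6 - a) * Q) \/ is_sqr ((2 - a) * Q).
Proof.
move=> D0 Q0 P1 [e [einj er He]]; have P0 : b + 2 - 2 * a != 0 by rewrite P1.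
pose x := e ord0.
have [z z0 zE] := sqrDV_exist (- a%:~R - (x ^+ 2 + x ^- 2)).
have [x0 w_add w_mul] := second_rootG er z0 zE; rewrite -/x in x0 w_add w_mul.
have := sqr_uP x0 z0 w_add w_mul; rewrite P1 => /(odd_choice oddDV z0) [y [y0 yE yP]].
rewrite -yE in w_add w_mul; rewrite zE in yE.
have HQ := sqr_vQ x0 y0 w_add w_mul; have [Hs Hd] := sqr_usum x0 y0 w_add yP.
have CQ := sign_char_filter (P := fun p => ~~ sgP p) (sign_charG_Q (x := x) (y := y)).
have Cs := sign_char_usum (x := x) (y := y); have Cd := sign_char_udiff (x := x) (y := y).
have [] := small_squareG (isT : 4%N \in [:: 2; 3; 4; 10]%N) einj er He D0 P0 Q0 (y := y)
  (zs := [:: ((x + x^-1 + (y + y^-1)) * ((x - x^-1) * (y - y^-1)), (6 - a) * Q);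
    ((x + x^-1 - (y + y^-1)) * ((x - x^-1) * (y - y^-1)), (2 - a) * Q)])
   y0 yE (indP x0 y0 w_add w_mul D0 P0 Q0 yP) small_checkP erefl.
- move=> [|[|i]] isz; [split | split | by []].
  + exact: sign_charM Cs CQ.
  + by rewrite [LHS]exprMn Hs HQ -intrM.
  + exact: sign_charM Cd CQ.
  by rewrite [LHS]exprMn Hd HQ -intrM.
- by left.
by case=> //; right.
Qed.

Lemma finG_squareQ a b (P := b + 2 - 2 * a) : a ^+ 2 - 4 * b + 8 != 0 -> P != 0 ->
  b + 2 + 2 * a = 1 -> galois_group_is (polyG a b) (T8 4) ->
  is_sqr ((- 2 - a) * P) \/ is_sqr ((- 6 - a) * P).
Proof.
move=> D0 P0 Q1 [e [einj er He]]; have Q0 : b + 2 + 2 * a != 0 by rewrite Q1.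
pose x := e ord0.
have [z z0 zE] := sqrDV_exist (- a%:~R - (x ^+ 2 + x ^- 2)).
have [x0 w_add w_mul] := second_rootG er z0 zE; rewrite -/x in x0 w_add w_mul.
have := sqr_vQ x0 z0 w_add w_mul; rewrite Q1 => /(odd_choice oddBV z0) [y [y0 yE yP]].
rewrite -yE in w_add w_mul; rewrite zE in yE.
have HP := sqr_uP x0 y0 w_add w_mul; have [Hs Hd] := sqr_vsum x0 y0 w_add yP.
have CP := sign_char_filter (P := fun p => ~~ sgQ p) (sign_charG_P (x := x) (y := y)).
have Cs := sign_char_vsum (x := x) (y := y); have Cd := sign_char_vdiff (x := x) (y := y).
have [] := small_squareG (isT : 4%N \in [:: 2; 3; 4; 10]%N) einj er He D0 P0 Q0 (y := y)
  (zs := [:: ((x - x^-1 + (y - y^-1)) * ((x + x^-1) * (y + y^-1)), (- 2 - a) * P);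
    ((x - x^-1 - (y - y^-1)) * ((x + x^-1) * (y + y^-1)), (- 6 - a) * P)])
   y0 yE (indQ x0 y0 w_add w_mul D0 P0 Q0 yP) small_checkQ erefl.
- move=> [|[|i]] isz; [split | split | by []].
  + exact: sign_charM Cs CP.
  + by rewrite [LHS]exprMn Hs HP -intrM.
  + exact: sign_charM Cd CP.
  by rewrite [LHS]exprMn Hd HP -intrM.
- by left.
by case=> //; right.
Qed.

(** * Finiteness *)

Lemma Aint_sqrt (z : algC) : z ^+ 2 \in Aint -> z \in Aint.
Proof.
move=> zA; pose p := minCpoly (z ^+ 2).
apply: (@root_monic_Aint (p \Po 'X^2)).
- by rewrite /root horner_comp hornerXn; apply: root_minCpoly.
- by rewrite monicE lead_coef_comp ?size_polyXn // lead_coefXn expr1n mulr1 -monicE minCpoly_monic.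
by rewrite polyOver_comp ?rpredX ?polyOverX.
Qed.

(** The square of [g(theta) / c] is [h(theta)], so [g(theta) / c] is integral and must have integral
    coordinates. *)
Lemma monogenic_square_bound (f g q h : {poly int}) (c : int) : monogenic f -> (1 < size f)%N ->
  (size g < size f)%N -> g ^+ 2 = f * q + (c ^+ 2)%:P * h -> forall i, (c %| g`_i)%Z.
Proof.
move=> mf sf sg gE i.
have [t ft] : exists t, root (polyZC f) t.
  apply/closed_rootP; rewrite /polyZC size_map_inj_poly ?rmorph0 //; last exact: intr_inj.
  by rewrite neq_ltn sf orbT.
(* For [c = 0] the claim is that [g] vanishes: [g(theta) = 0] can be divided by a number exceeding
   any chosen coefficient. *)
have [c0|c0] := eqVneq c 0.
  have : g ^+ 2 = f * q by rewrite gE c0 expr0n mul0r addr0.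
  move=> E; have : (map_poly intr g : {poly algC}).[t] / (`|(g`_i)%R|%N.+1)%:R \in Aint.
    have : (map_poly intr g : {poly algC}).[t] ^+ 2 = 0.
      by rewrite -horner_exp -rmorphXn E rmorphM hornerM (rootP ft) mul0r.
    by move=> /eqP; rewrite expf_eq0 /= => /eqP ->; rewrite mul0r rpred0.
  move=> gA; have := monogenic_dvd_coef mf ft (ltn0Sn _) sg gA i.
  rewrite c0 dvd0z dvdzE absz_nat => H; rewrite -absz_eq0.
  by apply: contraTT H => g0; rewrite gtnNdvd // lt0n.
have : (map_poly intr g : {poly algC}).[t] / `|c|%N%:R \in Aint.
  apply: Aint_sqrt; rewrite expr_div_n -evX gE evD !evM evC.
  rewrite (rootP ft) mul0r add0r.
  have -> : (`|c|%N%:R : algC) ^+ 2 = (c ^+ 2)%:~R.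
    by rewrite natr_absz -rmorphXn /= real_normK ?num_real.
  rewrite mulrAC divff ?mul1r ?intr_eq0 ?expf_neq0 //; by apply: ev_Aint ft _; case: mf.
move=> gA; have n0 : (0 < `|c|)%N by rewrite lt0n absz_eq0.
by have := monogenic_dvd_coef mf ft n0 sg gA i; rewrite !dvdzE absz_nat.
Qed.

(** The cases are [m = 1], squarefree, and [m = 2], for [d] and [D], whose test elements have
    leading coefficient 2. It also excludes [N = 0]. *)
Definition sqf_le (m N : int) := forall c k : int, N = c ^+ 2 * k -> - m <= c <= m.

Lemma dvdz1_le (c : int) : (c %| 1)%Z -> - 1 <= c <= 1.
Proof. by rewrite dvdzE /= dvdn1 => /eqP; lia. Qed.

Lemma dvdz2_le (c : int) : (c %| 2)%Z -> - 2 <= c <= 2.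
Proof. by rewrite dvdzE => /dvdn_leq; rewrite /= => /(_ isT); lia. Qed.

(** The test elements satisfy [(X^6 + a X^2)^2 = (f - b) (X^4 + a)] and
    [(2 X^4 + a)^2 = 4 f + d]. *)
Lemma monogenicF_sqf a b : monogenic (polyF a b) -> sqf_le 1 b /\ sqf_le 2 (a ^+ 2 - 4 * b).
Proof.
move=> mf; have [_ sf] := monic_size_polyF a b.
split=> c k E.
  have [gm gs] : 'X^6 + a%:P * 'X^2 \is monic /\ size ('X^6 + a%:P * 'X^2) = 7%N.
    by apply: monic_size_Xn; apply: size_CXn.
  have := @monogenic_square_bound _ ('X^6 + a%:P * 'X^2) ('X^4 + a%:P) (- k%:P * ('X^4 + a%:P)) c mf.
  rewrite sf gs => H; have {H} := H isT isT _ 6.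
  have -> : ('X^6 + a%:P * 'X^2)`_6 = 1 by rewrite coefD coefXn coefCM coefXn mulr0 addr0.
  move=> H; apply: dvdz1_le; apply: H; rewrite // /polyF E polyCM; ring.
have gs : (size (2%:P * 'X^4 + a%:P)%R <= 5)%N.
  by rewrite (leq_trans (size_polyD _ _)) // geq_max size_CXn // (leq_trans (size_polyC_leq1 _)).
have := @monogenic_square_bound _ (2%:P * 'X^4 + a%:P) 4%:P k%:P c mf.
rewrite sf => H; have {H} := H isT (leq_ltn_trans gs _) _ 4.
have -> : (2%:P * 'X^4 + a%:P)`_4 = 2 by rewrite coefD coefCM coefXn coefC mulr1 addr0.
move=> H; apply: dvdz2_le; apply: H => //.
have -> : (c ^+ 2)%:P * k%:P = (a ^+ 2 - 4 * b)%:P by rewrite -polyCM -E.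
by rewrite /polyF rmorphB rmorphXn /= four_int !polyCM; ring.
Qed.

(** From [f = (X^2 + 1)^2 h2 + P X^4] the element [(X^2 + 1) h2] has square [(f - P X^4) h2], and
    likewise for [Q] with [X^2 - 1]; for [D] the identity is
    [(2 X^4 + a X^2 + 2)^2 = 4 f + D X^4]. *)
Lemma monogenicG_sqf a b : monogenic (polyG a b) ->
  [/\ sqf_le 1 (b + 2 - 2 * a), sqf_le 1 (b + 2 + 2 * a) & sqf_le 2 (a ^+ 2 - 4 * b + 8)].
Proof.
move=> mf; have [_ sf] := monic_size_polyG a b.
have quad (u v : int) : [/\ (u%:P * 'X^4 + v%:P * 'X^2 + 'X^6)`_6 = 1 &
   (size (u%:P * 'X^4 + v%:P * 'X^2 + 'X^6)%R <= 7)%N].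
  rewrite !coefD !coefCM !coefXn !mulr0 !add0r; split=> //.
  rewrite (leq_trans (size_polyD _ _)) // geq_max size_polyXn andbT.
  by rewrite (leq_trans (size_polyD _ _)) // geq_max !size_CXn.
split=> c k E.
- pose h2 : {poly int} := 'X^4 + (a - 2)%:P * 'X^2 + 1; pose g := ('X^2 + 1) * h2.
  have [] : g`_6 = 1 /\ (size g <= 7)%N.
    have -> : g = (a - 1)%:P * 'X^4 + (a - 1)%:P * 'X^2 + 'X^6 + 1%:P.
      by rewrite /g /h2 !rmorphB /= -[2]/(1 + 1) rmorphD /=; ring.
    have [q1 q2] := quad (a - 1) (a - 1); split; first by rewrite coefD q1 coefC addr0.
    by rewrite (leq_trans (size_polyD _ _)) // geq_max q2 (leq_trans (size_polyC_leq1 _)).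
  move=> g6 gs; have := @monogenic_square_bound _ g h2 (- k%:P * 'X^4 * h2) c mf.
  rewrite sf => H; have {H} := H isT (leq_ltn_trans gs _) _ 6; rewrite g6 => H.
  apply: dvdz1_le; apply: H => //.
  have -> : (c ^+ 2)%:P * (- k%:P * 'X^4 * h2) = - (b + 2 - 2 * a)%:P * 'X^4 * h2.
    by rewrite E polyCM; ring.
  by rewrite /polyG /g /h2 !(rmorphB, rmorphD, rmorphM) /=; ring.
- pose h2 : {poly int} := 'X^4 + (a + 2)%:P * 'X^2 + 1; pose g := ('X^2 - 1) * h2.
  have [] : g`_6 = 1 /\ (size g <= 7)%N.
    have -> : g = (a + 1)%:P * 'X^4 + (- a - 1)%:P * 'X^2 + 'X^6 + (-1)%:P.
      by rewrite /g /h2 !(rmorphB, rmorphN, rmorphD) /=; ring.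
    have [q1 q2] := quad (a + 1) (- a - 1); split; first by rewrite coefD q1 coefC addr0.
    by rewrite (leq_trans (size_polyD _ _)) // geq_max q2 (leq_trans (size_polyC_leq1 _)).
  move=> g6 gs; have := @monogenic_square_bound _ g h2 (- k%:P * 'X^4 * h2) c mf.
  rewrite sf => H; have {H} := H isT (leq_ltn_trans gs _) _ 6; rewrite g6 => H.
  apply: dvdz1_le; apply: H => //.
  have -> : (c ^+ 2)%:P * (- k%:P * 'X^4 * h2) = - (b + 2 + 2 * a)%:P * 'X^4 * h2.
    by rewrite E polyCM; ring.
  by rewrite /polyG /g /h2 !(rmorphB, rmorphD, rmorphM) /=; ring.
pose g : {poly int} := 2%:P * 'X^4 + a%:P * 'X^2 + 2%:P.
have [] : g`_4 = 2 /\ (size g <= 5)%N.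
  split; first by rewrite !coefD !coefCM !coefXn coefC mulr0 mulr1 !addr0.
  rewrite (leq_trans (size_polyD _ _)) // geq_max (leq_trans (size_polyC_leq1 _)) ?andbT //.
  by rewrite (leq_trans (size_polyD _ _)) // geq_max !size_CXn.
move=> g4 gs; have := @monogenic_square_bound _ g 4%:P (k%:P * 'X^4) c mf.
rewrite sf => H; have {H} := H isT (leq_ltn_trans gs _) _ 4; rewrite g4 => H.
apply: dvdz2_le; apply: H => //.
rewrite mulrA -polyCM -E /polyG /g !(rmorphB, rmorphD, rmorphM, rmorphXn) /=.
ring.
Qed.

Lemma finitely_many_of_bound adm P H (B : int) :
  (forall a b : int, adm a b -> monogenic (P a b) -> galois_group_is (P a b) H -> `|a| <= B /\ `|b| <= B) ->
  finitely_many adm P H.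
Proof.
move=> HB; pose s : seq int := [seq i%:Z - B | i <- iota 0 `|(2 * B + 1)%R|].
have sP (z : int) : `|z| <= B -> z \in s.
  move=> zB; apply/mapP; exists `|(z + B)%R|%N; last by lia.
  by rewrite mem_iota; lia.
exists [seq (x, y) | x <- s, y <- s] => a b h1 h2 h3; have [aB bB] := HB a b h1 h2 h3.
by apply/allpairsP; exists (a, b); split; rewrite // sP.
Qed.

Lemma sqf_le_neq0 m N : 0 <= m -> sqf_le m N -> N != 0.
Proof.
move=> m0 sN; apply/eqP => N0; have := sN (m + 1) 0; rewrite mulr0 => /(_ N0); lia.
Qed.

Lemma coprime_split (N k : int) : N != 0 ->
  exists g n l, [/\ N = n * g, k = l * g & coprimez n l].
Proof.
move=> N0; have [n nE] := dvdzP (dvdz_gcdl N k); have [l lE] := dvdzP (dvdz_gcdr N k).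
exists (gcdz N k), n, l; split=> //.
have g0 : gcdz N k != 0 by rewrite gcdz_eq0 negb_and N0.
have : gcdz n l * gcdz N k = gcdz N k by have := mulz_gcdl n l (gcdz N k); rewrite -nE -lE.
by rewrite -[X in _ = X]mul1r => /(mulIf g0) gE; rewrite /coprimez gE.
Qed.

Lemma sqf_dvd (N M k : int) : sqf_le 1 N -> N * M = k ^+ 2 -> exists j, M = N * j ^+ 2.
Proof.
move=> sN E; have N0 := @sqf_le_neq0 1 N isT sN.
have [g [n [l [nE lE cnl]]]] := coprime_split k N0.
have g0 : g != 0 by apply: contraNneq N0 => g0; rewrite nE g0 mulr0.
have E1 : n * M = g * l ^+ 2.
  by apply: (mulfI g0); rewrite mulrA [g * n]mulrC -nE E lE; ring.
have /dvdzP [t tE] : (n %| g)%Z.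
  rewrite -(Gauss_dvdzl _ (_ : coprimez n (l ^+ 2))) ?coprimezXr //.
  by rewrite -E1 dvdz_mulr.
have n1 : - 1 <= n <= 1 by apply: (sN n t); rewrite nE tE; ring.
have n2 : n ^+ 2 = 1.
  have n0 : n != 0 by apply: contraNneq N0 => n0; rewrite nE n0 mul0r.
  have n11 : n = 1 \/ n = -1 by lia.
  by case: n11 => ->.
exists l; have -> : M = n ^+ 2 * M by rewrite n2 mul1r.
by rewrite nE expr2 -!mulrA E1; ring.
Qed.

Lemma sqf_sqr N : sqf_le 1 N -> is_sqr N -> N = 1.
Proof.
move=> sN [k kE]; have N0 := @sqf_le_neq0 1 N isT sN.
have k1 : - 1 <= k <= 1 by apply: (sN k 1); rewrite mulr1.
have k0 : k != 0 by apply: contraNneq N0 => k0; rewrite kE k0.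
have k11 : k = 1 \/ k = -1 by lia.
by case: k11 kE => ->.
Qed.

Lemma mul_sqr_le (x y N : int) : x * y ^+ 2 = N -> N != 0 -> `|x| <= `|N|.
Proof.
move=> <- N0; rewrite normrM ler_peMr // -[1]/(1%:Z) -gtz0_ge1 normr_gt0.
by apply: contraNneq N0 => ->; rewrite mulr0.
Qed.

Lemma norm_sqr_le (x : int) n : 0 <= n -> x ^+ 2 <= n ^+ 2 -> `|x| <= n.
Proof. by move=> n0; rewrite -[x ^+ 2]real_normK ?num_real // ler_sqr ?nnegrE. Qed.

(* [d * b] is a square and [d] is almost squarefree, hence [d = b * j ^+ 2] with [`|j| <= 2]. *)
Lemma sqf_quotient (b d e : int) : sqf_le 1 b -> sqf_le 2 d -> e ^+ 2 = d + 4 * b -> is_sqr (d * b) ->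
  `|b| <= 8 /\ `|e| <= 8.
Proof.
move=> sb sd eE [k]; rewrite mulrC => /(sqf_dvd sb) [j dE].
have j2 : - 2 <= j <= 2 by apply: (sd j b); rewrite dE mulrC.
have [t tE] : exists t, j ^+ 2 + 4 = b * t ^+ 2.
  by apply: (@sqf_dvd _ _ e sb); rewrite eE dE; ring.
have jE : j ^+ 2 <= 4 by nia.
have b8 : `|b| <= 8.
  have := @mul_sqr_le b t (j ^+ 2 + 4) (esym tE); nia.
split=> //; apply: norm_sqr_le => //; rewrite eE dE; nia.
Qed.

Lemma finite_F X : X \in finF -> finitely_many admF polyF (T8 X).
Proof.
move=> XF; apply: (@finitely_many_of_bound _ _ _ 8) => a b _ mf gal.
have [sb sd] := monogenicF_sqf mf; have b0 := @sqf_le_neq0 1 b isT sb.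
have sqr_bound (c k : int) : a ^+ 2 - 4 * b = k ^+ 2 * c -> - 2 <= k <= 2 := @sd k c.
have [/(sqf_sqr sb) b1|[k bk]|db|[k dbk]] := finF_square XF gal.
- subst b; split=> //; have [[k kE]|[k kE]|[k kE]] := finF_square1 XF gal.
  + have k2 : - 2 <= k <= 2 by apply: (@sd k (a - 2)); rewrite -kE; ring.
    have : k ^+ 2 <= 4 by nia.
    by rewrite -kE; have := sqr_ge0 k; rewrite -kE; lia.
  + have k2 : - 2 <= k <= 2 by apply: (@sd k (a + 2)); rewrite -kE; ring.
    have : k ^+ 2 <= 4 by nia.
    by rewrite -kE; have := sqr_ge0 k; rewrite -kE; lia.
  apply: norm_sqr_le => //; have := sqr_ge0 k; rewrite -kE; lia.
- have k1 : - 1 <= k <= 1 by apply: (sb k (-1)); rewrite -bk; ring.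
  have k3 : k = 0 \/ k = 1 \/ k = -1 by lia.
  have b1 : b = - 1 by case: k3 bk => [|[|]] ->; move: b0; clear; lia.
  subst b; split=> //; have [j jE] := finF_squareN1 XF gal.
  have [i iE] : exists i, j = 2 * i.
    have : (2 %| j ^+ 2)%Z by rewrite -jE dvdz_mulr.
    by rewrite expr2 Euclid_dvdz // orbb => /dvdzP [i ->]; exists i; rewrite mulrC.
  have i2 : - 2 <= i <= 2 by apply: (@sd i 2); move: jE; rewrite iE; nia.
  by apply: norm_sqr_le => //; move: jE; rewrite iE; nia.
- have aE : a ^+ 2 = a ^+ 2 - 4 * b + 4 * b by ring.
  by have [] := sqf_quotient sb sd aE db.
have [j jE] : exists j, - (a ^+ 2 - 4 * b) = b * j ^+ 2.
  by apply: (@sqf_dvd _ _ k sb); rewrite -dbk; ring.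
have j2 : - 2 <= j <= 2 by apply: (sd j (- b)); lia.
have aE : b * (4 - j ^+ 2) = a ^+ 2 by lia.
have [t tE] := sqf_dvd sb aE.
(* From [a^2 = b (4 - j^2)]: either [a = 0], where the second round is required, or [b] divides the
   bounded nonzero number [4 - j^2]. *)
have [j4|j4] := eqVneq (4 - j ^+ 2) 0.
  have a0 : a = 0 by apply/eqP; rewrite -sqrf_eq0 -aE j4 mulr0.
  subst a; split=> //; have [/(sqf_sqr sb) -> //|[i iE]|[i iE]] := finF_square0 XF gal.
    have [|u uE] := @sqf_dvd b 2 i sb; first by rewrite mulrC.
    have := @mul_sqr_le b u 2 (esym uE) isT; lia.
  have [|u uE] := @sqf_dvd b (-2) i sb; first by rewrite -iE; ring.
  have := @mul_sqr_le b u (-2) (esym uE) isT; lia.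
have b4 := @mul_sqr_le b t _ (esym tE) j4.
have jj : 0 <= j ^+ 2 <= 4 by nia.
split; last by lia.
by apply: norm_sqr_le => //; rewrite -aE; nia.
Qed.

Lemma norm_mul_ge (x y : int) : y != 0 -> `|x| <= `|x * y|.
Proof. by move=> y0; rewrite normrM ler_peMr // -[1]/(1%:Z) -gtz0_ge1 normr_gt0. Qed.

(** Multiplied by [p], the last equation reads [K (e c - u) = 8 (e^2 + u)] with [K = p (c - e)]. As
    [|e c| >= e^2], [K] is bounded for large [e], and so is [c - e]; it remains to bound [e]. *)
Lemma bounded_half (u m c e p : int) : 1 <= u <= 4 -> e ^+ 2 + u = p * m ->
  8 * m = (c - e) * (e * c - u) -> `|e| <= `|c| -> `|c| <= 107.
Proof.
move=> u4 mE E ec; have pm0 : p * m != 0 by rewrite -mE; have := sqr_ge0 e; lia.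
have [p0 m0] : p != 0 /\ m != 0 by apply/andP; rewrite -negb_or -mulf_eq0.
have mlt : `|m| <= `|e ^+ 2 + u| by rewrite mE mulrC norm_mul_ge.
have d0 : e * c - u != 0 by apply: contraNneq m0 => d0; move: E; rewrite d0 mulr0; lia.
(* For small [e] one has [|c - e| <= 8 (9 + 4) = 104], whence the constant 107; the other case gives
   less. *)
have [e3|e4] := lerP `|e| 3.
  have e9 : e ^+ 2 <= 9 by nia.
  have := norm_mul_ge (c - e) d0; rewrite -E; have := sqr_ge0 e; lia.
have e16 : 16 <= e ^+ 2 by nia.
have ecge : `|e * c| >= e ^+ 2 by rewrite -[e ^+ 2]real_normK ?num_real // expr2 normrM ler_wpM2l.
have KE : (p * (c - e)) * (e * c - u) = 8 * (e ^+ 2 + u) by rewrite mE -mulrA -E; ring.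
pose K := p * (c - e); rewrite -/K in KE.
have K13 : `|K| <= 13.
  rewrite leNgt; apply/negP => K14.
  have : `|K| * `|e * c - u| = 8 * (e ^+ 2 + u) by rewrite -normrM KE; lia.
  have : 14 * `|e * c - u| <= `|K| * `|e * c - u| by apply: ler_wpM2r; [apply: normr_ge0 | move: K14; clear; lia].
  by move: ecge u4 e16; clear; lia.
have d13 : `|c - e| <= 13 by apply: le_trans K13; rewrite /K mulrC norm_mul_ge.
(* This is [K c - 8 e], so that [e s = (K + 8) u] is bounded; if [s = 0], then [K = -8] and
   [c = - e], and the bound on [c - e] concludes. *)
pose s := (K - 8) * e + K * (c - e).
have sE : e * s = (K + 8) * u.
  rewrite /s; have -> : (K + 8) * u = K * (e * c) - (K * (e * c - u) - 8 * u) by ring.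
  by rewrite KE; ring.
have [s0|s0] := eqVneq s 0.
  have K8 : K = - 8.
    by move/eqP: sE; rewrite s0 mulr0 eq_sym mulf_eq0 => /orP [/eqP|/eqP]; lia.
  by move: s0; rewrite /s K8; lia.
have := norm_mul_ge e s0; rewrite sE => es.
have : `|(K + 8) * u| <= 84.
  rewrite normrM (le_trans (_ : _ <= 21 * `|u|)) //; last by move: u4; clear; lia.
  by apply: ler_wpM2r; [apply: normr_ge0 | move: K13; clear; lia].
by move: es d13; clear; lia.
Qed.

Lemma bounded_pair (u m c e p q : int) : 1 <= u <= 4 -> e ^+ 2 + u = p * m -> c ^+ 2 + u = q * m ->
  8 * m = (c - e) * (e * c - u) -> `|c| <= 107 /\ `|e| <= 107.
Proof.
move=> u4 pE qE E; have [ec|ce] := lerP `|e| `|c|.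
  by have := bounded_half u4 pE E ec; lia.
have E' : 8 * (- m) = (e - c) * (c * e - u) by rewrite mulrN E; ring.
have qE' : c ^+ 2 + u = (- q) * (- m) by rewrite qE; ring.
by have := bounded_half u4 qE' E' (ltW ce); lia.
Qed.

Lemma sqf_le_dvd m N M k : sqf_le m N -> N = M * k -> sqf_le m M.
Proof. by move=> sN E c l lE; apply: (sN c (l * k)); rewrite E lE mulrA. Qed.

Lemma sqf_dvd_sqr N M e : sqf_le 1 N -> e ^+ 2 = N * M -> exists c, e = N * c /\ M = N * c ^+ 2.
Proof.
move=> sN E; have [c cE] := sqf_dvd sN (esym E); have N0 := @sqf_le_neq0 1 N isT sN.
have : e ^+ 2 == (N * c) ^+ 2 by rewrite E cE; apply/eqP; ring.
by rewrite eqf_sqr => /orP [] /eqP ->; [exists c | exists (- c)]; split; rewrite ?sqrrN // mulrN.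
Qed.

(** With [P = p g] and [Q = q g], [p] and [q] coprime, squarefreeness forces [D = p q u] with [u]
    equal to 1 or 4. The equations [(a - 4)^2 = D + 4 P] and [(a + 4)^2 = D + 4 Q] then lead to the
    system of [bounded_pair]. *)
Lemma bounded_product : exists B : int, forall a D P Q : int,
  sqf_le 1 P -> sqf_le 1 Q -> sqf_le 2 D ->
  D = (a - 4) ^+ 2 - 4 * P -> Q = P + 4 * a -> is_sqr (D * (P * Q)) -> `|a| <= B /\ `|P| <= B.
Proof.
(* Only these two inequalities on [M] enter the estimates; [p] and [q] will divide nonzero numbers
   of size at most [107^2 + 4]. *)
have [M [M107 M4]] : exists M : int, 107 <= M /\ 107 ^+ 2 + 4 <= M by exists (107 ^+ 2 + 4).
exists (2 * M ^+ 3) => a D P Q sP sQ sD DE QE [k kE].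
have P0 := @sqf_le_neq0 1 P isT sP; have D0 := @sqf_le_neq0 2 D isT sD.
have [g [p [q [PE QE' cpq]]]] := coprime_split Q P0.
have g0 : g != 0 by apply: contraNneq P0 => g0; rewrite PE g0 mulr0.
have sp : sqf_le 1 p by apply: sqf_le_dvd sP PE.
have sq : sqf_le 1 q by apply: sqf_le_dvd sQ QE'.
have p0 := @sqf_le_neq0 1 p isT sp; have q0 := @sqf_le_neq0 1 q isT sq.
have [l lE] : exists l, p * (q * D) = l ^+ 2.
  have : (g %| k)%Z.
    have : (g ^+ 2 %| k ^+ 2)%Z by apply/dvdzP; exists (p * (q * D)); rewrite -kE PE QE'; ring.
    by rewrite dvdz_pexp2r.
  move=> /dvdzP [l lE]; exists l; apply: (mulfI (expf_neq0 2 g0)).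
  by rewrite [RHS]mulrC -exprMn -lE -kE PE QE'; ring.
have [t tE] := sqf_dvd sp lE.
have /dvdzP [D1 D1E] : (p %| D)%Z by rewrite -(Gauss_dvdzr _ cpq) tE dvdz_mulr.
have [j jE] : exists j, D1 = q * j ^+ 2.
  apply: (@sqf_dvd _ _ t sq); apply: (mulfI p0); rewrite -tE D1E; ring.
have {D1E} DE' : D = p * q * j ^+ 2 by rewrite D1E jE; ring.
have j2 : - 2 <= j <= 2 by apply: (sD j (p * q)); rewrite DE'; ring.
have j0 : j != 0 by apply: contraNneq D0 => j0; rewrite DE' j0 expr0n mulr0.
pose u := j ^+ 2; have u4 : 1 <= u <= 4 by rewrite /u; move: j2 j0; clear; nia.
rewrite -/u in DE'.
have [c [cE cE']] : exists c, a - 4 = p * c /\ q * u + 4 * g = p * c ^+ 2.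
  apply: sqf_dvd_sqr => //; have -> : (a - 4) ^+ 2 = D + 4 * P by rewrite DE; ring.
  by rewrite DE' PE; ring.
have [e [eE eE']] : exists e, a + 4 = q * e /\ p * u + 4 * g = q * e ^+ 2.
  apply: sqf_dvd_sqr => //; have -> : (a + 4) ^+ 2 = D + 4 * Q by rewrite DE QE; ring.
  by rewrite DE' QE'; ring.
(* Both sides equal [(p + q) u + 4 g]; by coprimality this gives the common cofactor [m]. *)
have pq : p * (c ^+ 2 + u) = q * (e ^+ 2 + u) by rewrite !mulrDr -cE' -eE'; ring.
have /dvdzP [m mE] : (q %| c ^+ 2 + u)%Z.
  by rewrite -(Gauss_dvdzr _ (_ : coprimez q p)) ?pq ?dvdz_mulr // coprimez_sym.
have mE' : e ^+ 2 + u = p * m by apply: (mulfI q0); rewrite -pq mE; ring.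
rewrite mulrC in mE.
(* The 8 is [(a + 4) - (a - 4) = q e - p c]. *)
have m8 : 8 * m = (c - e) * (e * c - u).
  have -> : 8 * m = (q * e - p * c) * m by rewrite -eE -cE; ring.
  have -> : (q * e - p * c) * m = (q * m) * e - (p * m) * c by ring.
  by rewrite -mE -mE'; ring.
have [c107 e107] := bounded_pair u4 mE' mE m8.
have m0 : m != 0.
  by apply/eqP => m0; move: mE; rewrite m0 mulr0; have := sqr_ge0 c; move: u4; clear; lia.
have sq107 (x : int) : `|x| <= 107 -> `|x ^+ 2 + u| <= 107 ^+ 2 + 4.
  move=> x107; have : x ^+ 2 <= 107 ^+ 2.
    by rewrite -[x ^+ 2]real_normK ?num_real // ler_sqr ?nnegrE.
  by have := sqr_ge0 x; move: u4; clear; lia.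
have cM : `|c| <= M by apply: le_trans M107.
have pM : `|p| <= M by rewrite (le_trans _ M4) // (le_trans (norm_mul_ge p m0)) // -mE' sq107.
have qM : `|q| <= M by rewrite (le_trans _ M4) // (le_trans (norm_mul_ge q m0)) // -mE sq107.
have c2M : `|c ^+ 2| <= M by have := sq107 c c107; have := sqr_ge0 c; move: M4 u4; clear; lia.
have M2 : 107 * M <= M ^+ 2 by rewrite expr2 ler_wpM2r // (le_trans _ M107).
have M3 : M ^+ 2 <= M ^+ 3 by rewrite ler_weXn2l // (le_trans _ M107).
have gM : `|g| <= 2 * M ^+ 2.
  have : `|q * u| <= M * 4 by rewrite normrM ler_pM // ger0_norm; move: u4; clear; lia.
  have : `|p * c ^+ 2| <= M * M by rewrite normrM ler_pM.
  by rewrite -cE' -expr2; move: M2 M107; clear; lia.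
split.
  have : `|p * c| <= M * M by rewrite normrM ler_pM.
  by rewrite -cE -expr2; move: M2 M3 M107; clear; lia.
have -> : 2 * M ^+ 3 = M * (2 * M ^+ 2) by ring.
by rewrite PE normrM ler_pM.
Qed.

Lemma sqf_mul_sqr P Q : sqf_le 1 P -> sqf_le 1 Q -> is_sqr (P * Q) -> Q = P.
Proof.
move=> sP sQ [k /(sqf_dvd sP) [j jE]]; have Q0 := @sqf_le_neq0 1 Q isT sQ.
have j1 : - 1 <= j <= 1 by apply: (sQ j P); rewrite jE mulrC.
have j3 : j = 0 \/ j = 1 \/ j = -1 by move: j1; clear; lia.
by case: j3 jE Q0 => [|[|]] ->; clear; lia.
Qed.

Lemma finite_G X : X \in [:: 2; 3; 10]%N -> finitely_many admG polyG (T8 X).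
Proof.
move=> XG; have [B HB] := bounded_product.
(* If [D P] or [D Q] is a square, then [|a| <= 12], and [b = P - 2 + 2 a = Q - 2 - 2 a] gives
   [|b| <= 34]; the term in [B] covers [D P Q]. If [P Q] is a square, then [P = Q], that is
   [a = 0]. *)
apply: (@finitely_many_of_bound _ _ _ (34 + 3 * `|B|)) => a b a0 mg gal.
have [sP sQ sD] := monogenicG_sqf mg.
have [PQ|DP|DQ|DPQ] := finG_square XG gal.
- by case: a0; have := sqf_mul_sqr sP sQ PQ; clear; lia.
- have [] := @sqf_quotient _ _ (a - 4) sP sD _ DP; first by ring.
  clear; lia.
- have [] := @sqf_quotient _ _ (a + 4) sQ sD _ DQ; first by ring.
  clear; lia.
have [] := HB a _ _ _ sP sQ sD _ _ DPQ; [by ring | by ring |].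
clear; lia.
Qed.

Lemma finite_G4 : finitely_many admG polyG (T8 4).
Proof.
apply: (@finitely_many_of_bound _ _ _ 100) => a b a0 mg gal.
have [sP sQ sD] := monogenicG_sqf mg; have D0 := sqf_le_neq0 (isT : (0 : int) <= 2) sD.
have Q0 := sqf_le_neq0 (isT : (0 : int) <= 1) sQ; have P0 := sqf_le_neq0 (isT : (0 : int) <= 1) sP.
have [PQ|/(sqf_sqr sP) P1|/(sqf_sqr sQ) Q1] := finG_square4 D0 gal.
- by case: a0; have := sqf_mul_sqr sP sQ PQ; clear; lia.
- have [[k kE]|[k kE]] := finG_squareP D0 Q0 P1 gal; rewrite mulrC in kE;
    have [j jE] := sqf_dvd sQ kE.
    (* Here [Q = 4 a + 1] and [6 - a = Q j^2]; multiplying the latter by 4 and eliminating [a]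
       leaves a divisor of 25. The other three cases are analogous. *)
    have E : (b + 2 + 2 * a) * (4 * j ^+ 2 + 1) = 25 by move: jE P1; clear; nia.
    have nz : 4 * j ^+ 2 + 1 != 0 by move: (sqr_ge0 j); clear; lia.
    have := norm_mul_ge (b + 2 + 2 * a) nz; rewrite E.
    by have := sqr_ge0 j; move: P1; clear; lia.
  have E : (b + 2 + 2 * a) * (4 * j ^+ 2 + 1) = 9 by move: jE P1; clear; nia.
  have nz : 4 * j ^+ 2 + 1 != 0 by move: (sqr_ge0 j); clear; lia.
    have := norm_mul_ge (b + 2 + 2 * a) nz; rewrite E.
  by have := sqr_ge0 j; move: P1; clear; lia.
have [[k kE]|[k kE]] := finG_squareQ D0 P0 Q1 gal; rewrite mulrC in kE;
    have [j jE] := sqf_dvd sP kE.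
  have E : (b + 2 - 2 * a) * (1 - 4 * j ^+ 2) = 9 by move: jE Q1; clear; nia.
  have nz : 1 - 4 * j ^+ 2 != 0 by move: (sqr_ge0 j); clear; lia.
have := norm_mul_ge (b + 2 - 2 * a) nz; rewrite E.
  by have := sqr_ge0 j; move: Q1; clear; lia.
have E : (b + 2 - 2 * a) * (1 - 4 * j ^+ 2) = 25 by move: jE Q1; clear; nia.
have nz : 1 - 4 * j ^+ 2 != 0 by move: (sqr_ge0 j); clear; lia.
have := norm_mul_ge (b + 2 - 2 * a) nz; rewrite E.
by have := sqr_ge0 j; move: Q1; clear; lia.
Qed.

Theorem theorem1p1 :
  [/\ (forall X : nat, X \in [:: 9; 15; 17; 26]%N ->
         infinite_family admF polyF (T8 X)),
      (forall X : nat, X \in [:: 2; 3; 4; 6; 8; 11; 16; 22]%N ->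
         finitely_many admF polyF (T8 X)),
      (forall X : nat, X \in [:: 9; 18]%N ->
         infinite_family admG polyG (T8 X))
    & (forall X : nat, X \in [:: 2; 3; 4; 10]%N ->
         finitely_many admG polyG (T8 X))].
Proof.
split=> X.
- rewrite !inE => /or4P [] /eqP ->.
  + exact: infinite_F9.
  + exact: infinite_F15.
  + exact: infinite_F17.
  exact: infinite_F26.
- exact: finite_F.
- rewrite !inE => /orP [] /eqP ->; [exact: infinite_G9 | exact: infinite_G18].
have [-> _|X4] := eqVneq X 4%N; first exact: finite_G4.
by move=> HX; apply: finite_G; move: HX; rewrite !inE (negPf X4).
Qed.
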